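(* On a compact set $X \subseteq \mathbb{R}^n$ (with the Euclidean metric) of nonzero Lebesgue measure, the uniform measure exists and is equal to Lebesgue measure restricted to $X$, normalised to a probability measure.
   Context: For a metric space $X = (X,d)$ and $t>0$, $tX$ is the set $X$ with the metric $t d$. $P(X)$ is the set of (Radon) probability measures on $X$, with the weak* topology as a subset of the dual of $C(X)$. For a compact metric space $X=(X,d)$ and $\mu \in P(X)$, put $(K\mu)(x) = \int_X e^{-d(x,y)}\, d\mu(y)$. The diversity of order $q \in [0,\infty]$ of $\mu$ is $D_q^X(\mu) = \left( \int_X (K\mu)^{q-1}\, d\mu \right)^{1/(1-q)}$ for $q \neq 1,\infty$; $D_1^X(\mu) = \exp\left(-\int_X \log(K\mu)\, d\mu\right)$; $D_\infty^X(\mu) = 1/\operatorname{ess\,sup}_\mu K\mu$. A probability measure $\mu$ on $X$ is maximising if for every $q \in [0,\infty]$ it maximises $D_q^X$ over $P(X)$. The maximising measures on $tX$ are those defined with respect to the metric $td$ (kernel $e^{-t d(x,y)}$), regarded as probability measures on the fixed set $X$. Uniform measure: suppose that $tX$ has a unique maximising measure $\mu_t$ for all sufficiently large $t$, and that $\lim_{t\to\infty}\mu_t$ exists in $P(X)$. Then the uniform measure on $X$ is said to exist, and it is $\mu_X = \lim_{t\to\infty}\mu_t$. *)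

(* Defs.v *)
From HB Require Import structures.
From mathcomp Require Import all_boot all_order all_algebra.
From mathcomp Require Import ring lra.
From mathcomp Require Import all_classical all_reals all_analysis.
From mathcomp Require Import measurable_realfun ess_sup_inf.

Set Implicit Arguments.
Unset Strict Implicit.
Unset Printing Implicit Defensive.

Import Order.TTheory GRing.Theory Num.Theory.
Import numFieldNormedType.Exports.

Local Open Scope classical_set_scope.
Local Open Scope ring_scope.

(* Metric spaces equipped with their Borel sigma-algebra. *)
HB.mixin Record isBorel (d : measure_display) (T : Type)
    & Measurable d T & Topological T := {
  borel_measurableE : @measurable d T = <<s @open T >>
}.

#[short(type="borelMetricType")]
HB.structure Definition BorelMetric (d : measure_display) (R : realType) :=
  { T of Measurable d T & Metric R T & isBorel d T }.

Section euclidean_space.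
Variables (R : realType) (n : nat).

(* R^n with the Euclidean metric; the topology is the one induced by that metric
   and the sigma-algebra is the product one (Borel by [euclidean_borelE]). *)
Definition euclidean : Type := n.-tuple (measurableTypeR R).

HB.instance Definition _ := Choice.copy euclidean (n.-tuple R).
HB.instance Definition _ :=
  Measurable.copy euclidean (n.-tuple (measurableTypeR R)).

Implicit Types x y z : euclidean.

Definition edist x y : R :=
  Num.sqrt (\sum_(i < n) (tnth x i - tnth y i) ^+ 2).

Lemma edist_ge0 x y : 0 <= edist x y.
Proof. exact: sqrtr_ge0. Qed.

Lemma edist_sq x y : edist x y ^+ 2 = \sum_(i < n) (tnth x i - tnth y i) ^+ 2.
Proof. by rewrite sqr_sqrtr// sumr_ge0// => i _; exact: sqr_ge0. Qed.

Lemma edistxx x : edist x x = 0.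
Proof. by rewrite /edist big1 ?sqrtr0// => i _; rewrite subrr expr0n. Qed.

Lemma edist_sym x y : edist x y = edist y x.
Proof. by congr Num.sqrt; apply: eq_bigr => i _; rewrite -sqrrN opprB. Qed.

Lemma edist_coord x y (i : 'I_n) : `|tnth x i - tnth y i| <= edist x y.
Proof.
rewrite -sqrtr_sqr ler_wsqrtr// (bigD1 i)//= lerDl sumr_ge0// => j _.
exact: sqr_ge0.
Qed.

Lemma edist_eq0 x y : edist x y = 0 -> x = y.
Proof.
move=> xy0; apply: eq_from_tnth => i; apply/eqP.
by rewrite -subr_eq0 -normr_le0 -xy0 edist_coord.
Qed.

Lemma cauchy_schwarz_sum (a b : 'I_n -> R) :
  \sum_i a i * b i <=
    Num.sqrt (\sum_i a i ^+ 2) * Num.sqrt (\sum_i b i ^+ 2).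
Proof.
set A := \sum_i a i ^+ 2; set B := \sum_i b i ^+ 2; set C := \sum_i a i * b i.
have A0 : 0 <= A by apply: sumr_ge0 => i _; exact: sqr_ge0.
have B0 : 0 <= B by apply: sumr_ge0 => i _; exact: sqr_ge0.
have key s : 0 <= A * s ^+ 2 + C * s *+ 2 + B.
  have -> : A * s ^+ 2 + C * s *+ 2 + B = \sum_i (a i * s + b i) ^+ 2.
    rewrite !mulr_suml -sumrMnl -!big_split/=; apply: eq_bigr => i _.
    by ring.
  by apply: sumr_ge0 => i _; exact: sqr_ge0.
rewrite -sqrtrM//; apply: le_trans (ler_norm _) _.
rewrite -sqrtr_sqr ler_wsqrtr//.
have [A00|An0] := eqVneq A 0.
  have := key (- (B + 1) / C); have [->|C0] := eqVneq C 0.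
    by rewrite expr0n/= mulr_ge0.
  rewrite A00 mul0r add0r mulrCA divff// mulr1 => h; exfalso.
  by move: h B0; lra.
have := key (- C / A).
have -> : A * (- C / A) ^+ 2 + C * (- C / A) *+ 2 + B = B - C ^+ 2 / A.
  by field.
by rewrite subr_ge0 ler_pdivrMr ?lt0r ?An0// mulrC.
Qed.

Lemma edist_triangle y x z : edist x z <= edist x y + edist y z.
Proof.
rewrite -[leRHS]ger0_norm ?addr_ge0 ?edist_ge0// -[leRHS]sqrtr_sqr.
rewrite /edist ler_wsqrtr// sqrrD !edist_sq.
have -> : \sum_(i < n) (tnth x i - tnth z i) ^+ 2 =
    \sum_(i < n) (tnth x i - tnth y i) ^+ 2 +
    (\sum_(i < n) (tnth x i - tnth y i) * (tnth y i - tnth z i)) *+ 2 +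
    \sum_(i < n) (tnth y i - tnth z i) ^+ 2.
  rewrite -sumrMnl -!big_split/=; apply: eq_bigr => i _.
  by rewrite -sqrrD addrA subrK.
by rewrite lerD2r lerD2l lerMn2r; exact: cauchy_schwarz_sum.
Qed.

HB.instance Definition _ :=
  @isMetric.Build R euclidean edist edistxx edist_eq0 edist_sym edist_triangle.

Lemma edist_le x y (e : R) : 0 <= e ->
  (forall i, `|tnth x i - tnth y i| <= e) -> edist x y <= n.+1%:R * e.
Proof.
move=> e0 xy; rewrite -[leRHS]ger0_norm ?mulr_ge0// -[leRHS]sqrtr_sqr.
rewrite ler_wsqrtr//; apply: (@le_trans _ _ (\sum_(i < n) e ^+ 2)).
  by apply: ler_sum => i _; rewrite -real_normK ?num_real// ler_pXn2r// nnegrE.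
rewrite sumr_const card_ord -[leLHS]mulr_natl exprMn ler_wpM2r ?sqr_ge0//.
by rewrite -natrX ler_nat (leq_trans (leqnSn n))// leq_pmulr.
Qed.

End euclidean_space.

Section euclidean_borel.
Variables (R : realType) (n : nat).
Implicit Types x y : euclidean R n.

Lemma tnth_continuous (i : 'I_n) :
  continuous (fun x : euclidean R n => tnth x i : R).
Proof.
move=> x; apply/(@cvgrPdist_lt _ _ _ (nbhs x) (nbhs_filter x)) => e e0.
apply/(@metricType_numDomainType.nbhs_mdistP R (euclidean R n)); exists e => //= y.
by apply: le_lt_trans; exact: edist_coord.
Qed.

Lemma measurable_edist x : measurable_fun [set: euclidean R n] (@edist R n x).
Proof.
apply: (@measurableT_comp _ _ _ _ _ _ (@Num.sqrt R)).
  by apply: continuous_measurable_fun => ?; exact: sqrt_continuous.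
apply: measurable_sum => i; apply: measurable_funX; apply: measurable_funB => //.
exact: measurable_tnth.
Qed.

Lemma euclidean_borelE :
  @measurable _ (euclidean R n) = <<s @open (euclidean R n) >>.
Proof.
apply/seteqP; split.
  apply: smallest_sub; first exact: smallest_sigma_algebra.
  rewrite -bigcup_seq; apply: bigcup_sub => i _.
  have : measurable_fun setT
      (fun x : g_sigma_algebraType (@open (euclidean R n)) => tnth x i : R).
    apply: (measurability _ (RGenOpens.measurableE R)).
    move=> _ [_ [a [b ->] <-]]; rewrite setTI; apply: sub_sigma_algebra.
    by apply: open_comp; [move=> ? _; exact: tnth_continuous|exact: interval_open].
  by move=> mi _ [B mB <-]; exact: mi.
apply: smallest_sub; first exact: sigma_algebra_measurable.
move=> A oA.
pose c (q : n.-tuple rat) : euclidean R n := map_tuple (@ratr R) q.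
pose B (qk : n.-tuple rat * nat) :=
  if pselect ([set x | edist (c qk.1) x < qk.2.+1%:R^-1] `<=` A)
  then [set x | edist (c qk.1) x < qk.2.+1%:R^-1] else set0.
have -> : A = \bigcup_qk B qk.
  apply/seteqP; split; last by move=> x [qk _]; rewrite /B; case: pselect => //; apply.
  move=> x Ax; have := oA; rewrite openE => /(_ _ Ax).
  move=> /(@metricType_numDomainType.nbhs_mdistP R (euclidean R n))[e /= e0 eA].
  have [k kE] : exists k, 2 * k.+1%:R^-1 < e.
    exists (Num.truncn (2 / e)); rewrite ltr_pdivrMr// mulrC -ltr_pdivrMr//.
    exact: truncnS_gt.
  pose d : R := k.+1%:R^-1 / 2 / n.+1%:R.
  have d0 : 0 < d by rewrite !divr_gt0// invr_gt0.
  have /choice[f fP] : forall i : 'I_n, exists q : rat, `|ratr q - tnth x i| <= d.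
    move=> i; have /rat_in_itvoo[q] : tnth x i - d < tnth x i + d by lra.
    by rewrite in_itv/= => qd; exists q; rewrite ler_norml; lra.
  have qx : edist (c [tuple f i | i < n]) x < k.+1%:R^-1.
    apply: (@le_lt_trans _ _ (n.+1%:R * d)).
      by apply: edist_le (ltW d0) _ => i; rewrite !tnth_map tnth_ord_tuple.
    rewrite mulrC divfK ?pnatr_eq0//.
    by rewrite ltr_pdivrMr// ltr_pMr ?invr_gt0// ltr1n.
  exists ([tuple f i | i < n], k) => //; rewrite /B; case: pselect => //= -[] y/= qy.
  apply: eA => /=; apply: le_lt_trans kE.
  apply: le_trans (edist_triangle (c [tuple f i | i < n]) _ _) _.
  by rewrite edist_sym mulr2n mulrDl mul1r lerD// ltW.
apply: (countable_bigcupT_measurable (countableP _)) => qk; rewrite /B; case: pselect => //= _.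
rewrite (_ : mkset _ = edist (c qk.1) @^-1` `]-oo, qk.2.+1%:R^-1[).
  by rewrite -[X in measurable X]setTI; exact: measurable_edist.
by apply/seteqP; split => y /=; rewrite in_itv.
Qed.

HB.instance Definition _ := isBorel.Build _ (euclidean R n) euclidean_borelE.

End euclidean_borel.

(* Lebesgue measure on R^n, by recursion on n: the point mass on R^0, and the
   image of the product measure under R x R^n -> R^(n+1), (a, v) |-> a :: v. *)
Section lebesgue_measure_euclidean.
Variable R : realType.

Section step.
Variables (n : nat) (m : {sigma_finite_measure set (euclidean R n) -> \bar R}).

Definition cons_euclidean (p : measurableTypeR R * euclidean R n) :
  euclidean R n.+1 := [tuple of p.1 :: p.2].

Lemma measurable_cons_euclidean : measurable_fun setT cons_euclidean.
Proof. exact: (measurable_cons measurable_fst measurable_snd). Qed.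

Definition lebesgue_step : set (euclidean R n.+1) -> \bar R :=
  pushforward (@lebesgue_measure R \x m)%E cons_euclidean.

Let prod : {measure set (measurableTypeR R * euclidean R n) -> \bar R} :=
  (@lebesgue_measure R \x m)%E.

Let lebesgue_step0 : lebesgue_step set0 = 0%E.
Proof. exact: (measure0 prod). Qed.

Let lebesgue_step_ge0 A : (0 <= lebesgue_step A)%E.
Proof. exact: (measure_ge0 prod). Qed.

Let lebesgue_step_sigma_additive : semi_sigma_additive lebesgue_step.
Proof.
move=> F mF tF mUF; rewrite /lebesgue_step/pushforward preimage_bigcup.
apply: (@measure_semi_sigma_additive _ _ _ prod).
- by move=> k; rewrite -[X in measurable X]setTI; exact: measurable_cons_euclidean.
- apply/trivIsetP => /= i j _ _ ij; rewrite -preimage_setI.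
  by move/trivIsetP : tF => /(_ _ _ _ _ ij) ->//; rewrite preimage_set0.
- rewrite -preimage_bigcup -[X in measurable X]setTI.
  exact: measurable_cons_euclidean.
Qed.

HB.instance Definition _ := isMeasure.Build _ _ _ lebesgue_step
  lebesgue_step0 lebesgue_step_ge0 lebesgue_step_sigma_additive.

Lemma sigma_finite_lebesgue_step : sigma_finite setT lebesgue_step.
Proof.
have /sigma_finiteP[F [TF ndF Foo]] := sigma_finiteT (@lebesgue_measure R).
have /sigma_finiteP[G [TG ndG Goo]] := sigma_finiteT m.
exists (fun k => [set x : euclidean R n.+1 |
    F k (thead x) /\ G k [tuple of behead x]]).
  apply/seteqP; split => // x _.
  have : [set: R] (thead x) by []; rewrite TF => -[k _ Fk].
  have : [set: euclidean R n] [tuple of behead x] by []; rewrite TG => -[l _ Gl].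
  exists (maxn k l) => //; split.
    by move: Fk; exact/subsetPset/ndF/leq_maxl.
  by move: Gl; exact/subsetPset/ndG/leq_maxr.
move=> k; have [mF Fk] := Foo k; have [mG Gk] := Goo k; split.
  apply: measurableI.
    rewrite -[X in measurable X]setTI.
    exact: (@measurable_tnth _ (measurableTypeR R) n.+1 ord0).
  rewrite -[X in measurable X]setTI.
  exact: (@measurable_behead _ (measurableTypeR R) n).
rewrite /lebesgue_step /pushforward (_ : _ @^-1` _ = F k `*` G k).
  by rewrite product_measure1E// lte_mul_pinfty// ge0_fin_numE.
apply/funext => -[a t]; rewrite /preimage /mkset.
have -> // : [tuple of behead (cons_euclidean (a, t))] = t :> euclidean R n.
exact/val_inj.
Qed.

HB.instance Definition _ := Measure_isSigmaFinite.Build _ _ _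
  lebesgue_step sigma_finite_lebesgue_step.
End step.

Fixpoint lebesgue_euclidean (n : nat) :
    {sigma_finite_measure set (euclidean R n) -> \bar R} :=
  match n with
  | 0 => \d_([tuple] : euclidean R 0)
  | k.+1 => lebesgue_step (lebesgue_euclidean k)
  end.

End lebesgue_measure_euclidean.

(* A compact metric space is given here as a compact subset X of an ambient
   metric space T, and a Borel probability measure on X as one on T that gives X
   mass 1; on a compact metric space all Borel probability measures are Radon.
   The metric [dist] is a separate argument so that it can be rescaled.
   For compact X and mu in P(X), all the integrals below are finite and K mu is
   bounded away from 0 on X, so that the real-valued operations are meaningful. *)
Section diversity.
Context {d : measure_display} {R : realType} {T : borelMetricType d R}.
Implicit Types (dist : T -> T -> R) (X : set T) (mu nu : probability T R).

Definition prob_on X : set (probability T R) := [set mu | mu X = 1%E].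

Definition Kmu dist X mu (x : T) : R := \int[mu]_(y in X) expR (- dist x y).

(* Orders range over [0, +oo]; the value at -oo is irrelevant. *)
Definition diversity dist X (q : \bar R) mu : R :=
  match q with
  | r%:E =>
      if r == 1 then expR (- \int[mu]_(x in X) ln (Kmu dist X mu x))
      else (\int[mu]_(x in X) (Kmu dist X mu x `^ (r - 1))) `^ (1 - r)^-1
  | +oo%E => (fine (ess_sup mu (EFin \o Kmu dist X mu)))^-1
  | -oo%E => 0
  end.

Definition maximising dist X mu : Prop :=
  prob_on X mu /\
  forall q : \bar R, (0 <= q)%E -> forall nu, prob_on X nu ->
    diversity dist X q nu <= diversity dist X q mu.

(* Two measures are identified when they agree on measurable sets. *)
Definition unique_maximising dist X mu : Prop :=
  maximising dist X mu /\
  forall nu, maximising dist X nu ->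
    forall A, measurable A -> nu A = mu A.

Definition scaled_dist (t : R) (x y : T) : R := t * mdist x y.

(* Convergence to mu of a filter on P(X), tested against every f in C(X). *)
Definition weak_star_cvg X (F : set_system (probability T R)) mu : Prop :=
  forall f : T -> R, {within X, continuous f} ->
    (fun nu : probability T R => \int[nu]_(x in X) f x) @ F -->
      \int[mu]_(x in X) f x.

Definition is_uniform_measure X mu : Prop :=
  prob_on X mu /\
  exists mu_ : R -> probability T R,
    (\forall t \near +oo, unique_maximising (scaled_dist t) X (mu_ t)) /\
    weak_star_cvg X (mu_ t @[t --> +oo]) mu.

End diversity.

(* Main.v *)
(* Let <m, m'> be the bilinear form of the kernel e^(-t|x-y|) on finite signed
   measures. The kernel is a mixture of Gaussians, so the form is positive
   definite. If mu minimises <mu, mu> over P(X), with minimum e, then K mu >= e on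
   X and K mu = e mu-a.e., so all diversities of mu equal 1/e. For any nu, power
   means give D_q(nu) <= \int 1/K nu dnu, and this is at most 1/e; so mu is
   maximising. If nu is maximising too, D_2(nu) = 1/e says that <nu, nu> = e, hence
   <mu - nu, mu - nu> = 0 and nu = mu. The minimum exists because a measure on X is coded
   by the cumulative masses of an infinite tree of finer and finer nets, a
   compact space of codes on which the energy is continuous.

   Let c be the integral of the kernel over R^n, L the Lebesgue measure on X and V
   its mass. As t -> +oo, the kernel divided by c is an approximate identity.
   Testing mu_t against Lebesgue measure on the r-neighbourhood X_r of X gives
   e >= c (1 - o(1)) / |X_r|, while <L, mu_t> >= e V and <L, L> <= c V, whence
   <mu_t - L/V, mu_t - L/V> <= c (1/V - (1 - o(1)) / |X_r|). Testing mu_t - L/V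
   against Lebesgue measure on a neighbourhood of a closed F in X then gives
   limsup mu_t(F) <= |F| / V, which is weak convergence to L/V. *)
Require Import Defs.
From HB Require Import structures.
From mathcomp Require Import all_boot all_order all_algebra.
From mathcomp Require Import ring lra.
From mathcomp Require Import all_classical all_reals all_analysis.
From mathcomp Require Import measurable_realfun ess_sup_inf.
(* Imported again so that [edist] is the Euclidean distance of Defs and not the
   extended pseudometric of mathcomp-analysis. *)
Require Import Defs.

Set Implicit Arguments.
Unset Strict Implicit.
Unset Printing Implicit Defensive.

Import Order.TTheory GRing.Theory Num.Theory.
Import numFieldNormedType.Exports.

Local Open Scope classical_set_scope.
Local Open Scope ring_scope.

(** Positivity is obtained without Fourier transforms. The Gaussian of rate [s] is, up to a
    constant, a self-convolution, so its form is an integral of squares; [expR (- b) = 2 \int_0^oo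
    phi(v) expR (- b^2 / (2 v^2)) dv], with [phi] the standard normal density, carries this over to
    the exponential kernel. Definiteness uses many rates at once: if the exponential form vanishes
    at a signed measure, the Gaussian forms vanish for almost all mixing parameters, hence at
    arbitrarily large rates, and narrow Gaussians recover the masses of closed sets. The same
    mollification estimates, with the exponential kernel, drive the limit. Minimising over coded
    measures is enough, because the first-order conditions only use perturbations towards point
    masses, and these have codes. In the limit, the energy gap has to be weighed against the
    self-energy of the test measure. A free factor [s] divides the first and multiplies the second,
    so the choices are made in the order [eps], [s], radius, [t]. *)

Section bounded_measurable.
Context d (T : measurableType d) (R : realType).
Implicit Types (f g : T -> R) (m : {finite_measure set T -> \bar R}).

(** The bound holds everywhere, not almost everywhere: one function is then integrable for all
    finite measures at once, and sections inherit the bound. *)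
Definition bmeas f := measurable_fun setT f /\ exists M, forall x, `|f x| <= M.

Lemma bmeas_cst (c : R) : bmeas (fun=> c).
Proof. by split; [exact: measurable_cst|exists `|c|]. Qed.

Lemma bmeasD f g : bmeas f -> bmeas g -> bmeas (fun x => f x + g x).
Proof.
move=> [mf [M fM]] [mg [N gN]]; split; first exact: measurable_funD.
by exists (M + N) => x; rewrite (le_trans (ler_normD _ _))// lerD.
Qed.

Lemma bmeasM f g : bmeas f -> bmeas g -> bmeas (fun x => f x * g x).
Proof.
move=> [mf [M fM]] [mg [N gN]]; split; first exact: measurable_funM.
by exists (M * N) => x; rewrite normrM ler_pM.
Qed.

Lemma bmeas_indic (A : set T) : measurable A -> bmeas (\1_A : T -> R).
Proof.
move=> mA; split; first exact: measurable_indic.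
by exists 1 => x; rewrite indicE; case: (_ \in _); rewrite ?normr1 ?normr0.
Qed.

Lemma bmeas_integrable m f (A : set T) : measurable A -> bmeas f ->
  m.-integrable A (EFin \o f).
Proof.
move=> mA [mf [M fM]]; apply: measurable_bounded_integrable => //.
- by rewrite -ge0_fin_numE//; exact: fin_num_measure.
- exact: measurable_funTS.
- exists M; split; first exact: num_real.
  by move=> y My x _ /=; rewrite (le_trans (fM x))// ltW.
Qed.

End bounded_measurable.

(** * Bilinear forms of kernels on signed measures *)

Section signed_functional.
Context d (T : measurableType d) (R : realType).
Implicit Types (L : (T -> R) -> R) (f g : T -> R).

(* Integration against a finite signed measure, presented as a linear
   combination of finite measures with bounded densities. *)
Inductive signed : ((T -> R) -> R) -> Prop :=
| signed_base (m : {finite_measure set T -> \bar R}) g : bmeas g ->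
    signed (fun f => \int[m]_x (g x * f x))
| signedD L1 L2 : signed L1 -> signed L2 -> signed (fun f => L1 f + L2 f)
| signedZ c L : signed L -> signed (fun f => c * L f).

Lemma signed_linD L f g : signed L -> bmeas f -> bmeas g ->
  L (fun x => f x + g x) = L f + L g.
Proof.
move=> sL bf bg; elim: sL => {L} [m h bh|L1 L2 _ IH1 _ IH2|c L _ IH].
- under eq_Rintegral do rewrite mulrDr.
  by rewrite RintegralD//; apply: bmeas_integrable => //; exact: bmeasM.
- by rewrite IH1 IH2 addrACA.
- by rewrite IH mulrDr.
Qed.

Lemma signed_linZ L c f : signed L -> bmeas f ->
  L (fun x => c * f x) = c * L f.
Proof.
move=> sL bf; elim: sL => {L} [m h bh|L1 L2 _ IH1 _ IH2|c' L _ IH].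
- under eq_Rintegral do rewrite mulrCA.
  by rewrite RintegralZl//; apply: bmeas_integrable => //; exact: bmeasM.
- by rewrite IH1 IH2 mulrDr.
- by rewrite IH mulrCA.
Qed.

(** [C] bounds the total variation of the signed measure. It makes potentials bounded and carries
    dominating functions through [L] in [ip_mixture]. *)
Lemma signed_bound L : signed L -> exists2 C, 0 <= C &
  forall f M, bmeas f -> (forall x, `|f x| <= M) -> `|L f| <= C * M.
Proof.
elim=> {L} [m h bh|L1 L2 _ [C C0 IH1] _ [D D0 IH2]|c L _ [C C0 IH]].
- have [mh [N hN]] := bh; exists (`|N| * fine (m setT)).
    by rewrite mulr_ge0// fine_ge0.
  move=> f M bf fM.
  have bhf : bmeas (fun x => h x * f x) by exact: bmeasM.
  apply: le_trans (le_normr_Rintegral _ (bmeas_integrable _ _ bhf)) _ => //.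
  rewrite mulrAC -Rintegral_cst//; apply: le_Rintegral => //.
  + apply: bmeas_integrable => //; case: bhf => mhf [K hfK]; split.
      exact: measurableT_comp.
    by exists K => x; rewrite normr_id.
  + exact/bmeas_integrable/bmeas_cst.
  + by move=> x _; rewrite normrM ler_pM// (le_trans (hN x))// ler_norm.
- exists (C + D) => [|f M bf fM]; first exact: addr_ge0.
  by rewrite mulrDl (le_trans (ler_normD _ _))// lerD ?IH1 ?IH2.
- exists (`|c| * C) => [|f M bf fM]; first exact: mulr_ge0.
  by rewrite normrM -mulrA ler_wpM2l// IH.
Qed.

End signed_functional.

Section bmeas_section.
Context d d' (T : measurableType d) (Z : measurableType d') (R : realType).

Lemma bmeas_section1 (F : Z * T -> R) z : bmeas F -> bmeas (fun x => F (z, x)).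
Proof.
move=> [mF [M FM]]; split; last by exists M.
exact: (measurableT_comp mF (measurable_pair1 _)).
Qed.

Lemma bmeas_section2 (F : Z * T -> R) x : bmeas F -> bmeas (fun z => F (z, x)).
Proof.
move=> [mF [M FM]]; split; last by exists M.
exact: (measurableT_comp mF (measurable_pair2 _)).
Qed.

End bmeas_section.

Section signed_param.
Context d d' (T : measurableType d) (Z : measurableType d') (R : realType).
Implicit Types (L : (T -> R) -> R).

Lemma measurable_Rintegral_param (m : {finite_measure set T -> \bar R})
    (F : Z * T -> R) : bmeas F ->
  measurable_fun setT (fun z => \int[m]_x F (z, x)).
Proof.
move=> bF; have [mF [M FM]] := bF.
(* Tonelli asks for a nonnegative integrand: [F] is shifted by its bound [M], and the integral of
   the constant is subtracted again. *)
have M0 zx : 0 <= F zx + M by have := FM zx; rewrite ler_norml; lra.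
have -> : (fun z => \int[m]_x F (z, x)) =
    (fun z => \int[m]_x (F (z, x) + M) - M * fine (m setT)).
  apply/funext => z; rewrite RintegralD ?Rintegral_cst ?addrK//.
    exact/bmeas_integrable/bmeas_section1.
  exact/bmeas_integrable/bmeas_cst.
apply: measurable_funB; last exact: measurable_cst.
apply: measurableT_comp => //.
have := @measurable_fun_fubini_tonelli_F _ _ Z T R m (fun zx => (F zx + M)%:E).
apply=> [|zx]; last by rewrite lee_fin.
apply/measurable_EFinP/measurable_funD => //.
Qed.

Lemma bmeas_signed_param L (F : Z * T -> R) : signed L -> bmeas F ->
  bmeas (fun z => L (fun x => F (z, x))).
Proof.
move=> sL bF; split; last first.
  have [C C0 LC] := signed_bound sL; have [_ [M FM]] := bF.
  by exists (C * M) => z; apply: LC => //; exact: bmeas_section1.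
elim: sL => {L} [m h bh|L1 L2 _ IH1 _ IH2|c L _ IH].
- apply: (@measurable_Rintegral_param m (fun zx => h zx.2 * F zx)).
  apply: bmeasM => //; have [mh [M hM]] := bh; split; last by exists M.
  exact: measurableT_comp.
- exact: measurable_funD.
- exact: measurable_funM.
Qed.

(** Fubini for a signed functional and a sigma-finite [m]. Since [m] may be infinite, boundedness of
    [F] does not give integrability on the product; the uniform bound [C] on the sections does. *)
Lemma signed_integrable_param (m : {sigma_finite_measure set Z -> \bar R})
    L (F : T * Z -> R) (C : R) : signed L -> bmeas F ->
  (forall x, (\int[m]_z `|F (x, z)|%:E <= C%:E)%E) ->
  m.-integrable setT (fun z => (L (fun x => F (x, z)))%:E) /\
  L (fun x => \int[m]_z F (x, z)) = \int[m]_z L (fun x => F (x, z)).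
Proof.
move=> sL bF FC.
have [mF _] := bF.
have mFx x : measurable_fun setT (fun z => F (x, z)).
  exact: (measurableT_comp mF (measurable_pair1 _)).
have iFx x : m.-integrable setT (fun z => (F (x, z))%:E).
  apply/integrableP; split; first exact/measurable_EFinP.
  by rewrite (le_lt_trans (FC x))// ltry.
elim: sL => {L} [m1 h bh|L1 L2 _ [i1 IH1] _ [i2 IH2]|c L _ [i IH]].
- have [mh [N hN]] := bh.
  pose G (zx : Z * T) := h zx.2 * F (zx.2, zx.1).
  have bG : bmeas G.
    apply: bmeasM; split; [exact: measurableT_comp|by exists N| |].
      exact: (measurableT_comp mF (measurable_fun_pair measurable_snd measurable_fst)).
    by have [_ [M FM]] := bF; exists M.
  have iG : (m \x m1)%E.-integrable setT (EFin \o G).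
    apply/integrable21ltyP; first by apply/measurable_EFinP; case: bG.
    apply: (@le_lt_trans _ _ (\int[m1]_x (`|N| * `|C|)%:E)%E); last first.
      by rewrite integral_cst// ltey_eq fin_numM// fin_num_measure.
    apply: ge0_le_integral => //.
    + by move=> x _; apply: integral_ge0.
    + apply: (@measurable_fun_fubini_tonelli_G _ _ Z T R m (abse \o (EFin \o G))).
        by apply: measurableT_comp => //; apply/measurable_EFinP; case: bG.
      by move=> z; apply: abse_ge0.
    + move=> x _; rewrite EFinM.
      have -> : (fun z => `|(EFin \o G) (z, x)|%E) =
          (fun z => `|h x|%:E * `|F (x, z)|%:E)%E.
        by apply/funext => z; rewrite /G /= normrM EFinM.
      rewrite ge0_integralZl//; last first.
        by apply/measurable_EFinP; exact: measurableT_comp.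
      rewrite lee_pmul ?lee_fin//; first by apply: integral_ge0.
        by rewrite (le_trans (hN x))// ler_norm.
      by rewrite (le_trans (FC x))// lee_fin ler_norm.
  have GE z : (\int[m1]_x (G (z, x)))%:E = (\int[m1]_x (G (z, x))%:E)%E.
    rewrite fineK//; apply: integrable_fin_num => //.
    exact/bmeas_integrable/bmeas_section1.
  have GE' : (fun z => (\int[m1]_x (G (z, x)))%:E) =
             (fun z => \int[m1]_x (G (z, x))%:E)%E.
    by apply/funext => z; rewrite GE.
  split; first by rewrite GE'; exact: (integrable_fubini_F iG).
  rewrite /Rintegral -/(fubini_F _ _ _); congr fine.
  rewrite [RHS](_ : _ = \int[m]_z \int[m1]_x (G (z, x))%:E)%E; last first.
    by apply: eq_integral => z _; rewrite -GE.
  rewrite (Fubini iG); apply: eq_integral => x _.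
  rewrite EFinM fineK ?integrable_fin_num//.
  by rewrite -integralZl.
- split; first exact: (integrableD measurableT i1 i2).
  by rewrite RintegralD// IH1 IH2.
- split; first exact: (integrableZl measurableT c i).
  by rewrite RintegralZl// IH.
Qed.

End signed_param.

Section kernel_form.
Context d (T : measurableType d) (R : realType).
Implicit Types (L : (T -> R) -> R) (k : T * T -> R).

Definition ip k L1 L2 : R := L1 (fun x => L2 (fun y => k (x, y))).

Lemma bmeas_potential k L : signed L -> bmeas k ->
  bmeas (fun x => L (fun y => k (x, y))).
Proof. exact: (@bmeas_signed_param _ _ T T R L k). Qed.

(** Only [L2] is taken apart: its base case is an integral against a finite measure, through which
    [signed_integrable_param] moves any signed [L1]. *)
Lemma ip_Fubini k L1 L2 : signed L1 -> signed L2 -> bmeas k ->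
  ip k L1 L2 = L2 (fun y => L1 (fun x => k (x, y))).
Proof.
move=> s1 s2 bk.
have bk1 L x : bmeas (fun y => k (x, y)) by exact: bmeas_section1.
elim: s2 => {L2} [m g bg|L2 L2' s2 IH2 s2' IH2'|c L s IH].
- pose F (xy : T * T) := g xy.2 * k xy.
  have bF : bmeas F.
    apply: bmeasM => //; have [mg [N gN]] := bg.
    by split; [exact: measurableT_comp|exists N].
  have [_ [M FM]] := bF.
  have [|_] := @signed_integrable_param _ _ T T R m L1 F (M * fine (m setT)) s1 bF.
    move=> x; apply: (@le_trans _ _ (\int[m]_z M%:E)%E).
      apply: ge0_le_integral => //.
      + apply/measurable_EFinP; apply: measurableT_comp => //.
        exact: (@bmeas_section1 _ _ T T R F x bF).1.
      + by move=> y _; rewrite lee_fin.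
    by rewrite integral_cst// EFinM fineK// fin_num_measure.
  rewrite /F /ip /= => ->; apply: eq_Rintegral => y _.
  by rewrite signed_linZ//; exact: bmeas_section2.
- rewrite -IH2 -IH2' /ip signed_linD//.
  + exact: bmeas_potential s2 bk.
  + exact: bmeas_potential s2' bk.
- by rewrite -IH /ip signed_linZ//; exact: bmeas_potential s bk.
Qed.

Lemma ip_sym k L1 L2 : signed L1 -> signed L2 -> bmeas k ->
  (forall x y, k (x, y) = k (y, x)) -> ip k L1 L2 = ip k L2 L1.
Proof.
move=> s1 s2 bk sk; rewrite ip_Fubini// /ip.
by congr L2; apply/funext => y; congr L1; apply/funext => x.
Qed.

Lemma ipD k L L1 L2 : signed L -> signed L1 -> signed L2 -> bmeas k ->
  ip k L (fun f => L1 f + L2 f) = ip k L L1 + ip k L L2.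
Proof.
by move=> s s1 s2 bk; rewrite /ip signed_linD//;
  [exact: bmeas_potential s1 bk|exact: bmeas_potential s2 bk].
Qed.

Lemma ipZ k c L L1 : signed L -> signed L1 -> bmeas k ->
  ip k L (fun f => c * L1 f) = c * ip k L L1.
Proof. by move=> s s1 bk; rewrite /ip signed_linZ//; exact: bmeas_potential s1 bk. Qed.

(* Positive semidefiniteness for signed measures, not just finite point
   configurations. *)
Definition psd k := forall L, signed L -> 0 <= ip k L L.

Lemma ip_sub_sq k L1 L2 (s : R) : signed L1 -> signed L2 -> bmeas k ->
  (forall x y, k (x, y) = k (y, x)) ->
  ip k (fun f => L1 f + - s * L2 f) (fun f => L1 f + - s * L2 f) =
  ip k L1 L1 - 2 * s * ip k L1 L2 + s ^+ 2 * ip k L2 L2.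
Proof.
move=> s1 s2 bk sk.
have sZ : signed (fun f => - s * L2 f) by exact: signedZ.
rewrite ipD//; last exact: signedD.
rewrite ipZ//; last exact: signedD.
rewrite [ip k _ L1]ip_sym//; last exact: signedD.
rewrite [ip k _ L2]ip_sym//; last exact: signedD.
by rewrite !ipD// !ipZ// (ip_sym s2 s1)//; ring.
Qed.

(** Positivity as a quadratic inequality in [s]. Later choices of [s] are a perturbation that
    excludes a nonzero pairing, a total mass, reciprocals of volumes, and a free parameter. *)
Lemma psd_sub k L1 L2 (s : R) : signed L1 -> signed L2 -> bmeas k ->
  (forall x y, k (x, y) = k (y, x)) -> psd k ->
  0 <= ip k L1 L1 - 2 * s * ip k L1 L2 + s ^+ 2 * ip k L2 L2.
Proof.
move=> s1 s2 bk sk pk; rewrite -ip_sub_sq//.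
by apply: pk; apply: signedD => //; exact: signedZ.
Qed.

End kernel_form.

Section kernel_mixture.
Context d d' (T : measurableType d) (Z : measurableType d') (R : realType).
Variable m : {sigma_finite_measure set Z -> \bar R}.
Implicit Types (L : (T -> R) -> R).

(** [psi] dominates [G] uniformly in [y], so the integral over [z] can be exchanged with [L2] at
    fixed [x]; [D * psi] then dominates the result, which allows the exchange with [L1]. *)
Lemma ip_mixture L1 L2 (G : (T * Z) * T -> R) (psi : T * Z -> R) (C : R) :
  signed L1 -> signed L2 -> bmeas G -> measurable_fun setT psi ->
  (forall x y z, `|G (x, z, y)| <= psi (x, z)) ->
  (forall x, (\int[m]_z (psi (x, z))%:E <= C%:E)%E) ->
  m.-integrable setT (fun z => (ip (fun xy => G (xy.1, z, xy.2)) L1 L2)%:E) /\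
  ip (fun xy => \int[m]_z G (xy.1, z, xy.2)) L1 L2 =
    \int[m]_z ip (fun xy => G (xy.1, z, xy.2)) L1 L2.
Proof.
move=> s1 s2 bG mpsi Gpsi psiC.
have [mG [M GM]] := bG.
have psi0 x z : 0 <= psi (x, z) by exact: le_trans (Gpsi x x z).
have [D D0 L2D] := signed_bound s2.
have mpsix x : measurable_fun setT (fun z => psi (x, z)).
  exact: (measurableT_comp mpsi (measurable_pair1 _)).
pose H (xz : T * Z) := L2 (fun y => G (xz, y)).
have bH : bmeas H by exact: (@bmeas_signed_param _ _ T (T * Z)%type R L2 G).
have bGx (x : T) : bmeas (fun yz : T * Z => G (x, yz.2, yz.1)).
  split; last by exists M.
  apply: (measurableT_comp mG); apply: measurable_fun_pair => //.
  exact: measurable_fun_pair.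
have LH x : L2 (fun y => \int[m]_z G (x, z, y)) = \int[m]_z H (x, z).
  have [|_ <- //] := @signed_integrable_param _ _ T Z R m L2
    (fun yz => G (x, yz.2, yz.1)) C s2 (bGx x).
  move=> y; apply: le_trans (psiC x); apply: ge0_le_integral => //.
  - apply/measurable_EFinP; apply: measurableT_comp => //.
    exact: (bmeas_section1 y (bGx x)).1.
  - exact/measurable_EFinP.
  - by move=> z _; rewrite lee_fin.
have [|] := @signed_integrable_param _ _ T Z R m L1 H (D * C) s1 bH.
  move=> x; apply: (@le_trans _ _ (\int[m]_z (D%:E * (psi (x, z))%:E))%E).
    apply: ge0_le_integral => //.
    - apply/measurable_EFinP; apply: measurableT_comp => //.
      exact: (bmeas_section1 x bH).1.
    - by apply/measurable_EFinP; exact: measurable_funM.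
    - move=> z _; rewrite -EFinM lee_fin; apply: L2D => //.
      exact: (@bmeas_section1 _ _ T (T * Z)%type).
  rewrite ge0_integralZl//.
  - by rewrite EFinM lee_wpmul2l// lee_fin.
  - exact/measurable_EFinP.
  - by move=> z _; rewrite lee_fin; exact: psi0.
by move=> iH LHE; split => //; rewrite -LHE; congr L1; apply/funext => x; exact: LH.
Qed.

End kernel_mixture.

(** * Gaussian and exponential kernels *)

Section gaussian_kernel.
Variable R : realType.

Lemma integral_gauss_scaled (s u : R) : 0 < s ->
  (\int[@lebesgue_measure R]_x (expR (- s * (u - x) ^+ 2))%:E =
   (Num.sqrt (pi / s))%:E)%E.
Proof.
move=> s0.
(* The standard deviation with [1 / (2 * sg ^+ 2) = s]: the integrand is an unnormalised normal
   density, so its integral is the inverse of the peak. *)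
pose sg : R := Num.sqrt ((2 * s)^-1).
have sg2 : sg ^+ 2 = (2 * s)^-1 by rewrite sqr_sqrtr// invr_ge0 mulr_ge0// ltW.
have sgN0 : sg != 0 by rewrite sqrtr_eq0 -ltNge invr_gt0 mulr_gt0.
have pk0 := normal_peak_gt0 sgN0.
have pkE : (normal_peak sg)^-1 = Num.sqrt (pi / s).
  rewrite invrK; congr Num.sqrt; rewrite sg2 mulr2n; field.
  by rewrite gt_eqF.
have mpdf := measurable_normal_pdf u sg.
transitivity (\int[@lebesgue_measure R]_x
    ((normal_peak sg)^-1%:E * (normal_pdf u sg x)%:E))%E.
  apply: eq_integral => x _; rewrite normal_pdfE// -EFinM mulKf ?gt_eqF//.
  by congr (expR _)%:E; rewrite sg2 mulr2n; field; rewrite gt_eqF.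
rewrite ge0_integralZl//.
- by rewrite integral_normal_pdf mule1 pkE.
- exact/measurable_EFinP.
- by move=> x _; rewrite lee_fin normal_pdf_ge0.
- by rewrite lee_fin invr_ge0 normal_peak_ge0.
Qed.

Lemma measurable_edist2 n : measurable_fun setT
  (fun xy : euclidean R n * euclidean R n => edist xy.1 xy.2).
Proof.
apply: (@measurableT_comp _ _ _ _ _ _ (@Num.sqrt R)).
  by apply: continuous_measurable_fun => ?; exact: sqrt_continuous.
apply: measurable_sum => i; apply: measurable_funX; apply: measurable_funB => //.
  exact: (measurableT_comp (measurable_tnth i) measurable_fst).
exact: (measurableT_comp (measurable_tnth i) measurable_snd).
Qed.

(** Induction along the recursive construction of Lebesgue measure: the Gaussian is the product of
    its first coordinate factor and a Gaussian in the remaining ones. *)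
Lemma integral_gauss_euclidean n (s : R) (x : euclidean R n) : 0 < s ->
  (\int[lebesgue_euclidean R n]_z (expR (- s * edist x z ^+ 2))%:E =
   (Num.sqrt (pi / s) ^+ n)%:E)%E.
Proof.
move=> s0.
have mg k (y : euclidean R k) : measurable_fun setT
    (fun z => (expR (- s * edist y z ^+ 2))%:E).
  apply/measurable_EFinP; apply: measurableT_comp => //.
  by apply: measurable_funM => //; apply: measurable_funX; exact: measurable_edist.
elim: n x => [|n IHn] x.
  have -> : (\int[lebesgue_euclidean R 0]_z (expR (- s * edist x z ^+ 2))%:E =
      \int[\d_([tuple] : euclidean R 0)]_z (expR (- s * edist x z ^+ 2))%:E)%E by [].
  rewrite integral_dirac//; last exact: mg.
  by rewrite edist_sq big_ord0 mulr0 expR0 diracT mul1e expr0.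
have -> : (\int[lebesgue_euclidean R n.+1]_z (expR (- s * edist x z ^+ 2))%:E =
    \int[pushforward (@lebesgue_measure R \x lebesgue_euclidean R n)
          (@cons_euclidean R n)]_z (expR (- s * edist x z ^+ 2))%:E)%E by [].
rewrite (ge0_integral_pushforward (@measurable_cons_euclidean R n))//; last exact: mg.
rewrite preimage_setT.
pose x' : euclidean R n := [tuple of behead x].
pose f (p : measurableTypeR R * euclidean R n) : \bar R :=
  ((expR (- s * (thead x - p.1) ^+ 2))%:E *
   (expR (- s * edist x' p.2 ^+ 2))%:E)%E.
have mf1 : measurable_fun setT
    (fun a : measurableTypeR R => (expR (- s * (thead x - a) ^+ 2))%:E).
  apply/measurable_EFinP; apply: measurableT_comp => //; apply: measurable_funM => //.
  by apply: measurable_funX; exact: measurable_funB.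
have mf : measurable_fun setT f.
  apply: emeasurable_funM; first exact: measurableT_comp mf1 _.
  exact: measurableT_comp (mg n x') _.
transitivity (\int[@lebesgue_measure R \x lebesgue_euclidean R n]_p f p)%E.
  apply: eq_integral => -[a v] _; rewrite /f /= -EFinM -expRD -mulrDr !edist_sq.
  congr (expR (- s * _))%:E; rewrite big_ord_recl; congr (_ ^+ 2 + _).
  apply: eq_bigr => i _; congr ((_ - _) ^+ 2).
    by rewrite tnth_behead; congr (tnth x _); apply/val_inj; rewrite /= inordK ?ltnS.
  exact: tnthS.
rewrite fubini_tonelli1//; last by move=> p; rewrite mule_ge0// lee_fin expR_ge0.
transitivity (\int[@lebesgue_measure R]_a
  ((Num.sqrt (pi / s) ^+ n)%:E * (expR (- s * (thead x - a) ^+ 2))%:E))%E.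
  apply: eq_integral => a _; rewrite /fubini_F /f/= ge0_integralZl//=.
    by rewrite IHn muleC.
  exact: mg.
by rewrite ge0_integralZl// integral_gauss_scaled// -EFinM exprSr.
Qed.

Definition gaussk n (s : R) (xy : euclidean R n * euclidean R n) : R :=
  expR (- s * edist xy.1 xy.2 ^+ 2).

Lemma bmeas_gaussk n s : 0 <= s -> bmeas (@gaussk n s).
Proof.
move=> s0; split.
  apply: measurableT_comp => //; apply: measurable_funM => //.
  by apply: measurable_funX; exact: measurable_edist2.
exists 1 => xy; rewrite ger0_norm ?expR_ge0// -[leRHS]expR0 ler_expR.
by rewrite mulNr oppr_le0 mulr_ge0// sqr_ge0.
Qed.

Lemma gaussk_sym n s (x y : euclidean R n) : gaussk s (x, y) = gaussk s (y, x).
Proof. by rewrite /gaussk /= edist_sym. Qed.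

(** Markov's inequality for the Gaussian centred at [x]: it is at least [expR (- M ^+ 2)] on [A] and
    has a finite integral. *)
Lemma lebesgue_euclidean_bounded n (A : set (euclidean R n)) x (M : R) :
  measurable A -> (forall y, A y -> edist x y <= M) ->
  (lebesgue_euclidean R n A < +oo)%E.
Proof.
move=> mA AM; have bg := @bmeas_gaussk n 1 ler01.
have mg : measurable_fun setT (fun z => (gaussk 1 (x, z))%:E).
  by apply/measurable_EFinP; exact: (bmeas_section1 x bg).1.
apply: (@le_lt_trans _ _ (\int[lebesgue_euclidean R n]_z
    ((expR (M ^+ 2))%:E * (gaussk 1 (x, z))%:E))%E); last first.
  rewrite ge0_integralZl//; last by move=> z _; rewrite lee_fin expR_ge0.
  by rewrite integral_gauss_euclidean// -EFinM ltry.
rewrite -[leLHS]mul1e -integral_cst//.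
have ? : measurable_fun setT
    (fun z => ((expR (M ^+ 2))%:E * (gaussk 1 (x, z))%:E)%E).
  exact: emeasurable_funM.
apply: (@le_trans _ _ (\int[lebesgue_euclidean R n]_(z in A)
    ((expR (M ^+ 2))%:E * (gaussk 1 (x, z))%:E))%E).
  apply: ge0_le_integral => //.
  - exact: measurable_funTS.
  - move=> z Az; rewrite -EFinM lee_fin -expRD -[leLHS]expR0 ler_expR mulN1r.
    by rewrite subr_ge0/= ler_pXn2r ?AM// nnegrE ?edist_ge0// (le_trans _ (AM z Az))// edist_ge0.
apply: ge0_subset_integral => //.
by move=> z _; rewrite mule_ge0// lee_fin expR_ge0.
Qed.

Lemma ip_kernelZ d (T : measurableType d) (k : T * T -> R) c L1 L2 :
  signed L1 -> signed L2 -> bmeas k ->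
  ip (fun xy => c * k xy) L1 L2 = c * ip k L1 L2.
Proof.
move=> s1 s2 bk; rewrite /ip -signed_linZ//; last exact: bmeas_potential s2 bk.
congr L1; apply/funext => x; rewrite signed_linZ//; exact: bmeas_section1.
Qed.

Definition midpoint n (x y : euclidean R n) : euclidean R n :=
  [tuple (tnth x i + tnth y i) / 2 | i < n].

(** Apollonius' identity. It turns a product of Gaussians centred at [x] and [y] into a Gaussian of
    [edist x y] times one centred at the midpoint. *)
Lemma edist_midpoint n (x y z : euclidean R n) :
  2 * edist x z ^+ 2 + 2 * edist y z ^+ 2 =
  edist x y ^+ 2 + 4 * edist (midpoint x y) z ^+ 2.
Proof.
rewrite !edist_sq !mulr_sumr -!big_split /=; apply: eq_bigr => i _.
by rewrite tnth_mktuple; field.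
Qed.

(** Integrating [psi (x, z) * psi (y, z)] over [z], with [psi] of rate [2 * s], gives [c] times the
    Gaussian of rate [s]. Hence [c] times the form is the integral over [z] of the square of
    [L (fun x => psi (x, z))]. *)
Lemma psd_gaussk n (s : R) : 0 < s -> psd (@gaussk n s).
Proof.
move=> s0 L sL.
pose psi (xz : euclidean R n * euclidean R n) := gaussk (2 * s) xz.
have s20 : 0 <= 2 * s by rewrite mulr_ge0// ltW.
have bpsi : bmeas psi by exact: bmeas_gaussk.
have psi01 xz : 0 <= psi xz <= 1.
  rewrite expR_ge0 -[leRHS]expR0 ler_expR mulNr oppr_le0 mulr_ge0 ?sqr_ge0//.
pose G (xzy : euclidean R n * euclidean R n * euclidean R n) : R :=
  psi xzy.1 * psi (xzy.2, xzy.1.2).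
have bG : bmeas G.
  have [mpsi [M psiM]] := bpsi; apply: bmeasM; split.
  - exact: measurableT_comp.
  - by exists M.
  - apply: (measurableT_comp mpsi); apply: measurable_fun_pair => //.
    exact: measurableT_comp.
  - by exists M.
pose c := Num.sqrt (pi / (4 * s)) ^+ n.
have c0 : 0 < c by rewrite exprn_gt0// sqrtr_gt0 divr_gt0 ?pi_gt0// mulr_gt0.
have GE xy : \int[lebesgue_euclidean R n]_z G (xy.1, z, xy.2) = c * gaussk s xy.
  rewrite /Rintegral.
  have -> : (fun z => (G (xy.1, z, xy.2))%:E) = (fun z => (gaussk s xy)%:E *
      (expR (- (4 * s) * edist (midpoint xy.1 xy.2) z ^+ 2))%:E)%E.
    apply/funext => z; rewrite -EFinM /G /psi /gaussk/= -!expRD; congr (expR _)%:E.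
    have /(congr1 (fun u => - s * u)) := edist_midpoint xy.1 xy.2 z.
    by rewrite !mulrDr !mulrA !mulNr ![s * _]mulrC.
  rewrite ge0_integralZl//.
  - by rewrite integral_gauss_euclidean ?mulr_gt0// -EFinM /= mulrC.
  - apply/measurable_EFinP.
    apply: (bmeas_section1 (midpoint xy.1 xy.2) (@bmeas_gaussk n (4 * s) _)).1.
    by rewrite mulr_ge0// ltW.
  - by rewrite lee_fin expR_ge0.
have [||_] := @ip_mixture _ _ _ _ R (lebesgue_euclidean R n) L L G psi
  (Num.sqrt (pi / (2 * s)) ^+ n) sL sL bG bpsi.1.
- move=> x y z; have /andP[p0 _] := psi01 (x, z).
  have /andP[q0 q1] := psi01 (y, z).
  by rewrite ger0_norm ?mulr_ge0// ler_piMr.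
- by move=> x; rewrite integral_gauss_euclidean ?mulr_gt0.
rewrite (_ : (fun xy => _) = (fun xy => c * gaussk s xy)); last first.
  by apply/funext => xy; rewrite GE.
rewrite ip_kernelZ//; last exact/bmeas_gaussk/ltW.
move=> cE; rewrite -(pmulr_rge0 _ c0) cE; apply: Rintegral_ge0 => z _.
have bpz : bmeas (fun x => psi (x, z)) by exact: bmeas_section2.
rewrite /ip /G /=.
rewrite (_ : (fun x => _) = (fun x => L (fun y => psi (y, z)) * psi (x, z))).
  by rewrite signed_linZ// -expr2 sqr_ge0.
by apply/funext => x; rewrite signed_linZ// mulrC.
Qed.

End gaussian_kernel.

(** * The exponential as a mixture of Gaussians *)

Section subordination.
Variable R : realType.
Notation leb := (@lebesgue_measure R).
Notation phi := (@normal_pdf R 0 1).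

Definition normal_cdf (x : R) : R := \int[leb]_(t in `]-oo, x]) phi t.

Lemma continuous_stdnormal : continuous phi.
Proof. by apply: continuous_normal_pdf; exact: oner_neq0. Qed.

Lemma is_derive_normal_cdf (x : R) : is_derive x 1 normal_cdf (phi x).
Proof.
have xx1 : x < x + 1 by rewrite ltrDl.
have iphi : leb.-integrable `]-oo, x + 1] (EFin \o phi).
  exact: integrableS (integrable_normal_pdf 0 1).
have [|dc cE] := continuous_FTC1 xx1 iphi _ (@continuous_stdnormal x).
  by rewrite ltNye.
by apply: (DeriveDef dc); rewrite -derive1E.
Qed.

(** The identity as a random variable of standard normal law; this makes [normal_cdf] a cumulative
    distribution function, with its limits at both infinities. *)
Let idR : measurableTypeR R -> R := idfun.
#[local] HB.instance Definition _ :=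
  @isMeasurableFun.Build _ _ _ _ idR (@measurable_id _ _ setT).

Let X : {RV (normal_prob (0 : R) 1) >-> R} := idR.

Lemma normal_cdfE x : (normal_cdf x)%:E = cdf X x.
Proof.
rewrite /normal_cdf /Rintegral fineK//; apply: integrable_fin_num => //.
exact: integrableS (integrable_normal_pdf 0 1).
Qed.

Let EFin_normal_cdf : EFin \o normal_cdf = cdf X.
Proof. by apply/funext => x; rewrite /= normal_cdfE. Qed.

Lemma normal_cdf_cvgy : normal_cdf x @[x --> +oo] --> (1 : R).
Proof. by have := cvg_cdfy1 X; rewrite -EFin_normal_cdf => /fine_cvg. Qed.

Lemma normal_cdf_cvgNy : normal_cdf x @[x --> -oo] --> (0 : R).
Proof. by have := cvg_cdfNy0 X; rewrite -EFin_normal_cdf => /fine_cvg. Qed.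

(* [H' = e^(-v^2/2 - b^2/(2v^2)) / sqrt(2pi)], since [(v +- b/v)^2/2] differs from
   [v^2/2 + b^2/(2v^2)] by [+- b]. *)
Let H (b v : R) : R := (expR b * normal_cdf (v + b / v) + expR (- b) * normal_cdf (v - b / v)) / 2.

(** At [v = 0] the plain formula would give [phi 0], since division by 0 yields 0. The value 0 is
    the right limit for [0 < b], as the fundamental theorem on [[0, +oo[] requires. *)
Let f (b v : R) : R := if v == 0 then 0 else phi v * expR (- (b ^+ 2 / (2 * v ^+ 2))).

Lemma is_derive_H (b v : R) : 0 < v -> is_derive v 1 (H b) (f b v).
Proof.
move=> v0; have vN0 : v != 0 by rewrite gt_eqF.
have dV : is_derive v 1 (fun w : R => w^-1) (- v ^- 2).
  by have := is_deriveV vN0 (is_derive_id v 1); rewrite /GRing.scale/= mulr1.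
have dbV : is_derive v 1 (fun w : R => b / w) (- (b / v ^+ 2)).
  have := is_deriveZ b dV; rewrite /GRing.scale/= mulrN.
  by [].
have dp : is_derive v 1 (fun w : R => w + b / w) (1 - b / v ^+ 2).
  exact: is_deriveD.
have dm : is_derive v 1 (fun w : R => w - b / w) (1 + b / v ^+ 2).
  have := is_deriveB (is_derive_id v 1) dbV; rewrite opprK.
  by [].
have dcp := @is_derive1_comp R normal_cdf (fun w => w + b / w) v _ _
  (is_derive_normal_cdf (v + b / v)) dp.
have dcm := @is_derive1_comp R normal_cdf (fun w => w - b / w) v _ _
  (is_derive_normal_cdf (v - b / v)) dm.
have dH := is_deriveZ 2^-1
  (is_deriveD (is_deriveZ (expR b) dcp) (is_deriveZ (expR (- b)) dcm)).
rewrite (_ : H b = 2^-1 \*: (expR b \*: (normal_cdf \o (fun w => w + b / w)) \+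
   expR (- b) \*: (normal_cdf \o (fun w => w - b / w)))); last first.
  by apply/funext => w; rewrite /H/= mulrC.
apply: is_derive_eq dH _; rewrite /f (negbTE vN0) /GRing.scale/=.
(* Used for [c = b] and [c = - b]: both terms carry the same density, and the inner derivatives
   [1 - b / v ^+ 2] and [1 + b / v ^+ 2] add up to 2, which cancels the division by 2 in [H]. *)
have fE c : expR c * phi (v + c / v) = phi v * expR (- (c ^+ 2 / (2 * v ^+ 2))).
  rewrite !normal_pdfE ?oner_neq0// /normal_fun !subr0 expr1n.
  rewrite mulrCA -mulrA; congr (_ * _); rewrite -!expRD; congr expR.
  by rewrite mulr2n; field.
have := fE (- b); rewrite mulNr sqrrN => fNE.
by rewrite mulrA fE (mulrA (expR (- b))) fNE; field.
Qed.

Let H_cvgy (b : R) : 0 <= b -> H b v @[v --> +oo] --> (expR b + expR (- b)) / 2.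
Proof.
move=> b0; apply: cvgM; last exact: cvg_cst.
apply: cvgD; rewrite -[X in _ --> X]mulr1; apply: cvgM; try exact: cvg_cst.
- apply: (@cvg_comp _ _ _ (fun v => v + b / v) normal_cdf) normal_cdf_cvgy.
  apply/cvgryPge => A; near=> v.
  have v0 : 0 < v by near: v; apply: nbhs_pinfty_gt; exact: num_real.
  have vA : A <= v by near: v; apply: nbhs_pinfty_ge; exact: num_real.
  by rewrite ler_wpDr// divr_ge0// ltW.
- apply: (@cvg_comp _ _ _ (fun v => v - b / v) normal_cdf) normal_cdf_cvgy.
  apply/cvgryPge => A; near=> v.
  have v1 : 1 <= v by near: v; apply: nbhs_pinfty_ge; exact: num_real.
  have vA : A + b <= v by near: v; apply: nbhs_pinfty_ge; exact: num_real.
  have : b / v <= b by rewrite ler_pdivrMr ?(lt_le_trans ltr01)// ler_peMr.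
  by lra.
Unshelve.
all: by end_near.
Qed.

(** Near 0 the arguments [v + b / v] and [v - b / v] tend to opposite infinities, so only the first
    term survives. At [+oo] both survive, and the difference of the two limits is
    [expR (- b) / 2]. *)
Let H_cvg0 (b : R) : 0 < b -> H b v @[v --> 0^'+] --> expR b / 2.
Proof.
move=> b0; rewrite [X in _ --> X](_ : _ = (expR b * 1 + expR (- b) * 0) / 2); last by ring.
apply: cvgM; last exact: cvg_cst.
apply: cvgD; apply: cvgM; try exact: cvg_cst.
- apply: (@cvg_comp _ _ _ (fun v => v + b / v) normal_cdf) normal_cdf_cvgy.
  apply/cvgryPge => A; near=> v.
  have v0 : 0 < v by near: v; exact: nbhs_right_gt.
  rewrite ler_wpDl ?(ltW v0)// ler_pdivlMr//.
  have A0 : 0 < `|A| + 1 by rewrite ltr_wpDl.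
  apply: (@le_trans _ _ ((`|A| + 1) * v)).
    by rewrite ler_wpM2r ?(ltW v0)// ler_wpDr// ler_norm.
  rewrite mulrC -ler_pdivlMr//; near: v; apply: nbhs_right_ltW.
  by rewrite divr_gt0.
- apply: (@cvg_comp _ _ _ (fun v => v - b / v) normal_cdf) normal_cdf_cvgNy.
  apply/cvgrNyPle => A; near=> v.
  have v0 : 0 < v by near: v; exact: nbhs_right_gt.
  have v1 : v <= 1 by near: v; exact: nbhs_right_ltW.
  rewrite lerBlDr -lerBlDl ler_pdivlMr//.
  have A0 : 0 < `|1 - A| + 1 by rewrite ltr_wpDl.
  apply: (@le_trans _ _ ((`|1 - A| + 1) * v)).
    by rewrite ler_wpM2r ?(ltW v0)// (@le_trans _ _ (1 - A)) ?lerB// ler_wpDr// ler_norm.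
  rewrite mulrC -ler_pdivlMr//; near: v; apply: nbhs_right_ltW.
  by rewrite divr_gt0.
Unshelve.
all: by end_near.
Qed.

Let continuous_f (b v : R) : v != 0 -> {for v, continuous (f b)}.
Proof.
move=> v0; rewrite /prop_for /continuous_at {2}/f (negbTE v0).
have : (fun w => phi w * expR (- (b ^+ 2 / (2 * w ^+ 2)))) @ v -->
    phi v * expR (- (b ^+ 2 / (2 * v ^+ 2))).
  apply: cvgM; first exact: continuous_stdnormal.
  apply: (@cvg_comp _ _ _ (fun w => - (b ^+ 2 / (2 * w ^+ 2))) (@expR R) _
    (nbhs (- (b ^+ 2 / (2 * v ^+ 2))))); last exact: continuous_expR.
  apply: cvgN; apply: cvgM; first exact: cvg_cst.
  apply: cvgV; first by rewrite mulf_neq0// expf_neq0.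
  by apply: cvgM; [exact: cvg_cst|exact: exprn_continuous].
have v0' : \forall w \near v, w != 0.
  by apply: open_nbhs_nbhs; split => //; exact: open_neq.
apply: cvg_trans; apply: near_eq_cvg; apply: filterS v0' => w w0.
by rewrite /f (negbTE w0).
Qed.

Let f_cvg0 (b : R) : 0 < b -> f b v @[v --> 0^'+] --> f b 0.
Proof.
move=> b0; rewrite {2}/f eqxx.
pose pk : R := normal_peak 1.
have cvg0 : (fun v : R => pk * (2 / b ^+ 2 * v ^+ 2)) @ 0^'+ --> (0 : R).
  rewrite -[X in _ --> X](_ : pk * (2 / b ^+ 2 * 0 ^+ 2) = 0); last by rewrite expr0n/= !mulr0.
  apply: cvg_at_right_filter.
  apply: cvgM; first exact: cvg_cst.
  by apply: cvgM; [exact: cvg_cst|exact: exprn_continuous].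
apply: (@squeeze_cvgr _ _ _ _ (fun=> 0) (fun v => pk * (2 / b ^+ 2 * v ^+ 2))) => //; last first.
  exact: cvg_cst.
near=> v.
have v0 : 0 < v by near: v; exact: nbhs_right_gt.
rewrite /f gt_eqF// mulr_ge0 ?normal_pdf_ge0 ?expR_ge0//=.
apply: ler_pM; rewrite ?normal_pdf_ge0 ?expR_ge0 ?normal_pdf_ub ?oner_neq0//.
(* With this [u], the inequality [expR (- u) <= u^-1] is exactly the quadratic majorant chosen
   above. *)
set u := b ^+ 2 / (2 * v ^+ 2).
have u0 : 0 < u by rewrite divr_gt0 ?mulr_gt0 ?exprn_gt0.
have -> : 2 / b ^+ 2 * v ^+ 2 = u^-1 by rewrite /u; field; rewrite !gt_eqF.
rewrite expRN lef_pV2 ?posrE ?expR_gt0//.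
by apply: le_trans (expR_ge1Dx u); rewrite lerDr.
Unshelve.
all: by end_near.
Qed.

Lemma subordination (b : R) : 0 <= b ->
  (\int[leb]_(v in `]0%R, +oo[) (phi v * expR (- (b ^+ 2 / (2 * v ^+ 2))))%:E =
   (expR (- b) / 2)%:E)%E.
Proof.
rewrite le_eqVlt => /predU1P[<-|b0].
  (* For [b = 0] the function [f b] is not right continuous at 0; symmetry of the normal density
     gives the value 1/2 directly. *)
  rewrite oppr0 expR0 mul1r.
  under eq_integral do rewrite expr0n/= mul0r oppr0 expR0 mulr1.
  rewrite integral_itv_obnd_cbnd//; last first.
    by apply/measurable_EFinP/measurable_funTS; exact: measurable_normal_pdf.
  have symphi : phi =1 phi \o -%R.
    by move=> v; rewrite /= !normal_pdfE ?oner_neq0// /normal_fun !subr0 sqrrN.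
  have := @ge0_symfun_integralT R phi (normal_pdf_ge0 0 1) continuous_stdnormal.
  rewrite integral_normal_pdf -set_itvcy => /(_ symphi) h.
  have one2 : 1%E = ((2^-1)%:E * 2%:E)%E :> \bar R by rewrite -EFinM mulVf.
  by rewrite -[LHS]mul1e one2 -muleA -h mule1.
transitivity (\int[leb]_(v in `[0%R, +oo[) (f b v)%:E)%E.
  rewrite -integral_itv_obnd_cbnd//; last first.
    apply/measurable_EFinP; apply: open_continuous_measurable_fun => //.
    by move=> v; rewrite inE/= in_itv/= andbT => v0; apply: continuous_f; rewrite gt_eqF.
  apply: eq_integral => v; rewrite inE/= in_itv/= andbT => v0.
  by rewrite /f gt_eqF.
(* [H b 0] would be computed with [b / 0 = 0] and miss the limit; the primitive is given its right
   limit on [v <= 0]. *)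
pose F v : R := if v <= 0 then expR b / 2 else H b v.
have FH : \forall v \near 0^'+, H b v = F v.
  by apply: filterS (nbhs_right_gt 0) => v v0; rewrite /F leNgt v0.
have FHv (v : R) : 0 < v -> \forall w \near v, H b w = F w.
  move=> v0; apply: filterS (lt_nbhsr v0) => w w0.
  by rewrite /F leNgt w0.
have dF (v : R) : 0 < v -> is_derive v 1 F (f b v).
  move=> v0; exact: near_eq_is_derive (FHv v v0) (is_derive_H b v0).
rewrite (@ge0_continuous_FTC2y R (f b) F 0 ((expR b + expR (- b)) / 2)).
- by rewrite /F lexx -EFinB; congr EFin; ring.
- move=> v _; rewrite /f; case: ifP => // _.
  by rewrite mulr_ge0 ?normal_pdf_ge0 ?expR_ge0.
- apply/continuous_within_itvcyP; split; last exact: f_cvg0.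
  by move=> v; rewrite in_itv/= andbT => v0; apply: continuous_f; rewrite gt_eqF.
- apply: cvg_trans (H_cvgy (ltW b0)); apply: near_eq_cvg.
  have y0 : \forall v \near +oo, (0 : R) < v by apply: nbhs_pinfty_gt; exact: num_real.
  by apply: filterS y0 => v v0; rewrite /F leNgt v0.
- by move=> v v0; have [] := dF v v0.
- rewrite {2}/F lexx; apply: cvg_trans (H_cvg0 b0); exact: near_eq_cvg.
- move=> v; rewrite in_itv/= andbT => v0; rewrite derive1E.
  by have [_ ->] := dF v v0.
Qed.

End subordination.

(** * The exponential kernel: positivity, definiteness and total integral *)

Section laplace_kernel.
Variable R : realType.
Notation leb := (@lebesgue_measure R).
Notation phi := (@normal_pdf R 0 1).

Definition lapk n (t : R) (xy : euclidean R n * euclidean R n) : R :=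
  expR (- (t * edist xy.1 xy.2)).

Lemma bmeas_lapk n t : 0 <= t -> bmeas (@lapk n t).
Proof.
move=> t0; split.
  apply: measurableT_comp => //; apply: measurable_funN.
  by apply: measurable_funM => //; exact: measurable_edist2.
exists 1 => xy; rewrite ger0_norm ?expR_ge0// -[leRHS]expR0 ler_expR.
by rewrite oppr_le0 mulr_ge0// edist_ge0.
Qed.

Lemma lapk_sym n t (x y : euclidean R n) : lapk t (x, y) = lapk t (y, x).
Proof. by rewrite /lapk /= edist_sym. Qed.

(* The exponential kernel is the mixture, over the half-normal law of [v], of
   the Gaussian kernels of rate [t^2 / (2v^2)]. *)
Definition mixrate (t v : R) : R := t ^+ 2 / 2 * (v `^ (-1)) ^+ 2.
Definition mixweight (v : R) : R := 2 * phi v * \1_(`]0%R, +oo[%classic : set R) v.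

Lemma mixrate_ge0 t v : 0 <= mixrate t v.
Proof. by rewrite mulr_ge0 ?divr_ge0 ?sqr_ge0. Qed.

Lemma mixrateE t v : 0 < v -> mixrate t v = t ^+ 2 / (2 * v ^+ 2).
Proof.
by move=> v0; rewrite /mixrate powR_inv1 ?ltW//; field; rewrite gt_eqF.
Qed.

Lemma mixrate_gt0 t v : 0 < t -> 0 < v -> 0 < mixrate t v.
Proof. by move=> t0 v0; rewrite mixrateE// divr_gt0 ?mulr_gt0 ?exprn_gt0. Qed.

Lemma mixweight_ge0 v : 0 <= mixweight v.
Proof. by rewrite mulr_ge0 ?mulr_ge0 ?normal_pdf_ge0. Qed.

Lemma measurable_mixweight : measurable_fun setT mixweight.
Proof.
apply: measurable_funM; last exact: measurable_indic.
by apply: measurable_funM => //; exact: measurable_normal_pdf.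
Qed.

(** Immediate because [mixrate] writes the inverse as a real power, which is measurable on the whole
    line and agrees with the inverse for [0 < v]. *)
Lemma measurable_mixrate t : measurable_fun setT (mixrate t).
Proof.
apply: measurable_funM => //; apply: measurable_funX.
exact: measurable_powR.
Qed.

Lemma integral_mixweight (f : R -> R) : measurable_fun setT f ->
  (forall v, 0 <= f v) ->
  (\int[leb]_v (mixweight v * f v)%:E =
   2%:E * \int[leb]_(v in `]0%R, +oo[) (phi v * f v)%:E)%E.
Proof.
move=> mf f0.
have mpf : measurable_fun setT (fun v => (phi v * f v)%:E).
  apply/measurable_EFinP; apply: measurable_funM => //.
  exact: measurable_normal_pdf.
rewrite -ge0_integralZl//; last 2 first.
- exact: measurable_funTS.
- by move=> v _; rewrite lee_fin mulr_ge0// normal_pdf_ge0.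
rewrite [RHS]integral_mkcond; apply: eq_integral => v _.
rewrite patchE /mixweight indicE; case: ifPn => _.
  by rewrite mulr1 -EFinM mulrA.
by rewrite mulr0 mul0r.
Qed.

Lemma integrable_mixweight :
  (\int[leb]_v (mixweight v)%:E = 1)%E.
Proof.
under eq_integral do rewrite -[mixweight _]mulr1.
rewrite integral_mixweight//.
rewrite (_ : integral _ _ _ = \int[leb]_(v in `]0%R, +oo[)
    (phi v * expR (- (0 ^+ 2 / (2 * v ^+ 2))))%:E)%E.
  by rewrite subordination// oppr0 expR0 -EFinM mulrC divfK.
by apply: eq_integral => v _; rewrite expr0n/= mul0r oppr0 expR0.
Qed.

Lemma measurable_mixgauss n t : measurable_fun setT
  (fun xvy : euclidean R n * R * euclidean R n =>
     mixweight xvy.1.2 * gaussk (mixrate t xvy.1.2) (xvy.1.1, xvy.2)).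
Proof.
apply: measurable_funM.
  apply: (measurableT_comp measurable_mixweight); exact: measurableT_comp.
apply: measurableT_comp => //; apply: measurable_funM.
  apply: measurable_funN; apply: (measurableT_comp (measurable_mixrate t)).
  exact: measurableT_comp.
apply: measurable_funX; apply: (measurableT_comp (@measurable_edist2 R n)).
by apply: measurable_fun_pair => //; exact: measurableT_comp.
Qed.

Lemma gaussk_le1 n s (xy : euclidean R n * euclidean R n) :
  0 <= s -> 0 <= gaussk s xy <= 1.
Proof.
move=> s0; rewrite expR_ge0 -[leRHS]expR0 ler_expR mulNr oppr_le0.
by rewrite mulr_ge0// sqr_ge0.
Qed.

Lemma mixweight_ub v : mixweight v <= 2 * normal_peak 1.
Proof.
rewrite /mixweight indicE; case: (_ \in _); rewrite ?mulr1 ?mulr0.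
  by rewrite ler_wpM2l// normal_pdf_ub// oner_neq0.
by rewrite mulr_ge0// normal_peak_ge0.
Qed.

Lemma measurable_gaussk_rate n t (xy : euclidean R n * euclidean R n) :
  measurable_fun setT (fun v => gaussk (mixrate t v) xy).
Proof.
apply: measurableT_comp => //; apply: measurable_funM => //.
by apply: measurable_funN; exact: measurable_mixrate.
Qed.

Lemma lapk_mixture_ereal n t (xy : euclidean R n * euclidean R n) : 0 <= t ->
  ((lapk t xy)%:E =
    \int[leb]_v (mixweight v * gaussk (mixrate t v) xy)%:E)%E.
Proof.
move=> t0; rewrite integral_mixweight//.
- transitivity (2%:E * \int[leb]_(v in `]0%R, +oo[)
      (phi v * expR (- ((t * edist xy.1 xy.2) ^+ 2 / (2 * v ^+ 2))))%:E)%E.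
    by rewrite subordination ?mulr_ge0 ?edist_ge0// -EFinM mulrC divfK.
  congr (_ * _)%E; apply: eq_integral => v; rewrite inE/= in_itv/= andbT => v0.
  rewrite /gaussk mixrateE//; congr (_ * expR _)%:E.
  by rewrite exprMn mulNr mulrAC.
- exact: measurable_gaussk_rate.
- by move=> v; rewrite expR_ge0.
Qed.

Lemma lapk_mixture n t (xy : euclidean R n * euclidean R n) : 0 <= t ->
  lapk t xy = \int[leb]_v (mixweight v * gaussk (mixrate t v) xy).
Proof. by move=> t0; rewrite /Rintegral -lapk_mixture_ereal. Qed.

(** Gaussians are at most 1, so [mixweight] alone, of integral 1, serves as the dominating
    function. *)
Lemma ip_lapk n t L1 L2 : 0 <= t -> signed L1 -> signed L2 ->
  leb.-integrable setT
    (fun v => (mixweight v * ip (@gaussk R n (mixrate t v)) L1 L2)%:E) /\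
  ip (@lapk n t) L1 L2 =
    \int[leb]_v (mixweight v * ip (gaussk (mixrate t v)) L1 L2).
Proof.
move=> t0 s1 s2.
pose G (xvy : euclidean R n * R * euclidean R n) : R :=
  mixweight xvy.1.2 * gaussk (mixrate t xvy.1.2) (xvy.1.1, xvy.2).
have G01 x v y : 0 <= G (x, v, y) <= mixweight v.
  have /andP[g0 g1] := gaussk_le1 (x, y) (mixrate_ge0 t v).
  by rewrite /G/= mulr_ge0 ?mixweight_ge0 ?ler_piMr ?mixweight_ge0.
have bG : bmeas G.
  split; first exact: measurable_mixgauss.
  exists (2 * normal_peak 1) => -[[x v] y]; have /andP[G0 G1] := G01 x v y.
  by rewrite ger0_norm// (le_trans G1)// mixweight_ub.
have [|||iG ipE] := @ip_mixture _ _ _ _ R leb L1 L2 G (mixweight \o snd) 1 s1 s2 bG.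
- exact: measurableT_comp measurable_mixweight _.
- by move=> x y v; have /andP[G0 G1] := G01 x v y; rewrite ger0_norm.
- by move=> x; rewrite integrable_mixweight.
have GE v : ip (fun xy => G (xy.1, v, xy.2)) L1 L2 =
    mixweight v * ip (gaussk (mixrate t v)) L1 L2.
  by rewrite -ip_kernelZ//; exact/bmeas_gaussk/mixrate_ge0.
have -> : lapk t = (fun xy => \int[leb]_v G (xy.1, v, xy.2)).
  by apply/funext => xy; rewrite lapk_mixture//; apply: eq_Rintegral => v _; case: xy.
split; last by rewrite ipE; apply: eq_Rintegral => v _.
by move: iG; congr (integrable _ _ _); apply/funext => v; rewrite GE.
Qed.

Lemma psd_lapk n t : 0 < t -> psd (@lapk n t).
Proof.
move=> t0 L sL; have [_ ->] := ip_lapk (ltW t0) sL sL.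
apply: Rintegral_ge0 => v _; rewrite /mixweight indicE.
case: (boolP (v \in _)) => [|_]; last by rewrite mulr0 mul0r.
rewrite inE/= in_itv/= andbT => v0; rewrite mulr1 mulr_ge0 ?mulr_ge0 ?normal_pdf_ge0//.
by apply: psd_gaussk => //; exact: mixrate_gt0.
Qed.

(** A nonnegative integrand with integral 0 vanishes almost everywhere. The rate exceeds [A] for all
    small [v], and an interval []0, e[] has positive measure, so it contains a good [v]. Large rates
    are what a mollification argument needs. *)
Lemma ip_lapk_eq0 n t L : 0 < t -> signed L -> ip (@lapk n t) L L = 0 ->
  forall A : R, exists s, A <= s /\ 0 < s /\ ip (@gaussk R n s) L L = 0.
Proof.
move=> t0 sL; have [] := ip_lapk (ltW t0) sL sL.
set h := (fun v => (mixweight v * _)%:E) => ih -> h0 A.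
have hge0 v : (0 <= h v)%E.
  rewrite lee_fin /mixweight indicE.
  case: (boolP (v \in _)) => [|_]; last by rewrite mulr0 mul0r.
  rewrite inE/= in_itv/= andbT => v0; rewrite mulr1 mulr_ge0 ?mulr_ge0 ?normal_pdf_ge0//.
  by apply: psd_gaussk => //; exact: mixrate_gt0.
have : ae_eq leb setT h (cst 0%E).
  apply/ae_eq_integral_abs => //; first by case/integrableP: ih.
  under eq_integral do rewrite gee0_abs//.
  have /fineK <- := integrable_fin_num measurableT ih.
  by congr EFin.
move=> [N [mN N0 hN]].
(* Below 1 one has [v ^+ 2 <= v]; the other bound makes [2 * v] times a number above [A] smaller
   than [t ^+ 2]. *)
pose e := Num.min 1 (t ^+ 2 / (2 * (`|A| + 1))).
have A10 : 0 < `|A| + 1 by rewrite ltr_wpDl.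
have e0 : 0 < e by rewrite lt_min ltr01 divr_gt0 ?exprn_gt0 ?mulr_gt0.
have rateA v : 0 < v < e -> A <= mixrate t v.
  move=> /andP[v0]; rewrite lt_min => /andP[v1 ve].
  rewrite mixrateE// ler_pdivlMr ?mulr_gt0 ?exprn_gt0//.
  apply: (@le_trans _ _ ((`|A| + 1) * (2 * v))).
    apply: (@le_trans _ _ ((`|A| + 1) * (2 * v ^+ 2))).
      apply: ler_wpM2r; first by rewrite mulr_ge0 ?sqr_ge0.
      by rewrite (le_trans (ler_norm A))// lerDl.
    apply: ler_wpM2l; first exact: ltW.
    by apply: ler_wpM2l => //; rewrite expr2 ler_piMr ?ltW.
  move: ve; rewrite ltr_pdivlMr ?mulr_gt0// => /ltW; apply: le_trans.
  by rewrite mulrCA mulrA mulrC mulrA.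
apply: contrapT => /forallNP noz.
have : (leb `]0%R, e[ <= leb N)%E.
  rewrite le_measure ?inE// => v; rewrite /= in_itv/= => /andP[v0 ve]; apply: hN => /= hv.
  have := hv I; rewrite /h /mixweight indicE mem_set ?mulr1/= ?in_itv/= ?v0//.
  move=> -[] /eqP; rewrite mulf_eq0 mulf_eq0 pnatr_eq0/=.
  rewrite normal_pdfE ?oner_neq0// mulf_eq0 gt_eqF ?normal_peak_gt0 ?oner_neq0//=.
  rewrite gt_eqF ?expR_gt0//= => /eqP hz.
  apply: (noz (mixrate t v)); split; last split => //; last exact: mixrate_gt0.
  by apply: rateA; rewrite v0.
rewrite lebesgue_measure_itv/= lte_fin e0 N0 -EFinB subr0 lee_fin.
by rewrite leNgt e0.
Qed.

(** In the mixture, integrate over [z] first: the Gaussian of rate [t^2 / (2 v^2)] has integral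
    [(sqrt(2 pi) v / t)^n]. The dependence on [t] factors out, and [C] is [sqrt(2 pi)^n] times the
    [n]-th moment of the half-normal law. *)
Lemma integral_lapk n : exists2 C : R, 0 <= C &
  forall t (x : euclidean R n), 0 < t ->
  (\int[lebesgue_euclidean R n]_z (lapk t (x, z))%:E = (C / t ^+ n)%:E)%E.
Proof.
pose k : R := Num.sqrt (2 * pi).
have k0 : 0 <= k by exact: sqrtr_ge0.
pose f v := mixweight v * (k * v) ^+ n.
have mf : measurable_fun setT f.
  apply: measurable_funM; first exact: measurable_mixweight.
  by apply: measurable_funX; exact: measurable_funM.
have fle0 v : v <= 0 -> f v = 0.
  move=> v0; rewrite /f /mixweight indicE memNset ?mulr0 ?mul0r//=.
  by rewrite in_itv/= andbT; apply/negP; rewrite -leNgt.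
have f0 v : 0 <= f v.
  have [/fle0 ->//|v0] := leP v 0.
  by rewrite mulr_ge0 ?mixweight_ge0// exprn_ge0// mulr_ge0// ltW.
pose I := (\int[leb]_v (f v)%:E)%E.
have I0 : (0 <= I)%E by apply: integral_ge0 => v _; rewrite lee_fin.
(* From [v ^+ n <= n! * expR v], and by completing the square: [expR v] times the standard density
   is [expR 2^-1] times the density centred at 1. *)
pose K : R := 2 * k ^+ n * (n`!%:R * expR 2^-1).
have K0 : 0 <= K by rewrite !mulr_ge0 ?exprn_ge0 ?expR_ge0.
have Ioo : (I < +oo)%E.
  apply: (@le_lt_trans _ _ (\int[leb]_v (K%:E * (normal_pdf 1 1 v)%:E))%E); last first.
    rewrite ge0_integralZl//; last 2 first.
    - by apply/measurable_EFinP; exact: measurable_normal_pdf.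
    - by move=> v _; rewrite lee_fin normal_pdf_ge0.
    by rewrite integral_normal_pdf mule1 ltry.
  apply: ge0_le_integral => //.
  - by move=> v _; rewrite lee_fin.
  - exact/measurable_EFinP.
  - apply/measurable_EFinP/measurable_funM => //.
    exact: measurable_normal_pdf.
  move=> v _; rewrite -EFinM lee_fin.
  have [/fle0 ->|v0] := leP v 0; first by rewrite mulr_ge0 ?normal_pdf_ge0.
  have vn : v ^+ n <= n`!%:R * expR v.
    case: n {f mf fle0 f0 I I0 K K0} => [|m].
      by rewrite expr0 mul1r -[leLHS]expR0 ler_expR ltW.
    rewrite -ler_pdivrMl ?ltr0n ?fact_gt0// mulrC.
    by apply: le_trans (expR_ge1Dxn m (ltW v0)); rewrite lerDr.
  rewrite /f /mixweight indicE mem_set ?mulr1/= ?in_itv/= ?v0// exprMn.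
  have -> : K * normal_pdf 1 1 v = 2 * phi v * (k ^+ n * (n`!%:R * expR v)).
    rewrite !normal_pdfE ?oner_neq0// /normal_fun /K !subr0 expr1n.
    have -> : expR (- (v - 1) ^+ 2 / (1 *+ 2)) =
        expR (- v ^+ 2 / (1 *+ 2)) * expR v * (expR 2^-1)^-1.
      rewrite -expRN -!expRD; congr expR.
      by rewrite mulr2n; field.
    by field; rewrite gt_eqF ?expR_gt0.
  by rewrite ler_wpM2l ?mulr_ge0 ?normal_pdf_ge0// ler_wpM2l// exprn_ge0.
exists (fine I) => [|t x t0]; first exact: fine_ge0.
transitivity (\int[lebesgue_euclidean R n]_z
    \int[leb]_v (mixweight v * gaussk (mixrate t v) (x, z))%:E)%E.
  by apply: eq_integral => z _; rewrite -lapk_mixture_ereal// ltW.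
rewrite (@fubini_tonelli _ _ _ _ R (lebesgue_euclidean R n) leb
  (fun zv => (mixweight zv.2 * gaussk (mixrate t zv.2) (x, zv.1))%:E)); last 2 first.
- have mpair : measurable_fun setT
      (fun zv : euclidean R n * R => (x, zv.2, zv.1)).
    by apply: measurable_fun_pair => //; exact: measurable_fun_pair.
  apply/measurable_EFinP.
  exact: (measurableT_comp (@measurable_mixgauss n t) mpair).
- by move=> zv; rewrite lee_fin mulr_ge0 ?mixweight_ge0// expR_ge0.
transitivity (\int[leb]_v ((t ^+ n)^-1%:E * (f v)%:E))%E.
  apply: eq_integral => v _ /=.
  under eq_integral do rewrite EFinM.
  rewrite ge0_integralZl//; last 3 first.
  - apply/measurable_EFinP.
    exact: (bmeas_section1 x (@bmeas_gaussk _ n _ (mixrate_ge0 t v))).1.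
  - by move=> z _; rewrite lee_fin expR_ge0.
  - by rewrite lee_fin mixweight_ge0.
  have [v0|v0] := leP v 0.
    rewrite (fle0 v v0) mule0; move: (fle0 v v0) => /eqP.
    rewrite /mixweight indicE memNset ?mulr0 ?mul0e//=.
    by rewrite in_itv/= andbT; apply/negP; rewrite -leNgt.
  rewrite integral_gauss_euclidean ?mixrate_gt0// -!EFinM /f mulrCA; congr (_ * _)%:E.
  rewrite -exprVn -exprMn; congr (_ ^+ n).
  rewrite mixrateE// (_ : _ / _ = 2 * pi * (v / t) ^+ 2); last first.
    by field; rewrite !gt_eqF.
  rewrite sqrtrM ?mulr_ge0 ?pi_ge0// sqrtr_sqr ger0_norm ?divr_ge0 ?ltW//.
  by rewrite -/k mulrA mulrC.
rewrite ge0_integralZl//.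
- by rewrite -/I -[I]fineK ?ge0_fin_numE// -EFinM mulrC.
- exact/measurable_EFinP.
- by move=> v _; rewrite lee_fin.
- by rewrite lee_fin invr_ge0 exprn_ge0// ltW.
Qed.

End laplace_kernel.

(** * Neighbourhoods and mollification *)

Section euclidean_topology.
Variables (R : realType) (n : nat).
Notation T := (euclidean R n).
Implicit Types (F X : set T) (x y z : T).

Lemma near_edist x (P : T -> Prop) :
  (\near x, P x) <-> exists2 e : R, 0 < e & forall y, edist x y < e -> P y.
Proof.
split=> [/(@metricType_numDomainType.nbhs_mdistP R T)[e /= e0 eP]|[e e0 eP]].
  by exists e.
by apply/(@metricType_numDomainType.nbhs_mdistP R T); exists e.
Qed.

Lemma continuous_edist x : continuous (edist x : T -> R).
Proof.
move=> y; apply/(@cvgrPdist_lt _ _ _ (nbhs y) (nbhs_filter y)) => e e0.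
apply/near_edist; exists e => // z; apply: le_lt_trans.
rewrite ler_norml; have := edist_triangle z x y; have := edist_triangle y x z.
by rewrite (edist_sym z y); lra.
Qed.

Lemma open_measurable_euclidean (A : set T) : open A -> measurable A.
Proof. by move=> oA; rewrite euclidean_borelE; exact: sub_sigma_algebra. Qed.

Lemma closed_measurable_euclidean (A : set T) : closed A -> measurable A.
Proof.
move=> cA; rewrite -(setCK A); apply: measurableC; apply: open_measurable_euclidean.
exact: closed_openC.
Qed.

Lemma compact_closed_euclidean (A : set T) : compact A -> closed A.
Proof. by apply: compact_closed; exact: (@metric_hausdorff R T). Qed.

Lemma compact_measurable_euclidean (A : set T) : compact A -> measurable A.
Proof. by move/compact_closed_euclidean; exact: closed_measurable_euclidean. Qed.

Lemma compact_edist_bounded (A : set T) x : compact A ->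
  exists2 M : R, 0 < M & forall y, A y -> edist x y <= M.
Proof.
move=> cA; have : compact ((edist x : T -> R) @` A).
  apply: continuous_compact => //; apply: continuous_subspaceT.
  exact: continuous_edist.
move=> /compact_bounded[M [_ Mb]]; exists (`|M| + 1); first by rewrite ltr_wpDl.
move=> y Ay; have MM : M < `|M| + 1 by rewrite (le_lt_trans (ler_norm M))// ltrDl.
by have /= := Mb _ MM _ (imageP _ Ay); rewrite ger0_norm ?edist_ge0.
Qed.

Lemma measurable_tail x (r : R) : measurable [set z : T | r <= edist x z].
Proof.
rewrite (_ : mkset _ = edist x @^-1` `[r, +oo[).
  by rewrite -[X in measurable X]setTI; exact: measurable_edist.
by apply/seteqP; split => y /=; rewrite in_itv/= andbT.
Qed.

Definition thicken F (r : R) : set T := [set x | exists2 y, F y & edist y x < r].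

Lemma open_thicken F r : open (thicken F r).
Proof.
rewrite openE => x [y Fy yx]; apply/near_edist; exists (r - edist y x).
  by rewrite subr_gt0.
move=> z xz; exists y => //; apply: le_lt_trans (edist_triangle x _ _) _.
by rewrite -ltrBrDl.
Qed.

Lemma measurable_thicken F r : measurable (thicken F r).
Proof. by apply: open_measurable_euclidean; exact: open_thicken. Qed.

Lemma subset_thicken F r : 0 < r -> F `<=` thicken F r.
Proof. by move=> r0 x Fx; exists x => //; rewrite edistxx. Qed.

(** Closedness makes the thickenings of radius [1 / (k + 1)] decrease to [F]; finiteness at radius 1
    allows continuity from above. *)
Lemma thicken_cvg (m : {measure set T -> \bar R}) F X (e : R) : closed F -> measurable X ->
  (m (X `&` thicken F 1) < +oo)%E -> 0 < e ->
  exists2 r : R, 0 < r <= 1 & (m (X `&` thicken F r) <= m (X `&` F) + e%:E)%E.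
Proof.
move=> cF mX moo e0.
pose S k := X `&` thicken F (k.+1%:R^-1).
have mS k : measurable (S k) by apply: measurableI => //; exact: measurable_thicken.
have capS : \bigcap_k S k = X `&` F.
  apply/seteqP; split => [x Sx|x [Xx Fx] k _].
    split; first by have [] := Sx 0%N I.
    apply: contrapT => Fx.
    have /near_edist[r r0 rF] : \near x, ~ F x.
      by apply: open_nbhs_nbhs; split => //; exact: closed_openC.
    have [k kr] : exists k, k.+1%:R^-1 < r.
      exists (Num.truncn r^-1); rewrite invf_plt ?posrE//.
      exact: truncnS_gt.
    have [_ [y Fy yx]] := Sx k I.
    by apply: (rF y) => //; rewrite edist_sym (lt_trans yx).
  by split => //; apply: subset_thicken.
have := @nonincreasing_cvg_mu _ _ _ m S.
rewrite capS => /(_ _ mS _ _).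
have mF : measurable (X `&` F) by apply: measurableI => //; exact: closed_measurable_euclidean.
have niS : nonincreasing_seq S.
  move=> i j ij; apply/subsetPset => x [Xx [y Fy yx]]; split => //; exists y => //.
  by rewrite (lt_le_trans yx)// lef_pV2 ?posrE// ler_nat ltnS.
have S0 : (m (S 0%N) < +oo)%E by rewrite /S invr1.
move=> /(_ S0 mF niS) cvS.
have XF : (m (X `&` F) < +oo)%E.
  apply: le_lt_trans moo; rewrite le_measure ?inE//.
    by apply: measurableI => //; exact: measurable_thicken.
  by apply: setIS; exact: subset_thicken.
have Ffin : m (X `&` F) \is a fin_num by rewrite ge0_fin_numE.
have Sfin k : m (S k) \is a fin_num.
  rewrite ge0_fin_numE//; apply: le_lt_trans S0; rewrite le_measure ?inE//.
  exact/subsetPset/niS.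
move: cvS; rewrite -[X in _ --> X](fineK Ffin) => /fine_cvg cvS.
have : \forall k \near \oo, fine (m (S k)) < fine (m (X `&` F)) + e.
  by apply: (cvgr_lt _ cvS); rewrite ltrDl.
move=> [k _ /(_ k (leqnn k)) kS]; exists k.+1%:R^-1.
  by rewrite invr_gt0 ltr0n/= invf_le1// ler1n.
by rewrite -(fineK (Sfin k)) -(fineK Ffin) -EFinD lee_fin ltW.
Qed.

End euclidean_topology.

Section restricted_functional.
Context d (T : measurableType d) (R : realType).

(** [m] itself may be infinite, as Lebesgue measure is. Only its restriction to [A] is a finite
    measure, and the indicator moves the domain of integration into the density. *)
Lemma signed_restr (m : {measure set T -> \bar R}) (A : set T) g :
  measurable A -> (m A < +oo)%E -> bmeas g ->
  signed (fun f => \int[m]_(x in A) (g x * f x)).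
Proof.
move=> mA mAoo bg.
have -> : (fun f => \int[m]_(x in A) (g x * f x)) =
    (fun f => \int[mfrestr mA mAoo]_x ((g x * \1_A x) * f x)).
  apply/funext => f.
  transitivity (\int[mfrestr mA mAoo]_(x in A) (g x * f x)).
    congr fine; apply: eq_measure_integral => B mB BA.
    by rewrite /= /mfrestr /mrestr setIidl.
  rewrite Rintegral_mkcond; apply: eq_Rintegral => x _.
  rewrite patchE indicE; case: (x \in A); first by rewrite mulr1.
  by rewrite mulr0 mul0r.
by apply: signed_base; apply: bmeasM => //; exact: bmeas_indic.
Qed.

Lemma signed_restr1 (m : {measure set T -> \bar R}) (A : set T) :
  measurable A -> (m A < +oo)%E -> signed (fun f => \int[m]_(x in A) f x).
Proof.
move=> mA mAoo; have := signed_restr mA mAoo (bmeas_cst T (1 : R)).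
rewrite (_ : (fun f => _) = (fun f => \int[m]_(x in A) f x))//.
by apply/funext => f; apply: eq_Rintegral => x _; rewrite mul1r.
Qed.

Lemma bmeas_integrable_restr (m : {measure set T -> \bar R}) (A : set T) (f : T -> R) :
  measurable A -> (m A < +oo)%E -> bmeas f -> m.-integrable A (EFin \o f).
Proof.
move=> mA mAoo [mf [M fM]]; apply: measurable_bounded_integrable => //.
  exact: measurable_funTS.
exists M; split; first exact: num_real.
by move=> y My x _ /=; rewrite (le_trans (fM x))// ltW.
Qed.

Lemma le_Rintegral_bmeas (m : {measure set T -> \bar R}) (A : set T) (f g : T -> R) :
  measurable A -> (m A < +oo)%E -> bmeas f -> bmeas g ->
  (forall x, A x -> f x <= g x) ->
  \int[m]_(x in A) f x <= \int[m]_(x in A) g x.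
Proof. by move=> mA mAoo bf bg fg; apply: le_Rintegral => //; exact: bmeas_integrable_restr. Qed.

Lemma Rintegral_indic (m : {measure set T -> \bar R}) (A B : set T) (c : R) :
  measurable A -> measurable B -> (m A < +oo)%E ->
  \int[m]_(x in A) (c * \1_B x) = c * fine (m (A `&` B)).
Proof.
move=> mA mB mAoo; rewrite RintegralZl//; last first.
  exact/bmeas_integrable_restr/bmeas_indic.
by congr (_ * _); rewrite /Rintegral integral_indic// setIC.
Qed.

End restricted_functional.

(** * Mollified indicators, for a kernel that is later Gaussian or exponential *)

Section mollification.
Variables (R : realType) (n : nat).
Notation T := (euclidean R n).
Notation Lm := (lebesgue_euclidean R n).
Variables (k : T * T -> R) (c delta r : R).
Hypothesis bk : bmeas k.
Hypothesis k_ge0 : forall xy, 0 <= k xy.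
Hypothesis c_ge0 : 0 <= c.
Hypothesis delta_ge0 : 0 <= delta.
Hypothesis integral_k : forall x, (\int[Lm]_z (k (x, z))%:E = c%:E)%E.
Hypothesis tail_k : forall x,
  (\int[Lm]_(z in [set z | (r <= edist x z)%R]) (k (x, z))%:E <= (delta * c)%:E)%E.
Variables (m : {measure set T -> \bar R}) (X F : set T).
Hypotheses (mX : measurable X) (mXoo : (m X < +oo)%E) (mF : measurable F).
Hypothesis FX : F `<=` X.
Hypothesis Uoo : (Lm (thicken F r) < +oo)%E.

Let U := thicken F r.
Let mU : measurable U. Proof. exact: measurable_thicken. Qed.
(** Up to the factor [c], a mollified indicator of [U]: within [delta] of 1 on [F], within [delta]
    of 0 outside the thickening of radius [2 * r]. *)
Let pot x := \int[Lm]_(y in U) k (x, y).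

Let mk x : measurable_fun setT (fun z => (k (x, z))%:E).
Proof. by apply/measurable_EFinP; exact: (bmeas_section1 x bk).1. Qed.

Let bpot : bmeas pot.
Proof. exact: (bmeas_potential (signed_restr1 mU Uoo) bk). Qed.

Let potE x : (pot x)%:E = (\int[Lm]_(y in U) (k (x, y))%:E)%E.
Proof.
rewrite fineK//; apply: integrable_fin_num => //.
by apply: bmeas_integrable_restr => //; exact: bmeas_section1.
Qed.

Let pot_ge0 x : 0 <= pot x.
Proof. exact: Rintegral_ge0. Qed.

Let mtail x : measurable [set z : T | r <= edist x z].
Proof. exact: measurable_tail. Qed.

Let pot_le x : pot x <= c.
Proof.
rewrite -lee_fin potE -(integral_k x); apply: ge0_subset_integral => //.
by move=> z _; rewrite lee_fin.
Qed.

Let pot_far x : ~ thicken F (2 * r) x -> pot x <= delta * c.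
Proof.
move=> xF; rewrite -lee_fin potE; apply: le_trans (tail_k x).
apply: ge0_subset_integral => //.
- exact: measurable_funTS.
- by move=> z _; rewrite lee_fin.
- move=> z [y Fy yz] /=; rewrite leNgt; apply/negP => xz; apply: xF.
  exists y => //; apply: le_lt_trans (edist_triangle z _ _) _.
  by rewrite (edist_sym z x); lra.
Qed.

Let pot_near x : F x -> c * (1 - delta) <= pot x.
Proof.
move=> Fx; rewrite mulrBr mulr1 lerBlDr (mulrC c) -lee_fin EFinD -(integral_k x) potE.
rewrite -(setUv U) ge0_integral_setU//; last 4 first.
- exact: measurableC.
- by rewrite setUv.
- by move=> z _; rewrite lee_fin.
- exact/disj_setPCl.
rewrite leeD2l//; apply: le_trans (tail_k x); apply: ge0_subset_integral => //.
- exact: measurableC.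
- exact: measurable_funTS.
- by move=> z _; rewrite lee_fin.
- by move=> z Uz /=; rewrite leNgt; apply/negP => xz; apply: Uz; exists x.
Qed.

Let M (f : T -> R) := \int[m]_(x in X) f x.
Let G (f : T -> R) := \int[Lm]_(x in U) f x.

(** Paired with [mollify_le], this bounds the mass of [F] for one measure by the mass of a
    thickening for another, once their pairings with [G] are comparable. *)
Lemma mollify_ge : c * (1 - delta) * fine (m F) <= ip k M G.
Proof.
rewrite -[F](setIidr FX) -Rintegral_indic//; apply: le_Rintegral_bmeas => //.
  by apply: bmeasM; [exact: bmeas_cst|exact: bmeas_indic].
move=> x Xx; rewrite indicE; case: (boolP (x \in F)) => [|_].
  by rewrite inE mulr1 => /pot_near.
by rewrite mulr0; exact: pot_ge0.
Qed.

Lemma mollify_le :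
  ip k M G <= c * (fine (m (X `&` thicken F (2 * r))) + delta * fine (m X)).
Proof.
have mU2 := @measurable_thicken R n F (2 * r).
have bi : bmeas (fun x => c * \1_(thicken F (2 * r)) x).
  by apply: bmeasM; [exact: bmeas_cst|exact: bmeas_indic].
apply: (@le_trans _ _ (\int[m]_(x in X) (c * \1_(thicken F (2 * r)) x + delta * c))).
  apply: le_Rintegral_bmeas => //.
    by apply: bmeasD => //; exact: bmeas_cst.
  move=> x Xx; rewrite indicE; case: (boolP (x \in _)) => [_|].
    by rewrite mulr1 (le_trans (pot_le x))// lerDl mulr_ge0.
  by rewrite notin_setE mulr0 add0r => /pot_far.
rewrite RintegralD//.
- by rewrite Rintegral_indic// Rintegral_cst// mulrDr mulrCA mulrA.
- exact: bmeas_integrable_restr.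
- by apply: bmeas_integrable_restr => //; exact: bmeas_cst.
Qed.

End mollification.

(** * Kernel mass away from the centre *)

Section kernel_tails.
Variables (R : realType) (n : nat).
Notation T := (euclidean R n).
Notation Lm := (lebesgue_euclidean R n).

Lemma expR_decay (a K e : R) : 0 < a -> 0 < e ->
  exists A : R, forall s, A <= s -> expR (- (s * a)) * K <= e.
Proof.
move=> a0 e0; exists (`|K| / (e * a)) => s.
have K0 : 0 <= `|K| by [].
rewrite ler_pdivrMr ?mulr_gt0// => sK.
have s0 : 0 <= s * a.
  rewrite -(pmulr_rge0 _ e0) (le_trans K0)//.
  by rewrite mulrCA.
apply: (@le_trans _ _ (expR (- (s * a)) * `|K|)).
  by rewrite ler_wpM2l ?expR_ge0// ler_norm.
rewrite expRN ler_pdivrMl ?expR_gt0//; apply: (le_trans sK).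
rewrite mulrCA mulrC ler_wpM2r ?(ltW e0)//.
by apply: le_trans (expR_ge1Dx _); rewrite lerDr.
Qed.

(** Half of the exponent pays for the small factor [b]; the other half is a wider kernel [k'] whose
    full integral is known. Halving the rate costs the factors [Num.sqrt 2 ^+ n] and [2 ^+ n] in the
    two applications. *)
Lemma tail_le (k k' : T * T -> R) (x : T) (r b c : R) : bmeas k -> bmeas k' ->
  0 <= b -> (forall xy, 0 <= k xy) -> (forall xy, 0 <= k' xy) ->
  (forall z, r <= edist x z -> k (x, z) <= b * k' (x, z)) ->
  (\int[Lm]_z (k' (x, z))%:E = c%:E)%E ->
  (\int[Lm]_(z in [set z | (r <= edist x z)%R]) (k (x, z))%:E <= (b * c)%:E)%E.
Proof.
move=> bk bk' b0 k0 k'0 kk' k'c.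
have mS := measurable_tail x r.
have mk : measurable_fun setT (fun z => (k (x, z))%:E).
  by apply/measurable_EFinP; exact: (bmeas_section1 x bk).1.
have mk' : measurable_fun setT (fun z => (k' (x, z))%:E).
  by apply/measurable_EFinP; exact: (bmeas_section1 x bk').1.
rewrite EFinM -k'c -ge0_integralZl//; last by move=> z _; rewrite lee_fin.
apply: (@le_trans _ _ (\int[Lm]_(z in [set z | (r <= edist x z)%R]) (b%:E * (k' (x, z))%:E))%E).
  apply: ge0_le_integral => //.
  - by move=> z _; rewrite lee_fin.
  - exact: measurable_funTS.
  - by apply: measurable_funTS; exact: emeasurable_funM.
apply: ge0_subset_integral => //; first exact: emeasurable_funM.
by move=> z _; rewrite mule_ge0 ?lee_fin.
Qed.

Lemma gaussk_tail (s r : R) (x : T) : 0 < s -> 0 <= r ->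
  (\int[Lm]_(z in [set z | (r <= edist x z)%R]) (gaussk s (x, z))%:E <=
   ((expR (- (s * (r ^+ 2 / 2))) * Num.sqrt 2 ^+ n) * Num.sqrt (pi / s) ^+ n)%:E)%E.
Proof.
move=> s0 r0; rewrite -mulrA -exprMn -sqrtrM//.
apply: (@tail_le (gaussk s) (gaussk (s / 2))); rewrite ?expR_ge0//.
- exact/bmeas_gaussk/ltW.
- by apply: bmeas_gaussk; rewrite divr_ge0// ltW.
- by move=> ?; rewrite expR_ge0.
- by move=> ?; rewrite expR_ge0.
- move=> z rz; rewrite /gaussk/= -expRD ler_expR.
  have : s * r ^+ 2 <= s * edist x z ^+ 2.
    by apply: ler_wpM2l; [exact: ltW|rewrite ler_pXn2r// nnegrE edist_ge0].
  set u := s * _; set v := s * _ => uv.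
  have -> : - s * edist x z ^+ 2 = - v by rewrite mulNr.
  have -> : - (s * (r ^+ 2 / 2)) = - u / 2 by rewrite mulrA mulNr.
  have -> : - (s / 2) * edist x z ^+ 2 = - v / 2 by rewrite mulNr mulrAC mulNr.
  by lra.
- rewrite integral_gauss_euclidean ?divr_gt0//; congr (Num.sqrt _ ^+ n)%:E.
  by field; rewrite gt_eqF.
Qed.

Lemma lapk_tail (C t r : R) (x : T) : 0 < t ->
  (forall t (x : T), 0 < t -> (\int[Lm]_z (lapk t (x, z))%:E = (C / t ^+ n)%:E)%E) ->
  (\int[Lm]_(z in [set z | (r <= edist x z)%R]) (lapk t (x, z))%:E <=
   ((expR (- (t * (r / 2))) * 2 ^+ n) * (C / t ^+ n))%:E)%E.
Proof.
move=> t0 hC; rewrite -mulrA.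
have t20 : 0 < t / 2 by rewrite divr_gt0.
apply: (@tail_le (lapk t) (lapk (t / 2))); rewrite ?expR_ge0//.
- exact/bmeas_lapk/ltW.
- exact/bmeas_lapk/ltW.
- by move=> ?; rewrite expR_ge0.
- by move=> ?; rewrite expR_ge0.
- move=> z rz; rewrite /lapk/= -expRD ler_expR.
  have : t * r <= t * edist x z by rewrite ler_wpM2l// ltW.
  set u := t * _; set v := t * _ => uv.
  have -> : t * (r / 2) = u / 2 by rewrite mulrA.
  have -> : t / 2 * edist x z = v / 2 by rewrite mulrAC.
  by lra.
- rewrite hC//; congr EFin.
  by rewrite expr_div_n; field; rewrite !expf_neq0// gt_eqF.
Qed.

Lemma thicken_lebesgue_lt_pinfty (F : set T) (x : T) (M r : R) :
  (forall y, F y -> edist x y <= M) -> (Lm (thicken F r) < +oo)%E.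
Proof.
move=> FM; apply: (@lebesgue_euclidean_bounded _ _ _ x (M + r)).
  exact: measurable_thicken.
move=> z [y Fy yz]; apply: le_trans (edist_triangle y _ _) _.
by rewrite lerD ?FM// ltW.
Qed.

End kernel_tails.

(** * A vanishing energy of the difference forces equality of measures *)

Section uniqueness.
Variables (R : realType) (n : nat).
Notation T := (euclidean R n).
Notation Lm := (lebesgue_euclidean R n).
Variables (X : set T) (mu nu : probability T R).
Hypotheses (compactX : compact X) (muX : mu X = 1%E) (nuX : nu X = 1%E).

Let M (f : T -> R) := \int[mu]_(x in X) f x.
Let N (f : T -> R) := \int[nu]_(x in X) f x.

Let mX : measurable X. Proof. exact: compact_measurable_euclidean. Qed.
Let muXoo : (mu X < +oo)%E. Proof. by rewrite muX ltry. Qed.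
Let nuXoo : (nu X < +oo)%E. Proof. by rewrite nuX ltry. Qed.
Let sM : signed M. Proof. exact: signed_restr1. Qed.
Let sN : signed N. Proof. exact: signed_restr1. Qed.

Lemma psd_cauchy0 (k : T * T -> R) L G : signed L -> signed G -> bmeas k ->
  (forall x y, k (x, y) = k (y, x)) -> psd k -> ip k L L = 0 -> ip k L G = 0.
Proof.
move=> sL sG bk sk pk L0.
set b := ip k L G; set q := ip k G G.
have q0 : 0 <= q by exact: pk.
have key s : 0 <= - 2 * s * b + s ^+ 2 * q.
  by have := psd_sub s sL sG bk sk pk; rewrite L0 sub0r mulNr mulNr.
apply/eqP/negPn/negP => b0.
(* A small multiple of [b] makes the linear term win; the denominator [q + 1] also covers
   [q = 0]. *)
have := key (b / (q + 1)).
rewrite (_ : _ + _ = - (b ^+ 2 * (q + 2) / (q + 1) ^+ 2)); last first.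
  by field; rewrite gt_eqF// ltr_wpDl.
have b2 : 0 < b ^+ 2 by rewrite exprn_even_gt0.
have q2 : 0 < b ^+ 2 * (q + 2) by rewrite mulr_gt0// ltr_wpDl.
have q1 : 0 < (q + 1) ^+ 2 by rewrite exprn_gt0// ltr_wpDl.
by rewrite oppr_ge0 leNgt divr_gt0.
Qed.

(** One third of [e] pays for the thickening and two thirds for [d], which enters on both sides. *)
Lemma mollified_arith (a b p d e : R) : a <= 1 -> 0 <= d -> d <= e / 3 ->
  p <= b + e / 3 -> (1 - d) * a <= p + d -> a <= b + e.
Proof.
move=> a1 d0 de pb h; have : d * a <= d by rewrite ler_piMr.
by move: h; rewrite mulrBl mul1r; lra.
Qed.

(* Smoothing the indicator of a neighbourhood of [F] by ever narrower Gaussians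
   bounds [mu F] by the [nu]-mass of a slightly larger neighbourhood. *)
Lemma measure_closed_le t (F : set T) : 0 < t ->
  ip (lapk t) (fun f => M f + -1 * N f) (fun f => M f + -1 * N f) = 0 ->
  closed F -> F `<=` X -> (mu F <= nu F)%E.
Proof.
move=> t0 E0 cF FX.
have mF : measurable F by exact: closed_measurable_euclidean.
have sL : signed (fun f => M f + -1 * N f) by apply: signedD => //; exact: signedZ.
have [F0|/set0P[x0 Fx0]] := eqVneq F set0; first by rewrite F0 !measure0.
have [D D0 XD] := compact_edist_bounded x0 compactX.
have FD y : F y -> edist x0 y <= D by move=> Fy; apply/XD/FX.
have fmu : mu F \is a fin_num by exact: fin_num_measure.
have fnu : nu F \is a fin_num by exact: fin_num_measure.
rewrite -(fineK fmu) -(fineK fnu) lee_fin; apply/ler_addgt0Pr => e e0.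
have e30 : 0 < e / 3 by rewrite divr_gt0.
have [|r /andP[r0 r1] nur] := @thicken_cvg R n nu F X _ cF mX _ e30.
  rewrite (le_lt_trans _ nuXoo)// le_measure ?inE//.
  by apply: measurableI => //; exact: measurable_thicken.
(* Half of the radius, since [mollify_le] doubles it. *)
have r20 : 0 < r / 2 by rewrite divr_gt0.
have Uoo : (Lm (thicken F (r / 2)) < +oo)%E by exact: thicken_lebesgue_lt_pinfty FD.
have a0 : 0 < (r / 2) ^+ 2 / 2 by rewrite divr_gt0// exprn_gt0.
have [A decay] := expR_decay (Num.sqrt 2 ^+ n) a0 e30.
(* A rate above [A], so that the Gaussian tail is small, at which the Gaussian form also
   vanishes. *)
have [s [As [s0 Es]]] := ip_lapk_eq0 t0 sL E0 A.
set delta := expR (- (s * ((r / 2) ^+ 2 / 2))) * Num.sqrt 2 ^+ n.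
have de : delta <= e / 3 by exact: decay.
have delta0 : 0 <= delta by rewrite mulr_ge0 ?expR_ge0// exprn_ge0 ?sqrtr_ge0.
pose c : R := Num.sqrt (pi / s) ^+ n.
have c0 : 0 < c by rewrite exprn_gt0// sqrtr_gt0 divr_gt0 ?pi_gt0.
pose U := thicken F (r / 2).
pose G (f : T -> R) := \int[Lm]_(x in U) f x.
have mU : measurable U by exact: measurable_thicken.
have sG : signed G by exact: signed_restr1.
have bg : bmeas (@gaussk R n s) by exact/bmeas_gaussk/ltW.
have gge0 (xy : T * T) : 0 <= gaussk s xy by rewrite expR_ge0.
have gint (x : T) : (\int[Lm]_z (gaussk s (x, z))%:E = c%:E)%E.
  exact: integral_gauss_euclidean.
have gtail (x : T) := gaussk_tail x s0 (ltW r20).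
have lo := mollify_ge bg gge0 gint gtail mX muXoo mF FX Uoo.
have hi := mollify_le bg gge0 (ltW c0) delta0 gint gtail mX nuXoo Uoo.
have MN : ip (gaussk s) M G = ip (gaussk s) N G.
  have := psd_cauchy0 sL sG bg (@gaussk_sym R n s) (@psd_gaussk R n s s0) Es.
  by rewrite /ip mulN1r => /eqP; rewrite subr_eq0 => /eqP.
have {lo hi} : c * (1 - delta) * fine (mu F) <=
    c * (fine (nu (X `&` thicken F (2 * (r / 2)))) + delta * fine (nu X)).
  apply: le_trans hi; rewrite -/G -/N -MN; exact: lo.
rewrite -mulrA ler_pM2l// nuX mulr1 (mulrC 2) divfK//.
have : fine (nu (X `&` thicken F r)) <= fine (nu F) + e / 3.
  rewrite -lee_fin EFinD !fineK//; first by rewrite (setIidr FX) in nur.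
  by rewrite fin_num_measure//; apply: measurableI => //; exact: measurable_thicken.
have mu1 : fine (mu F) <= 1 by rewrite -lee_fin fineK// probability_le1.
exact: mollified_arith.
Qed.

End uniqueness.

(** The form also vanishes at [L'], the negative of [L], so the inequality on closed subsets of [X]
    holds both ways. Passing to complements gives equality on open sets, a generating class stable
    under intersection. *)
Lemma lapk_measure_eq (R : realType) n (X : set (euclidean R n))
    (mu nu : probability (euclidean R n) R) t :
  compact X -> mu X = 1%E -> nu X = 1%E -> 0 < t ->
  let L f := \int[mu]_(x in X) f x + -1 * \int[nu]_(x in X) f x in
  ip (lapk t) L L = 0 -> forall A, measurable A -> mu A = nu A.
Proof.
move=> cX muX nuX t0 L L0.
have mX : measurable X by exact: compact_measurable_euclidean.
have clX : closed X by exact: compact_closed_euclidean.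
have muXoo : (mu X < +oo)%E by rewrite muX ltry.
have nuXoo : (nu X < +oo)%E by rewrite nuX ltry.
have sM := signed_restr1 mX muXoo.
have sN := signed_restr1 mX nuXoo.
have bk : bmeas (@lapk R n t) by exact/bmeas_lapk/ltW.
pose L' f := \int[nu]_(x in X) f x + -1 * \int[mu]_(x in X) f x.
have L'0 : ip (lapk t) L' L' = 0.
  have sL : signed L by apply: signedD => //; exact: signedZ.
  have -> : L' = (fun f => -1 * L f) by apply/funext => f; rewrite /L' /L; ring.
  rewrite ipZ//; last exact: signedZ.
  by rewrite (ip_sym _ sL bk (@lapk_sym R n t)) ?ipZ// ?L0 ?mulr0//; exact: signedZ.
have eqF F : closed F -> F `<=` X -> mu F = nu F.
  move=> cF FX; apply/eqP; rewrite eq_le.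
  by rewrite (measure_closed_le cX muX nuX t0 L0)// (measure_closed_le cX nuX muX t0 L'0).
have outX (p : probability (euclidean R n) R) C : p X = 1%E -> measurable C ->
    p C = p (C `&` X).
  move=> pX mC.
  have pX0 : p (~` X) = 0%E by rewrite probability_setC// pX subee.
  rewrite -{1}(setIT C) -(setUv X) setIUr measureU//.
  - rewrite [X in (_ + X)%E](_ : _ = 0%E) ?adde0//.
    apply/eqP; rewrite eq_le measure_ge0 andbT -pX0 le_measure ?inE//.
      by apply: measurableI => //; exact: measurableC.
    exact: measurableC.
  - exact: measurableI.
  - by apply: measurableI => //; exact: measurableC.
  - by rewrite setIACA setICr setI0.
have eqC C : closed C -> mu C = nu C.
  move=> cC; have mC := closed_measurable_euclidean cC.
  rewrite (outX mu)// (outX nu)//; apply: eqF; last exact: subIsetr.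
  exact: closedI.
apply: (@measure_unique _ R (euclidean R n) (@open (euclidean R n)) (fun=> setT)) => //.
- exact: euclidean_borelE.
- by move=> A B oA oB; exact: openI.
- by move=> _; exact: openT.
- by apply/seteqP; split => // x _; exists 0%N.
- move=> A oA; have mA := open_measurable_euclidean oA.
  have cP (p : probability (euclidean R n) R) : p A = (1 - p (~` A))%E.
    by rewrite -[in LHS](setCK A) probability_setC//; exact: measurableC.
  transitivity (1 - mu (~` A))%E; first exact: cP.
  rewrite (eqC (~` A)); last exact: open_closedC.
  by apply/esym; exact: cP.
- by move=> _; apply: le_lt_trans (ltry 1); exact: probability_le1.
Qed.

(** * Diversities of equilibrium measures *)

Section power_means.
Context d (T : measurableType d) (R : realType).
Variables (nu : probability T R) (X : set T).
Hypotheses (mX : measurable X) (nuX : nu X = 1%E).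
Variable l : T -> R.
Hypothesis bl : bmeas l.

Let nuXoo : (nu X < +oo)%E. Proof. by rewrite nuX ltry. Qed.

Let Rintegral_cst1 (c : R) : \int[nu]_(x in X) c = c.
Proof.
rewrite Rintegral_cst// -[RHS]mulr1; congr (_ * _); exact: (congr1 fine nuX).
Qed.

Lemma bmeas_expR (c : R) : bmeas (fun x => expR (c * l x)).
Proof.
have [ml [M lM]] := bl; split.
  by apply: measurableT_comp => //; exact: measurable_funM.
exists (expR (`|c| * M)) => x; rewrite ger0_norm ?expR_ge0// ler_expR.
by rewrite (le_trans (ler_norm _))// normrM ler_wpM2l.
Qed.

Let iexp c : nu.-integrable X (EFin \o (fun x => expR (c * l x))).
Proof. by apply: bmeas_integrable_restr => //; exact: bmeas_expR. Qed.

Let m := \int[nu]_(x in X) expR (- 1 * l x).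

Let m_gt0 : 0 < m.
Proof.
have [_ [M lM]] := bl; apply: (@lt_le_trans _ _ (expR (- M))); first exact: expR_gt0.
rewrite -[leLHS]Rintegral_cst1.
apply: le_Rintegral_bmeas => //; [exact: bmeas_cst|exact: bmeas_expR|].
move=> x _; rewrite ler_expR mulN1r lerN2.
exact: le_trans (ler_norm _) _.
Qed.

(** The tangent of [expR] at [p * y] is evaluated at 0 and at [y]; averaging with weights [1 - p]
    and [p] cancels the slopes. Only [1 + x <= expR x] is used. *)
Lemma expR_convex_le (p y : R) : 0 <= p <= 1 -> expR (p * y) <= 1 + p * (expR y - 1).
Proof.
move=> /andP[p0 p1].
have h0 : expR (p * y) * (1 - p * y) <= 1.
  rewrite -[leRHS](expRxMexpNx_1 (p * y)) ler_wpM2l ?expR_ge0//.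
  exact: expR_ge1Dx.
have h1 : expR (p * y) * (1 + (1 - p) * y) <= expR y.
  rewrite [leRHS](_ : _ = expR (p * y) * expR ((1 - p) * y)).
    by rewrite ler_wpM2l ?expR_ge0// expR_ge1Dx.
  by rewrite -expRD; congr expR; ring.
have p1' : 0 <= 1 - p by rewrite subr_ge0.
have -> : 1 + p * (expR y - 1) = (1 - p) * 1 + p * expR y by ring.
have -> : expR (p * y) = (1 - p) * (expR (p * y) * (1 - p * y)) +
    p * (expR (p * y) * (1 + (1 - p) * y)) by ring.
by apply: lerD; exact: ler_wpM2l.
Qed.

Lemma expR_convex_ge (p y : R) : p <= 0 -> 1 + p * (expR y - 1) <= expR (p * y).
Proof.
move=> p0; apply: le_trans (expR_ge1Dx _); rewrite lerD2l.
by rewrite ler_wnM2l// lerBrDl expR_ge1Dx.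
Qed.

(** Dividing by [m] makes the mean of [expR (- l)] equal to 1, so the affine correction integrates
    to 0. The pointwise bounds on [expR (p * y)] then give Jensen's inequality by plain
    integration. *)
Let normalised_mean (p : R) :
  \int[nu]_(x in X) (expR (p * ln m) * (1 + p * (m^-1 * expR (- 1 * l x) - 1))) =
  expR (p * ln m).
Proof.
have i1 c : nu.-integrable X (EFin \o (fun x : T => c : R)).
  by apply: bmeas_integrable_restr => //; exact: bmeas_cst.
have bm : bmeas (fun x => m^-1 * expR (- 1 * l x) - 1).
  by apply: bmeasD; [apply: bmeasM; [exact: bmeas_cst|exact: bmeas_expR]|exact: bmeas_cst].
have bpm : bmeas (fun x => p * (m^-1 * expR (- 1 * l x) - 1)).
  by apply: bmeasM => //; exact: bmeas_cst.
rewrite RintegralZl//; last first.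
  by apply: bmeas_integrable_restr => //; apply: bmeasD => //; exact: bmeas_cst.
rewrite RintegralD//; last exact: bmeas_integrable_restr.
rewrite RintegralZl//; last exact: bmeas_integrable_restr.
rewrite RintegralB//; last first.
  apply: bmeas_integrable_restr => //; apply: bmeasM; [exact: bmeas_cst|].
  exact: bmeas_expR.
by rewrite RintegralZl// !Rintegral_cst1 -/m mulVf ?gt_eqF// subrr mulr0 addr0 mulr1.
Qed.

Let normalised_expR (p : R) x :
  expR (- p * l x) = expR (p * ln m) * expR (p * (- l x - ln m)).
Proof. by rewrite -expRD; congr expR; ring. Qed.

Let expR_ratio x : expR (- l x - ln m) = m^-1 * expR (- 1 * l x).
Proof. by rewrite expRD mulrC (expRN (ln m)) lnK ?posrE// mulN1r. Qed.

Let bmeas_ratio (p : R) :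
  bmeas (fun x => expR (p * ln m) * (1 + p * (m^-1 * expR (- 1 * l x) - 1))).
Proof.
apply: bmeasM; first exact: bmeas_cst.
apply: bmeasD; first exact: bmeas_cst.
apply: bmeasM; first exact: bmeas_cst.
apply: bmeasD; last exact: bmeas_cst.
by apply: bmeasM; [exact: bmeas_cst|exact: bmeas_expR].
Qed.

(** Monotonicity of power means, applied with [p = 1 - q]. For [p < 0] the comparison of the
    integrals is reversed, and the negative outer exponent reverses it back. *)
Lemma power_mean_le (p : R) : p != 0 -> p <= 1 ->
  (\int[nu]_(x in X) expR (- p * l x)) `^ p^-1 <= m.
Proof.
move=> p0 p1; set E := \int[nu]_(x in X) _.
have mE : m = expR (p^-1 * (p * ln m)) by rewrite mulKf// lnK// posrE.
have [pn|pp] := ltP p 0.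
  have hE : expR (p * ln m) <= E.
    rewrite -normalised_mean; apply: le_Rintegral_bmeas => //; first exact: bmeas_expR.
    move=> x _; rewrite normalised_expR -expR_ratio ler_wpM2l ?expR_ge0//.
    exact/expR_convex_ge/ltW.
  have E0 : 0 < E by exact: lt_le_trans (expR_gt0 _) hE.
  rewrite /powR gt_eqF// [leRHS]mE ler_expR ler_wnM2l//.
    by rewrite invr_le0 ltW.
  by rewrite -[leLHS]expRK ler_ln ?posrE ?expR_gt0.
have {}pp : 0 < p by rewrite lt_neqAle eq_sym p0.
have hE : E <= expR (p * ln m).
  rewrite -normalised_mean; apply: le_Rintegral_bmeas => //; first exact: bmeas_expR.
  move=> x _; rewrite normalised_expR -expR_ratio ler_wpM2l ?expR_ge0//.
  by apply: expR_convex_le; rewrite ltW.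
rewrite /powR; have [E0|E0] := eqVneq E 0.
  by rewrite invr_eq0 (negbTE p0) ltW.
have {}E0 : 0 < E.
  by rewrite lt_neqAle eq_sym E0; apply: Rintegral_ge0 => x _; exact: expR_ge0.
rewrite [leRHS]mE ler_expR ler_wpM2l ?invr_ge0 ?(ltW pp)//.
by rewrite -[leRHS]expRK ler_ln ?posrE ?expR_gt0.
Qed.

(** The limiting case [p = 0], that is order 1: the tangent of [expR] at 0 takes the place of the
    two convexity bounds. *)
Lemma geometric_mean_le : expR (- \int[nu]_(x in X) l x) <= m.
Proof.
rewrite -[leRHS]lnK ?posrE// ler_expR.
have il : nu.-integrable X (EFin \o l) by exact: bmeas_integrable_restr.
have -> : - (\int[nu]_(x in X) l x) = \int[nu]_(x in X) (- 1 * l x).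
  by rewrite RintegralZl// mulN1r.
have bm : bmeas (fun x => m^-1 * expR (- 1 * l x)).
  by apply: bmeasM; [exact: bmeas_cst|exact: bmeas_expR].
have bm1 : bmeas (fun x => ln m - 1 + m^-1 * expR (- 1 * l x)).
  by apply: bmeasD => //; exact: bmeas_cst.
have -> : ln m = \int[nu]_(x in X) (ln m - 1 + m^-1 * expR (- 1 * l x)).
  rewrite RintegralD//; last exact: bmeas_integrable_restr.
    by rewrite RintegralZl// Rintegral_cst1 -/m mulVf ?gt_eqF// subrK.
  by apply: bmeas_integrable_restr => //; exact: bmeas_cst.
apply: le_Rintegral_bmeas => //.
  by apply: bmeasM => //; exact: bmeas_cst.
move=> x _; rewrite -expR_ratio mulN1r.
rewrite [leLHS](_ : _ = ln m - 1 + (1 + (- l x - ln m))); last by ring.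
by rewrite lerD2l expR_ge1Dx.
Qed.

End power_means.

Lemma am_gm (R : realType) (a b k : R) : 0 <= k ->
  a * (b * k) <= 2^-1 * (a * a * k + b * b * k).
Proof.
move=> k0; rewrite -mulrDl !mulrA; apply: ler_wpM2r => //.
have : 0 <= (a - b) ^+ 2 by exact: sqr_ge0.
have -> : (a - b) ^+ 2 = a * a + b * b - 2 * (a * b) by ring.
by lra.
Qed.

Lemma mean_arith (R : realType) (m e ss sm : R) : 0 < m -> ss <= m -> e * m <= sm ->
  0 <= ss - 2 * m * sm + m ^+ 2 * e -> e * m <= 1.
Proof.
move=> m0 ssm esm h; rewrite -(ler_pM2l m0) mulr1.
have : m * (e * m) <= m * sm by rewrite ler_wpM2l// ltW.
have -> : m * (e * m) = m ^+ 2 * e by ring.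
by move: h; rewrite -mulrA; lra.
Qed.

Lemma energy_arith (R : realType) (a b c : R) : a <= b -> b <= c -> a - 2 * c + b <= 0.
Proof. lra. Qed.

Section diversity_bound.
Variables (R : realType) (n : nat) (X : set (euclidean R n)) (t : R).
Notation T := (euclidean R n).
Hypotheses (compactX : compact X) (t_gt0 : 0 < t).

Let mX : measurable X. Proof. exact: compact_measurable_euclidean. Qed.

Lemma KmuE (nu : probability T R) x :
  Kmu (@scaled_dist _ R T t) X nu x = \int[nu]_(y in X) lapk t (x, y).
Proof. by []. Qed.

Section one_measure.
Variable nu : probability T R.
Hypothesis nuX : nu X = 1%E.

Let nuXoo : (nu X < +oo)%E. Proof. by rewrite nuX ltry. Qed.
Let K := Kmu (@scaled_dist _ R T t) X nu.
Let bk : bmeas (@lapk R n t). Proof. exact/bmeas_lapk/ltW. Qed.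

Lemma bmeas_Kmu : bmeas K.
Proof. exact: (bmeas_potential (signed_restr1 mX nuXoo) bk). Qed.

Lemma Kmu_le1 x : K x <= 1.
Proof.
rewrite /K KmuE; apply: (@le_trans _ _ (\int[nu]_(y in X) (1 : R))).
  apply: le_Rintegral_bmeas => //; [exact: bmeas_section1|exact: bmeas_cst|].
  move=> y _; rewrite -[leRHS]expR0 ler_expR oppr_le0 mulr_ge0 ?(ltW t_gt0)//.
  exact: edist_ge0.
rewrite Rintegral_cst// mul1r; have := congr1 fine nuX.
by move=> /= ->.
Qed.

Lemma Kmu_lbound : exists2 k0 : R, 0 < k0 & forall x, X x -> k0 <= K x.
Proof.
have [X0|/set0P[x0 Xx0]] := eqVneq X set0.
  by exists 1 => // x; rewrite X0.
have [D D0 XD] := compact_edist_bounded x0 compactX.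
exists (expR (- (t * (D + D)))) => [|x Xx]; first exact: expR_gt0.
rewrite /K KmuE; apply: (@le_trans _ _ (\int[nu]_(y in X) expR (- (t * (D + D))))).
  rewrite Rintegral_cst//; have := congr1 fine nuX.
  by move=> /= ->; rewrite mulr1.
apply: le_Rintegral_bmeas => //; [exact: bmeas_cst|exact: bmeas_section1|].
move=> y Xy; rewrite ler_expR lerN2 ler_wpM2l ?(ltW t_gt0)//=.
apply: le_trans (edist_triangle x0 _ _) _.
by rewrite lerD ?XD// edist_sym XD.
Qed.

(** Cut off outside [X], where [K] need not have a positive lower bound, so that it is bounded
    everywhere and can serve as [l] in the power means. *)
Definition logK x : R := \1_X x * ln (K x).

Lemma bmeas_logK : bmeas logK.
Proof.
have [k0 k00 k0K] := Kmu_lbound; split.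
  apply: measurable_funM; first exact: measurable_indic.
  by apply: (measurableT_comp (@measurable_ln R)); exact: bmeas_Kmu.1.
exists `|ln k0| => x; rewrite /logK indicE; case: (boolP (x \in X)) => [|_].
  rewrite inE => Xx; rewrite mul1r.
  have K0 : 0 < K x by exact: lt_le_trans (k0K x Xx).
  rewrite ler0_norm ?ln_le0 ?Kmu_le1// ler_normr; apply/orP; right.
  by rewrite lerN2 ler_ln ?posrE// k0K.
by rewrite mul0r normr0.
Qed.

Lemma expR_logK c x : X x -> expR (c * logK x) = K x `^ c.
Proof.
move=> Xx; have [k0 k00 k0K] := Kmu_lbound.
have K0 : 0 < K x by exact: lt_le_trans (k0K x Xx).
by rewrite /logK indicE mem_set// mul1r /powR gt_eqF.
Qed.

(** The diversity of order 0, which dominates those of all other orders. *)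
Definition mean_invK := \int[nu]_(x in X) expR (- 1 * logK x).

Lemma prob_on_ae (P : T -> Prop) : (forall x, X x -> P x) -> \forall x \ae nu, P x.
Proof.
move=> XP; exists (~` X); split.
- exact: measurableC.
- by rewrite probability_setC//; apply/eqP; rewrite sube_eq// ?add0e ?nuX.
- by move=> x /= nP Xx; exact/nP/XP.
Qed.

Lemma mean_invK_gt0 : 0 < mean_invK.
Proof.
have bl := bmeas_logK; have [_ [M lM]] := bl.
apply: (@lt_le_trans _ _ (expR (- M))); first exact: expR_gt0.
have -> : expR (- M) = \int[nu]_(x in X) expR (- M).
  rewrite Rintegral_cst// -[LHS]mulr1; congr (_ * _).
  by apply/esym; exact: (congr1 fine nuX).
apply: le_Rintegral_bmeas => //; [exact: bmeas_cst|exact: bmeas_expR|].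
move=> x _; rewrite ler_expR mulN1r lerN2.
exact: le_trans (ler_norm _) _.
Qed.

(** With [s] the essential supremum, [1 <= s / K] holds almost everywhere on [X]; integrate. The
    bounds [Sge] and [Sle] ensure that [s] is a positive real number. *)
Lemma ess_sup_le_mean : (fine (ess_sup nu (EFin \o K)))^-1 <= mean_invK.
Proof.
have [k0 k00 k0K] := Kmu_lbound.
have nuT : (0 < nu setT)%E by rewrite probability_setT.
have Sge : (k0%:E <= ess_sup nu (EFin \o K))%E.
  by apply: ess_sup_gee => //; apply: prob_on_ae => x Xx; rewrite lee_fin k0K.
have Sle : (ess_sup nu (EFin \o K) <= 1%:E)%E.
  by apply/ess_supP; apply: prob_on_ae => x Xx; rewrite lee_fin Kmu_le1.
have := ess_sup_ge nu (EFin \o K).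
move: Sge Sle; case: (ess_sup _ _) => [s| |]//=.
rewrite !lee_fin => k0s _ Ks.
have s0 : 0 < s by exact: lt_le_trans k0s.
rewrite -div1r ler_pdivrMr//.
have bh : bmeas (fun x => expR (- 1 * logK x) * s).
  by apply: bmeasM; [exact/bmeas_expR/bmeas_logK|exact: bmeas_cst].
rewrite -RintegralZr//; last exact/bmeas_integrable_restr/bmeas_expR/bmeas_logK.
rewrite -lee_fin fineK; last exact/integrable_fin_num/bmeas_integrable_restr.
rewrite [leLHS](_ : _ = \int[nu]_(x in X) (cst 1 x))%E; last first.
  by rewrite integral_cst// mul1e; exact: esym nuX.
apply: ae_ge0_le_integral => //.
- by move=> x _; rewrite lee_fin mulr_ge0 ?expR_ge0 ?ltW.
- by apply/measurable_EFinP/measurable_funTS; case: bh.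
apply: filterS Ks => x; rewrite /= lee_fin => Kx Xx.
have K0 : 0 < K x by exact: lt_le_trans (k0K x Xx).
by rewrite -[1%E]/(1%:E) lee_fin expR_logK// powR_inv1 ?(ltW K0)// ler_pdivlMl// mulr1.
Qed.

Lemma diversity_le_mean q : (0 <= q)%E ->
  diversity (@scaled_dist _ R T t) X q nu <= mean_invK.
Proof.
case: q => [r| |//]; last first.
  by move=> _ /=; exact: ess_sup_le_mean.
rewrite lee_fin => r0 /=; case: eqVneq => [_|r1].
  rewrite (_ : Rintegral _ _ _ = \int[nu]_(x in X) logK x).
    exact: geometric_mean_le bmeas_logK.
  apply: eq_Rintegral => x; rewrite inE => Xx.
  by rewrite /logK indicE mem_set// mul1r.
rewrite (_ : Rintegral _ _ _ = \int[nu]_(x in X) expR (- (1 - r) * logK x)).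
  apply: power_mean_le => //; first exact: bmeas_logK.
    by rewrite subr_eq0 eq_sym.
  by rewrite gerBl.
by apply: eq_Rintegral => x; rewrite inE => Xx; rewrite expR_logK// opprB.
Qed.

End one_measure.

Let bk : bmeas (@lapk R n t). Proof. exact/bmeas_lapk/ltW. Qed.
Let K nu := Kmu (@scaled_dist _ R T t) X nu.

(* Such a measure minimises the energy [\int K mu dmu] over [P(X)]: these are
   the first-order conditions. *)
Definition equilibrium (mu : probability T R) (e : R) :=
  [/\ mu X = 1%E, 0 < e, (forall x, X x -> e <= K mu x) &
      \int[mu]_(x in X) K mu x = e].

(* With [sigma = nu / K nu], of mass [m], one has [<sigma, sigma> <= m] by AM-GM
   and [<sigma, sigma> >= m^2 e] by positive definiteness. *)
Lemma mean_invK_le (mu nu : probability T R) e : equilibrium mu e -> nu X = 1%E ->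
  mean_invK nu <= e^-1.
Proof.
move=> [muX e0 eK Ee] nuX.
have muXoo : (mu X < +oo)%E by rewrite muX ltry.
have nuXoo : (nu X < +oo)%E by rewrite nuX ltry.
pose h x := expR (- 1 * logK nu x).
have bh : bmeas h by exact/bmeas_expR/bmeas_logK.
have bh2 : bmeas (fun x => h x * h x) by exact: bmeasM.
pose S f := \int[nu]_(x in X) (h x * f x).
pose S2 f := \int[nu]_(x in X) ((h x * h x) * f x).
pose N f := \int[nu]_(x in X) f x.
pose M f := \int[mu]_(x in X) f x.
have sS : signed S by exact: signed_restr.
have sS2 : signed S2 by exact: signed_restr.
have sN : signed N by exact: signed_restr1.
have sM : signed M by exact: signed_restr1.
have m0 := mean_invK_gt0 nuX.
set m := mean_invK nu in m0 *.
have [k0 k00 k0K] := Kmu_lbound nuX.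
have hhK x : X x -> h x * h x * K nu x = h x.
  move=> Xx; have K0 : 0 < K nu x by exact: lt_le_trans (k0K x Xx).
  by rewrite /h expR_logK// powR_inv1 ?ltW// mulfVK// gt_eqF.
have bKn : bmeas (K nu) by exact: bmeas_Kmu.
have bKm : bmeas (K mu) by exact: bmeas_Kmu.
have SM : e * m <= ip (lapk t) S M.
  rewrite /m /mean_invK -RintegralZl//; last exact: bmeas_integrable_restr.
  apply: le_Rintegral_bmeas => //.
  - by apply: bmeasM => //; exact: bmeas_cst.
  - exact: bmeasM.
  - by move=> x Xx; rewrite mulrC ler_wpM2l ?expR_ge0//; exact: eK.
have S2N : S2 (K nu) = m by apply: eq_Rintegral => x; rewrite inE => /hhK.
have bS2 : bmeas (fun x => S2 (fun y => lapk t (x, y))) by exact: bmeas_potential sS2 bk.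
have bh2K : bmeas (fun x => h x * h x * K nu x) := bmeasM bh2 bKn.
have ibir f := @bmeas_integrable_restr _ T R nu X f mX nuXoo.
(* AM-GM replaces [h x * h y] by half the sum of the squares. By symmetry of the kernel each square
   contributes the integral of [h ^+ 2 * K nu = h], which is [m]. *)
have SS : ip (lapk t) S S <= m.
  have -> : m = \int[nu]_(x in X)
      (2^-1 * ((h x * h x) * K nu x + S2 (fun y => lapk t (x, y)))).
    rewrite (RintegralZl _ mX (ibir _ (bmeasD bh2K bS2))).
    rewrite (RintegralD mX (ibir _ bh2K) (ibir _ bS2)).
    rewrite -/(S2 (K nu)) S2N.
    have -> : \int[nu]_(x in X) S2 (fun y => lapk t (x, y)) = ip (lapk t) N S2 by [].
    rewrite ip_Fubini//.
    have -> : S2 (fun y => N (fun x => lapk t (x, y))) = m.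
      rewrite -S2N; apply: (congr1 S2); apply/funext => y.
      rewrite /K KmuE; apply: eq_Rintegral => x _; exact: lapk_sym.
    by field.
  apply: le_Rintegral_bmeas => //.
  - exact: bmeasM bh (bmeas_potential sS bk).
  - exact: bmeasM (bmeas_cst T _) (bmeasD bh2K bS2).
  move=> x Xx; have bkx : bmeas (fun y => lapk t (x, y)) := bmeas_section1 x bk.
  have bhk : bmeas (fun y => h y * lapk t (x, y)) := bmeasM bh bkx.
  have bhhk : bmeas (fun y => h y * h y * lapk t (x, y)) := bmeasM bh2 bkx.
  have bck : bmeas (fun y => h x * h x * lapk t (x, y)) := bmeasM (bmeas_cst T _) bkx.
  have bsum := bmeasD bck bhhk.
  rewrite /S -(RintegralZl _ mX (ibir _ bhk)).
  have -> : 2^-1 * (h x * h x * K nu x + S2 (fun y => lapk t (x, y))) =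
      \int[nu]_(y in X) (2^-1 * (h x * h x * lapk t (x, y) + h y * h y * lapk t (x, y))).
    rewrite (_ : K nu x = \int[nu]_(y in X) lapk t (x, y)); last exact: KmuE.
    rewrite (RintegralZl _ mX (ibir _ bsum)) (RintegralD mX (ibir _ bck) (ibir _ bhhk)).
    have e1 := RintegralZl (h x * h x) mX (ibir _ bkx).
    by apply: congr1; apply: (f_equal2 _ (esym e1)).
  apply: le_Rintegral_bmeas => //.
  - exact: bmeasM (bmeas_cst T _) bhk.
  - exact: bmeasM (bmeas_cst T _) bsum.
  by move=> y Xy; apply: am_gm; exact: expR_ge0.
have MM : ip (lapk t) M M = e by rewrite -Ee.
have := psd_sub m sS sM bk (@lapk_sym R n t) (psd_lapk t_gt0).
rewrite MM => h0.
rewrite -div1r ler_pdivlMr// mulrC.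
exact: mean_arith h0.
Qed.

Section equilibrium_measure.
Variables (mu : probability T R) (e : R).
Hypothesis eqmu : equilibrium mu e.

Let muX : mu X = 1%E. Proof. by case: eqmu. Qed.
Let e_gt0 : 0 < e. Proof. by case: eqmu. Qed.
Let muXoo : (mu X < +oo)%E. Proof. by rewrite muX ltry. Qed.
Let bK : bmeas (K mu). Proof. exact: bmeas_Kmu. Qed.

(** [K mu - e] is nonnegative on [X] and integrates to 0. *)
Lemma equilibrium_ae : \forall x \ae mu, X x -> K mu x = e.
Proof.
have [_ _ eK Ee] := eqmu.
have ime : mu.-integrable X (EFin \o cst e).
  exact: bmeas_integrable_restr mX muXoo (bmeas_cst T e).
have iK : mu.-integrable X (EFin \o K mu).
  exact: bmeas_integrable_restr mX muXoo bK.
have me : \int[mu]_(x in X) (cst e x) = e.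
  rewrite Rintegral_cst// -[RHS]mulr1; congr (_ * _).
  exact: (congr1 fine muX).
have bD : bmeas (fun x => K mu x - e) := bmeasD bK (bmeas_cst T (- e)).
have iD := bmeas_integrable_restr mX muXoo bD.
have : \int[mu]_(x in X) (K mu x - e) = 0.
  have := RintegralB mX iK ime; rewrite Ee me subrr.
  by [].
move=> D0.
have : ae_eq mu X (fun x => (K mu x - e)%:E) (cst 0%E).
  apply/ae_eq_integral_abs => //.
    by apply/measurable_EFinP/measurable_funTS; case: bD.
  rewrite (_ : integral _ _ _ = \int[mu]_(x in X) (K mu x - e)%:E)%E.
    have := integrable_fin_num mX iD; move/fineK => <-.
    by congr EFin.
  apply: eq_integral => x; rewrite inE => Xx.
  by rewrite gee0_abs// lee_fin subr_ge0 eK.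
apply: filterS => x h Xx; have [/eqP] := h Xx.
by rewrite subr_eq0 => /eqP.
Qed.

Let Rintegral_equilibrium (phi : R -> R) : measurable_fun setT phi ->
  \int[mu]_(x in X) phi (K mu x) = phi e.
Proof.
move=> mphi.
transitivity (\int[mu]_(x in X) (cst (phi e) x)).
  congr fine; apply: ae_eq_integral => //.
  - by apply/measurable_EFinP/measurable_funTS; apply: measurableT_comp => //; case: bK.
  - exact: (measurable_cst (phi e)%:E).
  - by apply: filterS equilibrium_ae => x h Xx; rewrite h.
rewrite Rintegral_cst// -[RHS]mulr1; congr (_ * _).
exact: (congr1 fine muX).
Qed.

Lemma equilibrium_diversity q : (0 <= q)%E ->
  diversity (@scaled_dist _ R T t) X q mu = e^-1.
Proof.
case: q => [r| |//] r0 /=.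
  case: eqVneq => [_|r1].
    by rewrite (Rintegral_equilibrium (@measurable_ln R)) expRN lnK// posrE.
  rewrite (Rintegral_equilibrium (@measurable_powR R (r - 1))) -powRrM.
  rewrite (_ : (r - 1) * (1 - r)^-1 = - 1); last first.
    by rewrite -[r - 1]opprB mulNr divff// subr_eq0 eq_sym.
  by rewrite powR_inv1// ltW.
have muT : (0 < mu setT)%E by rewrite probability_setT.
rewrite (_ : ess_sup _ _ = e%:E)//; apply: ess_sup_ae_cst; first exact: muT.
have [N [mN N0 hN]] := equilibrium_ae.
have [N' [mN' N'0 hN']] := prob_on_ae muX (fun x (Xx : X x) => Xx).
exists (N `|` N'); split.
- exact: measurableU.
- by rewrite measureU0.
- move=> x /= nK; have [Xx|nX] := pselect (X x).
    by left; apply: hN => /= /(_ Xx) KE; apply: nK; rewrite -KE.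
  by right; exact: hN'.
Qed.

Lemma equilibrium_maximising : maximising (@scaled_dist _ R T t) X mu.
Proof.
split; first exact: muX.
move=> q q0 nu nuX; rewrite equilibrium_diversity//.
exact: le_trans (diversity_le_mean nuX q0) (mean_invK_le eqmu nuX).
Qed.

Lemma equilibrium_unique : unique_maximising (@scaled_dist _ R T t) X mu.
Proof.
split; first exact: equilibrium_maximising.
move=> nu [nuX numax] A mA.
have nuXoo : (nu X < +oo)%E by rewrite nuX ltry.
have q2 : (0 <= 2%:E :> \bar R)%E by rewrite lee_fin.
(* At order 2 the diversity is the reciprocal of the energy, so maximality of [nu] bounds its energy
   by [e]. *)
have := numax 2%:E q2 mu muX; rewrite equilibrium_diversity//=.
have h21 : (2 == 1 :> R) = false by rewrite (eqr_nat R 2 1).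
rewrite h21 => h.
set E := \int[nu]_(x in X) K nu x.
have [k0 k00 k0K] := Kmu_lbound nuX.
have E0 : 0 < E.
  apply: (lt_le_trans k00).
  rewrite -[leLHS](_ : \int[nu]_(x in X) k0 = k0); last first.
    rewrite Rintegral_cst// -[RHS]mulr1; congr (_ * _).
    exact: (congr1 fine nuX).
  apply: le_Rintegral_bmeas => //; [exact: bmeas_cst|exact: bmeas_Kmu].
have Ee : E <= e.
  rewrite -lef_pV2 ?posrE//; apply: le_trans h _.
  rewrite (_ : Rintegral _ _ _ = E); last first.
    apply: eq_Rintegral => x; rewrite inE => Xx.
    rewrite (_ : 2 - 1 = 1 :> R); last by ring.
    by rewrite powRr1// (le_trans (ltW k00))// k0K.
  rewrite (_ : (1 - 2)^-1 = - 1 :> R); last by field.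
  by rewrite powR_inv1// ltW.
pose M f := \int[mu]_(x in X) f x.
pose N f := \int[nu]_(x in X) f x.
have sM : signed M := signed_restr1 mX muXoo.
have sN : signed N := signed_restr1 mX nuXoo.
have [_ _ eK EM] := eqmu.
have NM : e <= ip (lapk t) N M.
  rewrite -[leLHS](_ : \int[nu]_(x in X) e = e); last first.
    rewrite Rintegral_cst// -[RHS]mulr1; congr (_ * _).
    exact: (congr1 fine nuX).
  apply: le_Rintegral_bmeas => //; exact: bmeas_cst.
have sL : signed (fun f => N f + -1 * M f) by apply: signedD => //; exact: signedZ.
apply: (@lapk_measure_eq R n X nu mu t compactX nuX muX t_gt0) => //.
apply/eqP; rewrite eq_le (psd_lapk t_gt0 sL) andbT.
have -> : ip (lapk t) (fun f => N f + -1 * M f) (fun f => N f + -1 * M f) =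
    E - 2 * ip (lapk t) N M + e.
  have s1M : signed (fun f => - 1 * M f) by exact: signedZ.
  have lsym := @lapk_sym R n t.
  rewrite (ipD sL sN s1M bk) (ipZ _ sL sM bk).
  rewrite (ip_sym sL sN bk lsym) (ip_sym sL sM bk lsym).
  rewrite (ipD sN sN s1M bk) (ipZ _ sN sM bk) (ipD sM sN s1M bk) (ipZ _ sM sM bk).
  rewrite (ip_sym sM sN bk lsym).
  have -> : ip (lapk t) M M = e by rewrite -EM.
  have -> : ip (lapk t) N N = E by [].
  by ring.
exact: energy_arith.
Qed.

End equilibrium_measure.

End diversity_bound.

(** * Existence of equilibrium measures *)

Section minimiser_arith.
Variable R : realType.

(** The budget is 26 = 8 + 8 + 2 * 5: both energies are known up to 8 units [t * m], the cross term
    up to 5, with a coefficient of at most 2. *)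
Lemma mixture_form_arith (E Es F Fs P B s t m : R) : 0 <= s <= 1 -> 0 <= t * m ->
  `|E - F| <= t * 8 * m -> `|Es - Fs| <= t * 8 * m -> `|P - B| <= t * 5 * m ->
  E <= Es -> Fs = (1 - s) ^+ 2 * F + 2 * s * (1 - s) * B + s ^+ 2 ->
  E <= (1 - s) ^+ 2 * E + 2 * s * (1 - s) * P + s ^+ 2 + t * 26 * m.
Proof.
move=> /andP[s0 s1]; set u := t * m => u0.
have -> : t * 8 * m = 8 * u by rewrite /u; ring.
have -> : t * 5 * m = 5 * u by rewrite /u; ring.
have -> : t * 26 * m = 26 * u by rewrite /u; ring.
rewrite !ler_norml => /andP[EF _] /andP[_ EsFs] /andP[PB _] EEs FsE.
have a0 : 0 <= (1 - s) ^+ 2 by exact: sqr_ge0.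
have a1 : (1 - s) ^+ 2 <= 1 by rewrite expr_le1// ?subr_ge0// gerBl.
have b0 : 0 <= 2 * s * (1 - s) by rewrite !mulr_ge0// subr_ge0.
have b2 : 2 * s * (1 - s) <= 2.
  by rewrite -[leRHS]mulr1 ler_pM ?mulr_ge0 ?subr_ge0 ?gerBl// -[leRHS]mulr1 ler_pM2l.
move: a0 a1 b0 b2 FsE; set a := (1 - s) ^+ 2; set b := 2 * s * (1 - s) => a0 a1 b0 b2 FsE.
have aF : a * F <= a * E + 8 * u.
  apply: (@le_trans _ _ (a * (E + 8 * u))); first by apply: ler_wpM2l => //; lra.
  by rewrite mulrDr lerD2l ler_piMl// mulr_ge0.
have bB : b * B <= b * P + 10 * u.
  apply: (@le_trans _ _ (b * (P + 5 * u))); first by apply: ler_wpM2l => //; lra.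
  have -> : 10 * u = 2 * (5 * u) by ring.
  by rewrite mulrDr lerD2l ler_wpM2r// mulr_ge0.
by lra.
Qed.

(** The derivative at [s = 0] of the energy towards a point mass is nonnegative. After division by
    [2 * s] the remaining error is at most [s], because [E - 2 * P + 1 <= 2]. *)
Lemma first_order_arith (E P : R) : E <= 1 -> 0 <= P ->
  (forall s, 0 <= s <= 1 ->
    E <= (1 - s) ^+ 2 * E + 2 * s * (1 - s) * P + s ^+ 2) -> E <= P.
Proof.
move=> E1 P0 h.
have small s : 0 < s -> s <= 1 -> E <= P + s.
  move=> s0 s1; have := h s; rewrite (ltW s0) s1 => /(_ isT) hs.
  have : s * (2 * E) <= s * (2 * P + s * (E - 2 * P + 1)) by move: hs; lra.
  rewrite ler_pM2l// => h2.
  have : s * (E - 2 * P + 1) <= s * 2 by rewrite ler_wpM2l ?(ltW s0)//; lra.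
  by lra.
apply/ler_addgt0Pr => e e0; apply: (@le_trans _ _ (P + Num.min e 1)).
  by apply: small; rewrite ?lt_min ?e0 ?ltr01// ge_min lexx orbT.
by rewrite lerD2l ge_min lexx.
Qed.

End minimiser_arith.

Section signed_sum.
Context d (T : measurableType d) (R : realType).

Lemma bmeas_sum (W : nat) (c : 'I_W -> R) (f : 'I_W -> T -> R) :
  (forall i, bmeas (f i)) -> bmeas (fun x => \sum_i c i * f i x).
Proof.
move=> bf; elim: (index_enum _) => [|i s IH].
  rewrite (_ : (fun=> _) = fun=> 0); first exact: bmeas_cst.
  by apply/funext => x; rewrite big_nil.
rewrite (_ : (fun=> _) = fun x => c i * f i x + \sum_(j <- s) c j * f j x).
  by apply: bmeasD => //; apply: bmeasM => //; exact: bmeas_cst.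
by apply/funext => x; rewrite big_cons.
Qed.

Lemma signed_lin_sum L (W : nat) (c : 'I_W -> R) (f : 'I_W -> T -> R) :
  signed L -> (forall i, bmeas (f i)) ->
  L (fun x => \sum_i c i * f i x) = \sum_i c i * L (f i).
Proof.
move=> sL bf; pose F s x := \sum_(j <- s) c j * f j x.
suff bF s : bmeas (F s) /\ L (F s) = \sum_(j <- s) c j * L (f j) by exact: (bF _).2.
elim: s => [|i s [IH1 IH2]].
  have -> : F [::] = fun=> 0 * 0 by apply/funext => x; rewrite /F big_nil mul0r.
  by split; rewrite ?signed_linZ ?mul0r ?big_nil//; exact: bmeas_cst.
have bi : bmeas (fun x => c i * f i x) by apply: bmeasM => //; exact: bmeas_cst.
have -> : F (i :: s) = fun x => c i * f i x + F s x.
  by apply/funext => x; rewrite /F big_cons.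
by split; [exact: bmeasD|rewrite signed_linD// signed_linZ// big_cons IH2].
Qed.

Lemma Rintegral_near (m : {measure set T -> \bar R}) (A : set T) (f g : T -> R) b :
  measurable A -> m A = 1%E -> bmeas f -> bmeas g ->
  (forall x, A x -> `|f x - g x| <= b) ->
  `|\int[m]_(x in A) f x - \int[m]_(x in A) g x| <= b.
Proof.
move=> mA mA1 bf bg fg.
have mAoo : (m A < +oo)%E by rewrite mA1 ltry.
have bb : bmeas (fun=> b : R) := bmeas_cst T b.
have half f1 f2 : bmeas f1 -> bmeas f2 -> (forall x, A x -> f1 x <= f2 x + b) ->
    \int[m]_(x in A) f1 x <= \int[m]_(x in A) f2 x + b.
  move=> b1 b2 h; apply: le_trans (le_Rintegral_bmeas mA mAoo b1 (bmeasD b2 bb) h) _.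
  rewrite (signed_linD (signed_restr1 mA mAoo) b2 bb) Rintegral_cst//.
  by rewrite mA1 mulr1.
rewrite ler_norml; apply/andP; split.
  rewrite lerNl opprB lerBlDl; apply: half => // x Ax.
  by have := fg x Ax; rewrite ler_norml => /andP[+ _]; rewrite lerNl opprB lerBlDl.
rewrite lerBlDl; apply: half => // x Ax.
by have := fg x Ax; rewrite ler_norml => /andP[_]; rewrite lerBlDl.
Qed.

Lemma Rintegral_cst_prob (m : {measure set T -> \bar R}) (A : set T) (b : R) :
  measurable A -> m A = 1%E -> \int[m]_(x in A) b = b.
Proof. by move=> mA mA1; rewrite Rintegral_cst// mA1 mulr1. Qed.

(** Along an ultrafilter a cluster point is a limit. All entries of a sequence of codes thus
    converge along one filter, with no diagonal extraction. *)
Lemma ultra_cvg (U : set_system nat) (u : nat -> R) : UltraFilter U ->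
  (forall m, 0 <= u m <= 1) -> exists l : R, u @ U --> l.
Proof.
move=> UU u01.
have FX : (u @ U) `[0, 1]%classic.
  by apply: (@filterS _ U _ setT) filterT => m _; rewrite /= in_itv/=.
have [l [_ cl]] := segment_compact (fmap_proper_filter u _) FX.
exists l => B nB; have [//|UB] := in_ultra_setVsetC (u @^-1` B) UU.
by have [x [nBx Bx]] := cl (~` B) B UB nB.
Qed.

End signed_sum.

(** * Trees of nets and the measures coded by them *)

Section compact_tree.
Variables (R : realType) (n : nat) (X : set (euclidean R n)).
Notation T := (euclidean R n).
Hypothesis compactX : compact X.

Lemma compact_net (r : R) : 0 < r ->
  exists2 s : seq T, (forall y, y \in s -> X y) &
    forall z, X z -> exists2 y, y \in s & edist z y <= r.
Proof.
move=> r0; move: compactX; rewrite compact_cover.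
have oB (y : T) : X y -> open [set z : T | edist y z < r].
  move=> _; rewrite (_ : mkset _ = thicken [set y] r); first exact: open_thicken.
  by apply/seteqP; split=> z /= => [yz|[_ -> //]]; exists y.
move=> /(_ _ X (fun y => [set z : T | edist y z < r]) oB)[|D DX XD].
  by move=> z Xz; exists z => //=; rewrite edistxx.
exists (finmap.enum_fset D) => [y yD|z /XD[y /= yD yz]].
  by have := DX y yD; rewrite inE.
by exists y => //; rewrite edist_sym ltW.
Qed.

Variables (x0 : T) (D : R).
Hypotheses (Xx0 : X x0) (D0 : 0 < D) (XD : forall y, X y -> edist x0 y <= D).

(** Level 0 consists of [x0] alone, which is within [D] of all of [X]; each level halves the
    scale. *)
Definition mesh (N : nat) : R := D / 2 ^+ N.

Lemma mesh_gt0 N : 0 < mesh N.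
Proof. by rewrite divr_gt0// exprn_gt0. Qed.

Lemma meshS N : mesh N = 2 * mesh N.+1.
Proof. by rewrite /mesh exprS; field; rewrite expf_neq0. Qed.

Lemma mesh_small (c e : R) : 0 < e -> exists L, c * mesh L < e.
Proof.
move=> e0; exists (Num.truncn (e^-1 * (c * D))).+1.
rewrite /mesh mulrA ltr_pdivrMr ?exprn_gt0// -ltr_pdivrMl//.
by apply: lt_trans (truncnS_gt _) _; rewrite -natrX ltr_nat ltn_expl.
Qed.

Lemma le_mesh (c a b : R) : (forall L, a <= b + c * mesh L) -> a <= b.
Proof.
move=> ab; apply/ler_addgt0Pl => e /(mesh_small c)[L Le].
by rewrite addrC (le_trans (ab L))// lerD2l ltW.
Qed.

Let net_ex N : exists s : seq T, [/\ (0 < size s)%N, (forall y, y \in s -> X y) &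
    forall z, X z -> exists2 y, y \in s & edist z y <= mesh N.+1].
Proof.
have [s sX Xs] := compact_net (mesh_gt0 N.+1).
exists s; split => //; have [y + _] := Xs x0 Xx0.
by case: s {sX Xs}.
Qed.

(** Net [N] has the scale of level [N.+1]: it supplies the children of the nodes of level [N]. *)
Definition net N : seq T := projT1 (cid (net_ex N)).
Definition radix N := size (net N).

Fixpoint width N : nat := if N is N'.+1 then (width N' * radix N')%N else 1.

(* Nodes of level [N] are numbered [0 .. width N - 1]; the parent of [i] at level
   [N.+1] is [i %/ radix N], and the child of [p] with the [j]-th net point is
   that point if it lies within [2 mesh N] of [p], and [p] itself otherwise. *)
Fixpoint node N (i : nat) : T :=
  if N is N'.+1 then
    let p := node N' (i %/ radix N')%N in
    let y := nth x0 (net N') (i %% radix N')%N in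
    if edist y p <= 2 * mesh N' then y else p
  else x0.

Lemma radix_gt0 N : (0 < radix N)%N.
Proof. by rewrite /radix /net; case: cid => s []. Qed.

Lemma width_gt0 N : (0 < width N)%N.
Proof. by elim: N => // N IH; rewrite /= muln_gt0 IH radix_gt0. Qed.

Lemma nodeX N i : X (node N i).
Proof.
elim: N i => [|N IH] i //=; case: ifP => _; last exact: IH.
have := radix_gt0 N; rewrite /radix /net; case: cid => s/= [_ sX _] s0.
by apply: sX; rewrite mem_nth// ltn_mod.
Qed.

Lemma node_step N i : edist (node N.+1 i) (node N (i %/ radix N)%N) <= 2 * mesh N.
Proof.
rewrite /=; case: ifP => // _; rewrite edistxx mulr_ge0//.
exact/ltW/mesh_gt0.
Qed.

Lemma node_child z N i : X z -> (i < width N)%N -> edist z (node N i) <= mesh N ->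
  exists j, [/\ (j < width N.+1)%N, (j %/ radix N)%N = i &
    edist z (node N.+1 j) <= mesh N.+1].
Proof.
move=> Xz iN zi.
have [j jr zj] : exists2 j, (j < radix N)%N & edist z (nth x0 (net N) j) <= mesh N.+1.
  rewrite /radix /net; case: cid => s/= [_ _ /(_ z Xz)[y ys zy]].
  by exists (index y s); rewrite ?index_mem// nth_index.
have r0 := radix_gt0 N.
exists (i * radix N + j)%N; split => /=.
- by rewrite (@leq_trans (i.+1 * radix N))// ?leq_mul2r ?iN ?orbT// mulSn addnC ltn_add2r.
- by rewrite divnMDl// divn_small// addn0.
rewrite divnMDl// (divn_small jr) addn0 modnMDl (modn_small jr) ifT//.
(* The net point near [z] is within [mesh N.+1 + mesh N] of the parent, below the threshold
   [2 * mesh N] in [node], so it is kept as a child. *)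
apply: le_trans (edist_triangle z _ _) _.
rewrite (edist_sym _ z) (le_trans (lerD zj zi))// (meshS N).
by have := mesh_gt0 N.+1; lra.
Qed.

Lemma node_path z : X z -> exists i : nat -> nat, forall N,
  [/\ (i N < width N)%N, (i N.+1 %/ radix N)%N = i N &
      edist z (node N (i N)) <= mesh N].
Proof.
move=> Xz.
pose good N i := (i < width N)%N /\ edist z (node N i) <= mesh N.
have /choice[c cP] : forall Ni : nat * nat, exists j, good Ni.1 Ni.2 ->
    good Ni.1.+1 j /\ (j %/ radix Ni.1)%N = Ni.2.
  move=> [N i]; have [[iN zi]|ng] := pselect (good N i).
    by have [j [jN ji zj]] := node_child Xz iN zi; exists j.
  by exists 0%N => /ng.
pose i := fix i N := if N is N'.+1 then c (N', i N') else 0%N.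
have gi N : good N (i N).
  elim: N => [|N IH]; last by have [] := cP (N, i N) IH.
  by split => //=; rewrite edist_sym (le_trans (XD Xz))// /mesh expr0 divr1.
by exists i => N; split; [exact: (gi N).1|exact: (cP (N, i N) (gi N)).2|exact: (gi N).2].
Qed.

(* [C L a] is the total mass of the first [a] nodes of level [L]; the last
   condition says that a node has the mass of its children. *)
Definition tree_cdf (C : nat -> nat -> R) := [/\ forall L, C L 0%N = 0,
  forall L a, (width L <= a)%N -> C L a = 1,
  forall L a, C L a <= C L a.+1 & forall L a, C L.+1 (a * radix L)%N = C L a].

Section tree_measure.
Variable C : nat -> nat -> R.
Hypothesis treeC : tree_cdf C.

Let cell L a := [set u : R | C L a <= u < C L a.+1].

Let C_mono L a b : (a <= b)%N -> C L a <= C L b.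
Proof.
move=> /subnK <-; elim: (b - a)%N => [|k IH]; first by rewrite add0n.
by rewrite addSn (le_trans IH)//; have [_ _ + _] := treeC; exact.
Qed.

Let cell_ex L (u : R) : 0 <= u < 1 -> exists2 a, (a < width L)%N & cell L a u.
Proof.
move=> /andP[u0 u1]; have [C0 C1 _ _] := treeC.
have exC : exists a, u < C L a.+1.
  by exists (width L).-1; rewrite prednK ?width_gt0// C1.
have [a ua amin] := ex_minnP exC; exists a; last first.
  rewrite /cell/= ua andbT; case: a amin {ua} => [|a] amin; first by rewrite C0.
  by rewrite leNgt; apply/negP => /amin; rewrite ltnn.
rewrite -(prednK (width_gt0 L)) ltnS; apply: amin.
by rewrite prednK ?width_gt0// C1.
Qed.

Let cell_unique L u a b : cell L a u -> cell L b u -> a = b.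
Proof.
move=> /andP[a1 a2] /andP[b1 b2]; case: (ltngtP a b) => // ab.
  by have := lt_le_trans a2 (le_trans (C_mono L ab) b1); rewrite ltxx.
by have := lt_le_trans b2 (le_trans (C_mono L ab) a1); rewrite ltxx.
Qed.

Let cell_parent L a u : cell L.+1 a u -> cell L (a %/ radix L)%N u.
Proof.
have [_ _ _ CS] := treeC; move=> /andP[a1 a2]; apply/andP; split.
  by rewrite -CS (le_trans _ a1)// C_mono// leq_trunc_div.
by rewrite -CS (lt_le_trans a2)// C_mono// ltn_ceil// radix_gt0.
Qed.

(* Inverse transform sampling: [u] selects at each level the node whose interval of
   cumulative masses contains it, and these nodes converge. *)
Let skorokhod_ex (u : R) : exists z, X z /\ (0 <= u < 1 ->
  forall L a, cell L a u -> edist z (node L a) <= 4 * mesh L).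
Proof.
have [u01|nu] := boolP (0 <= u < 1); last by exists x0; split.
have /choice[j jP] : forall L, exists a, (a < width L)%N /\ cell L a u.
  by move=> L; have [a aL au] := cell_ex L u01; exists a.
have jS L : (j L.+1 %/ radix L)%N = j L.
  exact: cell_unique (cell_parent (jP L.+1).2) (jP L).2.
(* A step from level [N] costs [2 * mesh N = 4 * mesh N - 4 * mesh N.+1], which telescopes; this is
   the origin of the factor 4. *)
have jdist L k : edist (node (L + k)%N (j (L + k)%N)) (node L (j L)) <=
    4 * mesh L - 4 * mesh (L + k)%N.
  elim: k => [|k IH]; first by rewrite addn0 edistxx subrr.
  rewrite addnS (le_trans (edist_triangle (node (L + k)%N (j (L + k)%N)) _ _))//.
  have := node_step (L + k)%N (j (L + k).+1).
  by rewrite jS; have := meshS (L + k)%N; lra.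
have FX : ((fun k => node k (j k)) @ \oo) X by exists 0%N => // k _; exact: nodeX.
have [z [Xz clz]] := compactX
  (fmap_proper_filter (fun k => node k (j k)) eventually_filter) FX.
exists z; split => // _ L a aL; rewrite (cell_unique aL (jP L).2).
apply/ler_addgt0Pl => e e0.
have /clz : ((fun k => node k (j k)) @ \oo) [set y | edist y (node L (j L)) <= 4 * mesh L].
  exists L => // k /= Lk; rewrite -(subnKC Lk).
  by apply: le_trans (jdist L _) _; have := mesh_gt0 (L + (k - L))%N; lra.
move=> /(_ [set y | edist z y < e])[|y [/= yL zy]].
  by apply/near_edist; exists e.
by rewrite (le_trans (edist_triangle y _ _))// lerD// ltW.
Qed.

Let g u : T := projT1 (cid (skorokhod_ex u)).

Let gX u : X (g u). Proof. by rewrite /g; case: cid => z []. Qed.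

Let g_cell u L a : 0 <= u < 1 -> cell L a u -> edist (g u) (node L a) <= 4 * mesh L.
Proof. by rewrite /g; case: cid => z [_]/= + /[dup]u01 => /[apply]; exact. Qed.

Let cell01 L a u : (a < width L)%N -> cell L a u -> 0 <= u < 1.
Proof.
have [C0 C1 _ _] := treeC; move=> aL /andP[a1 a2]; apply/andP; split.
  by rewrite (le_trans _ a1)// -(C0 L) C_mono.
by rewrite (lt_le_trans a2)// -(C1 L _ (leqnn _)) C_mono.
Qed.

Let cellE L a : cell L a = `[C L a, C L a.+1[%classic.
Proof. by apply/seteqP; split=> u /=; rewrite in_itv. Qed.

Let D01 : set (measurableTypeR R) := `[0, 1[%classic.

(** [g] is chosen pointwise, but the tree controls it: the preimage of an open set is the countable
    union of the cells whose node has its ball of radius [4 * mesh L] inside the set. *)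
Let measurable_g : measurable_fun D01 (g : measurableTypeR R -> T).
Proof.
apply: (measurability (@open T)); first exact: euclidean_borelE.
move=> _ [B oB <-].
rewrite (_ : _ `&` _ = \bigcup_L \bigcup_(a in [set a | (a < width L)%N /\
    forall z, edist z (node L a) <= 4 * mesh L -> B z]) cell L a).
  apply: bigcup_measurable => L _; apply: bigcup_measurable => a _.
  by rewrite cellE; exact: measurable_itv.
apply/seteqP; split=> [u [/=]|u [L _ [a [aL aB] ua]]]; last first.
  have u01 := cell01 aL ua; split; first by rewrite /D01/= in_itv.
  exact/aB/g_cell.
rewrite /D01/= in_itv/= => u01 Ogu.
have := oB; rewrite openE => /(_ _ Ogu)/near_edist[e e0 eB].
(* Twice the factor 4: from [g u] to the node and from the node to [z]. *)
have [L Le] := mesh_small 8 e0.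
have [a aL ua] := cell_ex L u01.
exists L => //; exists a => //=; split => // z za; apply: eB.
apply: le_lt_trans (edist_triangle (node L a) _ _) _.
rewrite (edist_sym _ z) (le_lt_trans _ Le)// (le_trans (lerD (g_cell u01 ua) za))//.
by rewrite -mulrDl; apply: ler_wpM2r; [exact/ltW/mesh_gt0|rewrite -natrD].
Qed.

Let G (u : measurableTypeR R) : T := if 0 <= u < 1 then g u else x0.

Let D01E : D01 = [set u : measurableTypeR R | 0 <= u < 1].
Proof. by apply/seteqP; split=> u; rewrite /D01/= in_itv. Qed.

Let measurable_G : measurable_fun setT G.
Proof.
have mD : measurable D01 by exact: measurable_itv.
apply: measurable_fun_if => //.
- apply: (measurable_fun_bool true); rewrite setTI.
  by rewrite (_ : _ @^-1` _ = D01)// D01E; apply/seteqP; split=> u.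
- by rewrite setTI (_ : _ @^-1` _ = D01)// D01E; apply/seteqP; split=> u.
Qed.

Let Gm : {mfun measurableTypeR R >-> T} := HB.pack G (isMeasurableFun.Build _ _ _ _ G measurable_G).

Let P01 : probability (measurableTypeR R) R := uniform_prob (@ltr01 R).

Let P01_itv (a b : R) : 0 <= a -> a <= b -> b <= 1 -> P01 `[a, b[%classic = (b - a)%:E.
Proof.
move=> a0 ab b1; rewrite /P01 /= /uniform_prob.
rewrite (eq_integral (fun=> 1%:E)); last first.
  move=> x; rewrite inE/= in_itv/= /uniform_pdf => /andP[ax xb].
  by rewrite (le_trans a0 ax) (le_trans (ltW xb) b1) subr0 invr1.
rewrite integral_cst//= mul1e lebesgue_measure_itv/= lte_fin.
by move: ab; rewrite le_eqVlt => /orP[/eqP->|->//]; rewrite ltxx subrr.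
Qed.

Let C01 L a : (a <= width L)%N -> 0 <= C L a <= 1.
Proof.
have [C0 C1 _ _] := treeC; move=> aL; rewrite -[X in X <= _ <= _](C0 L).
by rewrite -[X in _ <= _ <= X](C1 L _ (leqnn _)) !C_mono.
Qed.

Let bmeas_G (f : T -> R) : bmeas f -> bmeas (fun u => f (G u)).
Proof.
move=> [mf [M fM]]; split; last by exists M => u.
exact: measurableT_comp mf measurable_G.
Qed.

(** The measure is the law of [G] under the uniform distribution. On a cell, [G] stays within
    [4 * mesh L] of the node, and the length of the cell is the mass of the node, so the sum is the
    integral of a step function close to [f]. *)
Lemma tree_law : exists mu : probability T R, mu X = 1%E /\
  forall f (c : R), bmeas f -> 0 <= c ->
    (forall x y, `|f x - f y| <= c * edist x y) -> forall L,
    `|\int[mu]_(x in X) f x -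
      \sum_(a < width L) (C L a.+1 - C L a) * f (node L a)| <= c * 4 * mesh L.
Proof.
exists (distribution P01 Gm).
have GX : G @^-1` X = setT.
  by apply/seteqP; split => // u _; rewrite /preimage /= /G; case: ifP => // _; exact: gX.
have PD : P01 D01 = 1%E by rewrite /D01 P01_itv ?subr0.
split; first by rewrite /distribution /pushforward /= GX probability_setT.
move=> f c bf c0 flip L.
have mD : measurable D01 by exact: measurable_itv.
have Doo : (P01 D01 < +oo)%E by rewrite PD ltry.
have mX := compact_measurable_euclidean compactX.
have bfG := bmeas_G bf.
have PC : P01 (~` D01) = 0%E by rewrite probability_setC// PD subee.
have -> : \int[distribution P01 Gm]_(x in X) f x = \int[P01]_(u in D01) f (G u).
  rewrite /Rintegral integral_pushforward//=.
  - rewrite GX (@negligible_integral _ _ _ _ _ (~` D01)) ?setTD ?setCK//.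
    + exact: measurableC.
    + exact: bmeas_integrable.
  - by apply/measurable_EFinP; exact: bf.1.
  - by rewrite GX; exact: bmeas_integrable.
have mcell a : measurable (cell L a : set (measurableTypeR R)).
  by rewrite cellE; exact: measurable_itv.
pose h (u : measurableTypeR R) := \sum_(a < width L) f (node L a) * \1_(cell L a) u.
have bh : bmeas h by apply: bmeas_sum => a; exact: bmeas_indic.
have sI := signed_restr1 mD Doo.
have Ih : \int[P01]_(u in D01) h u =
    \sum_(a < width L) (C L a.+1 - C L a) * f (node L a).
  rewrite (signed_lin_sum _ sI) => [|a]; last exact: bmeas_indic.
  apply: eq_bigr => a _; rewrite mulrC; congr (_ * _).
  have /andP[a0 a1] := C01 (ltnW (ltn_ord a)).
  have /andP[b0 b1] := C01 (ltn_ord a).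
  have -> : \int[P01]_(u in D01) \1_(cell L a) u = fine (P01 (D01 `&` cell L a)).
    rewrite -[RHS]mul1r -Rintegral_indic//.
    by apply: eq_Rintegral => u _; rewrite mul1r.
  have -> : D01 `&` cell L a = `[C L a, C L a.+1[%classic.
    by rewrite -cellE setIidr// D01E => u; exact: cell01 (ltn_ord a).
  by rewrite P01_itv//; have [_ _ + _] := treeC; exact.
have h_near u : D01 u -> `|f (G u) - h u| <= c * 4 * mesh L.
  rewrite D01E/= => u01; have [a aL ua] := cell_ex L u01.
  have -> : h u = f (node L a).
    rewrite /h (bigD1 (Ordinal aL))//= indicE mem_set// mulr1 big1 ?addr0// => b ba.
    rewrite indicE memNset ?mulr0// => /(cell_unique ua) ab.
    by move: ba; rewrite -val_eqE/= ab eqxx.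
  apply: le_trans (flip _ _) _; rewrite -mulrA ler_wpM2l//.
  by rewrite /G u01; exact: g_cell.
by rewrite -Ih; exact: Rintegral_near.
Qed.

End tree_measure.

(** * Minimising the energy over codes *)

Section minimiser.
Variable t : R.
Hypothesis t_gt0 : 0 < t.
Let k := @lapk R n t.
Let bk : bmeas k. Proof. exact/bmeas_lapk/ltW. Qed.
Let mX : measurable X. Proof. exact: compact_measurable_euclidean. Qed.

(** The conclusion of [tree_law] as a relation: from here on a measure is known through its code
    only up to these approximations. *)
Definition realises (C : nat -> nat -> R) (mu : probability T R) := mu X = 1%E /\
  forall f (c : R), bmeas f -> 0 <= c ->
    (forall x y, `|f x - f y| <= c * edist x y) -> forall L,
    `|\int[mu]_(x in X) f x -
      \sum_(a < width L) (C L a.+1 - C L a) * f (node L a)| <= c * 4 * mesh L.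

Let energy (mu : probability T R) := \int[mu]_(x in X) \int[mu]_(y in X) k (x, y).
Let potential (mu : probability T R) x := \int[mu]_(y in X) k (x, y).

Let weight (C : nat -> nat -> R) L a := C L a.+1 - C L a.
Let form (C C' : nat -> nat -> R) L := \sum_(a < width L) weight C L a *
  \sum_(b < width L) weight C' L b * k (node L a, node L b).

Let lapk_lip z x y : `|k (z, x) - k (z, y)| <= t * edist x y.
Proof.
wlog xy : x y / edist z x <= edist z y => [h|].
  have [/h//|/ltW/h] := leP (edist z x) (edist z y).
  by rewrite distrC edist_sym.
have zx := edist_triangle x z y.
have eD : expR (- (t * edist z y)) =
    expR (- (t * edist z x)) * expR (- (t * (edist z y - edist z x))).
  by rewrite -expRD mulrBr; congr expR; ring.
have d0 : 0 <= t * (edist z y - edist z x) by rewrite mulr_ge0 ?subr_ge0// ltW.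
have e1 := expR_ge1Dx (- (t * (edist z y - edist z x))).
have e2 : expR (- (t * (edist z y - edist z x))) <= 1 by rewrite -expR0 ler_expR oppr_le0.
have z1 : expR (- (t * edist z x)) <= 1.
  by rewrite -expR0 ler_expR oppr_le0 mulr_ge0 ?edist_ge0// ltW.
have z0 := expR_ge0 (- (t * edist z x)).
rewrite /k /lapk/= eD -[X in `|X - _|]mulr1 -mulrBr ger0_norm; last first.
  by rewrite mulr_ge0// subr_ge0.
apply: (@le_trans _ _ (1 * (t * (edist z y - edist z x)))).
  by apply: ler_pM; rewrite ?subr_ge0// lerBlDl -lerBlDr.
by rewrite mul1r ler_wpM2l ?(ltW t_gt0)// lerBlDl.
Qed.

Section realised.
Variables (C : nat -> nat -> R) (mu : probability T R).
Hypothesis muC : realises C mu.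

Let muX : mu X = 1%E. Proof. by case: muC. Qed.
Let muXoo : (mu X < +oo)%E. Proof. by rewrite muX ltry. Qed.

Let bpot : bmeas (potential mu).
Proof. exact: (bmeas_potential (signed_restr1 mX muXoo) bk). Qed.

Lemma potential_lip x y : `|potential mu x - potential mu y| <= t * edist x y.
Proof.
apply: (Rintegral_near mX muX) => [||z _]; [exact: bmeas_section1..|].
rewrite /k (lapk_sym _ x) (lapk_sym _ y); exact: lapk_lip.
Qed.

Let pot_le1 x : potential mu x <= 1. Proof. exact: (Kmu_le1 compactX t_gt0 muX). Qed.

Lemma potential_approx z L :
  `|potential mu z - \sum_(a < width L) weight C L a * k (z, node L a)| <= t * 4 * mesh L.
Proof.
have [_ h] := muC; apply: h; [exact: bmeas_section1|exact: ltW|].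
by move=> x y; exact: lapk_lip.
Qed.

Lemma energy_approx_potential L :
  `|energy mu - \sum_(a < width L) weight C L a * potential mu (node L a)| <= t * 4 * mesh L.
Proof. by have [_ h] := muC; exact: (h _ _ bpot (ltW t_gt0) potential_lip L). Qed.

Lemma energy_le1 : energy mu <= 1.
Proof.
apply: (@le_trans _ _ (\int[mu]_(x in X) 1)); last first.
  by rewrite (Rintegral_cst_prob 1 mX muX).
exact: (le_Rintegral_bmeas mX muXoo bpot (bmeas_cst T 1) (fun x _ => pot_le1 x)).
Qed.

Hypothesis treeC : tree_cdf C.

Lemma weight_ge0 L a : 0 <= weight C L a.
Proof. by rewrite subr_ge0; have [_ _ + _] := treeC; exact. Qed.

Lemma sum_weight L : \sum_(a < width L) weight C L a = 1.
Proof.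
have [C0 C1 _ _] := treeC.
rewrite -(big_mkord xpredT (weight C L)) telescope_sumr ?width_gt0//.
by rewrite C1// C0 subr0.
Qed.

Lemma weight_avg (f g : nat -> R) (b : R) L : (forall a, `|f a - g a| <= b) ->
  `|\sum_(a < width L) weight C L a * f a - \sum_(a < width L) weight C L a * g a| <= b.
Proof.
move=> fg; rewrite -sumrB; apply: le_trans (ler_norm_sum _ _ _) _.
rewrite -[leRHS]mul1r -(sum_weight L) mulr_suml; apply: ler_sum => a _.
by rewrite -mulrBr normrM ger0_norm ?weight_ge0// ler_wpM2l// weight_ge0.
Qed.

(** Discretising the outer integral and then each potential costs 4 units apiece. *)
Lemma energy_approx L : `|energy mu - form C C L| <= t * 8 * mesh L.
Proof.
have -> : t * 8 * mesh L = t * 4 * mesh L + t * 4 * mesh L by ring.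
apply: le_trans (ler_distD (\sum_(a < width L) weight C L a * potential mu (node L a)) _ _) _.
apply: lerD; first exact: energy_approx_potential.
apply: (weight_avg (f := fun a => potential mu (node L a))
  (g := fun a => \sum_(b < width L) weight C L b * k (node L a, node L b))) => a.
exact: potential_approx.
Qed.

End realised.

(** The form at level [L] involves finitely many entries of a code, so it passes to the ultrafilter
    limit; its distance to the energy is uniform in the code. Comparison is with realised codes
    only, which include those needed for the first-order conditions. *)
Lemma energy_minimiser : exists C mu, [/\ tree_cdf C, realises C mu &
  forall C' mu', tree_cdf C' -> realises C' mu' -> energy mu <= energy mu'].
Proof.
pose E : set R := [set r | exists C mu, [/\ tree_cdf C, realises C mu & r = energy mu]].
have E_ge0 : lbound E 0.
  move=> _ [C [mu [_ _ ->]]]; apply: Rintegral_ge0 => x _.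
  by apply: Rintegral_ge0 => y _; exact: expR_ge0.
have Einf : has_inf E.
  split; last by exists 0.
  (* All mass at node 0 of every level, to see that [E] is not empty. *)
  pose C0 (L a : nat) : R := (0 < a)%N%:R.
  have tC0 : tree_cdf C0.
    split=> [//|L a wa|L a|L a]; rewrite /C0.
    - by rewrite (leq_trans (width_gt0 L)).
    - by rewrite ler_nat; case: a.
    - by rewrite muln_gt0 radix_gt0 andbT.
  by have [mu muC] := tree_law tC0; exists (energy mu), C0, mu.
have /choice[Cmu CmuP] : forall m : nat, exists Cmu : (nat -> nat -> R) * probability T R,
    [/\ tree_cdf Cmu.1, realises Cmu.1 Cmu.2 & energy Cmu.2 <= inf E + m.+1%:R^-1].
  move=> m; have [|_ [C [mu [tC muC ->]]] em] := @inf_adherent R E m.+1%:R^-1 _ Einf.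
    by rewrite invr_gt0.
  by exists (C, mu); split => //; exact: ltW.
have [U [UU Uoo]] := ultraFilterLemma eventually_filter.
have bd C L a : tree_cdf C -> 0 <= C L a <= 1.
  move=> [C0 C1 Cm _].
  have mono b c : (b <= c)%N -> C L b <= C L c.
    move=> /subnK <-; elim: (c - b)%N => [|i IH]; first by rewrite add0n.
    by rewrite addSn (le_trans IH).
  rewrite -{1}(C0 L) mono//= -(C1 L (a + width L)%N) ?leq_addl// mono//.
  exact: leq_addr.
have /choice[c' c'P] : forall La : nat * nat, exists l : R,
    (fun m => (Cmu m).1 La.1 La.2) @ U --> l.
  by move=> [L a]; apply: ultra_cvg => m; apply: bd; have [] := CmuP m.
pose c L a := c' (L, a).
have cP L a : (fun m => (Cmu m).1 L a) @ U --> c L a := c'P (L, a).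
have cE L a b : (forall m, (Cmu m).1 L a = b) -> c L a = b.
  move=> h; have := cP L a; rewrite (_ : (fun m => _) = fun=> b); last exact/funext.
  by move=> /cvg_unique; apply => //; exact: cvg_cst.
have tc : tree_cdf c.
  split=> [L|L a wa|L a|L a].
  - by apply: cE => m; have [[]] := CmuP m.
  - by apply: cE => m; have [[_ + _ _] _ _] := CmuP m; exact.
  - apply: (ler_cvg_to (cP L a) (cP L a.+1)); apply: nearW => m.
    by have [[_ _ + _] _ _] := CmuP m; exact.
  - have := cP L.+1 (a * radix L)%N.
    rewrite (_ : (fun m => _) = fun m => (Cmu m).1 L a).
      by move=> /cvg_unique; apply => //; exact: cP.
    by apply/funext => m; have [[_ _ _ +] _ _] := CmuP m; exact.
have [mu muc] := tree_law tc.
exists c, mu; split => // C1 mu1 tC1 muC1.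
apply: (@le_trans _ _ (inf E)); last by apply: (ge_inf Einf.2); exists C1, mu1.
(* 8 units for the limit measure and 8 for those of the minimising sequence. *)
apply: (@le_mesh (t * 16)) => L.
have form_cvg : (fun m => form (Cmu m).1 (Cmu m).1 L) @ U --> form c c L.
  apply: cvg_big => [|a _]; first exact: add_continuous.
  apply: cvgM; first by apply: cvgB; exact: cP.
  apply: cvg_big => [|b _]; first exact: add_continuous.
  apply: cvgM; last exact: cvg_cst.
  by apply: cvgB; exact: cP.
have formE : form c c L <= inf E + t * 8 * mesh L.
  apply/ler_addgt0Pr => e e0; apply: (cvgr_to_le form_cvg).
  have [N Ne] : exists N, N.+1%:R^-1 < e.
    exists (Num.truncn e^-1); rewrite invf_plt ?posrE//; exact: truncnS_gt.
  apply: Uoo; exists N => // m /= Nm.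
  have [tm mm em] := CmuP m.
  have := energy_approx mm tm L; rewrite ler_norml => /andP[+ _].
  rewrite lerNl opprB lerBlDr => /le_trans; apply.
  rewrite addrC addrAC lerD2r (le_trans em)// lerD2l (le_trans _ (ltW Ne))//.
  by rewrite lef_pV2 ?posrE// ler_nat.
have := energy_approx muc tc L; rewrite ler_norml => /andP[_].
rewrite lerBlDr => /le_trans; apply.
have -> : t * 16 * mesh L = t * 8 * mesh L + t * 8 * mesh L by ring.
by rewrite addrA [leRHS]addrC lerD2l.
Qed.

(* The variation of the energy towards the point mass at [z], coded by the
   nodes of a path converging to [z]. *)
Lemma minimiser_potential C mu z : tree_cdf C -> realises C mu ->
  (forall C' mu', tree_cdf C' -> realises C' mu' -> energy mu <= energy mu') ->
  X z -> energy mu <= potential mu z.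
Proof.
move=> tC muC minE Xz.
have [i iP] := node_path Xz.
pose Cz (L a : nat) : R := (i L < a)%N%:R.
have tCz : tree_cdf Cz.
  split=> [L|L a wa|L a|L a]; rewrite /Cz //.
  - by have [iL _ _] := iP L; rewrite (leq_trans iL).
  - by rewrite ler_nat ltnS; case: (ltngtP (i L) a).
  - by have [_ <- _] := iP L; rewrite ltn_divLR ?radix_gt0.
have Cz_sum (f : nat -> R) L : \sum_(a < width L) weight Cz L a * f a = f (i L).
  have [iL _ _] := iP L.
  rewrite (bigD1 (Ordinal iL))//= /weight /Cz ltnS leqnn ltnn subr0 mul1r.
  rewrite big1 ?addr0// => a; rewrite -val_eqE/= ltnS => ai.
  by case: (ltngtP (i L) a) ai; rewrite ?subrr ?mul0r.
have step (s : R) : 0 <= s <= 1 ->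
    energy mu <= (1 - s) ^+ 2 * energy mu + 2 * s * (1 - s) * potential mu z + s ^+ 2.
  move=> /andP[s0 s1].
  (* Codes are mixed rather than measures: [tree_law] provides some measure for the mixed code, and
     its energy is known up to the mesh. *)
  pose Cs L a := (1 - s) * C L a + s * Cz L a.
  have tCs : tree_cdf Cs.
    case: tC tCz => [a1 a2 a3 a4] [b1 b2 b3 b4]; split=> [L|L a wa|L a|L a]; rewrite /Cs.
    - by rewrite a1 b1 !mulr0 addr0.
    - by rewrite a2// b2// !mulr1 subrK.
    - by apply: lerD; apply: ler_wpM2l => //; rewrite subr_ge0.
    - by rewrite a4 b4.
  have [mus musC] := tree_law tCs.
  have wE L a : weight Cs L a = (1 - s) * weight C L a + s * weight Cz L a.
    by rewrite /weight /Cs; ring.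
  apply: (@le_mesh (t * 26)) => L.
  pose p := node L (i L).
  pose B := \sum_(a < width L) weight C L a * k (p, node L a).
  have formE : form Cs Cs L = (1 - s) ^+ 2 * form C C L + 2 * s * (1 - s) * B + s ^+ 2.
    pose F C' a := \sum_(b < width L) weight C' L b * k (node L a, node L b).
    have FE a : F Cs a = (1 - s) * F C a + s * k (node L a, p).
      rewrite /F -(Cz_sum (fun b => k (node L a, node L b))) !mulr_sumr -big_split/=.
      by apply: eq_bigr => b _; rewrite wE; ring.
    have -> : form Cs Cs L = (1 - s) * (\sum_(a < width L) weight C L a * F Cs a) + s * F Cs (i L).
      rewrite -(Cz_sum (F Cs)) !mulr_sumr -big_split/=.
      by apply: eq_bigr => a _; rewrite wE /F; ring.
    have -> : \sum_(a < width L) weight C L a * F Cs a = (1 - s) * form C C L + s * B.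
      rewrite /form /B !mulr_sumr -big_split/=.
      by apply: eq_bigr => a _; rewrite FE /k (lapk_sym t p) /F; ring.
    have kp : k (p, p) = 1 by rewrite /k /lapk/= edistxx mulr0 oppr0 expR0.
    by rewrite FE -/p kp -/(F C (i L)) (_ : F C (i L) = B)//; ring.
  (* One unit to move from [z] to the node [p], four to discretise the potential at [p]. *)
  have Bz : `|potential mu z - B| <= t * 5 * mesh L.
    have [_ _ zp] := iP L.
    apply: le_trans (ler_distD (potential mu p) _ _) _.
    have -> : t * 5 * mesh L = t * mesh L + t * 4 * mesh L by ring.
    apply: lerD; last exact: potential_approx.
    by apply: le_trans (potential_lip muC z p) _; rewrite ler_wpM2l// ltW.
  have e1 := energy_approx muC tC L.
  have e2 := energy_approx musC tCs L.
  have e3 := minE _ _ tCs musC.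
  have m0 : 0 <= t * mesh L by rewrite mulr_ge0// ltW// mesh_gt0.
  apply: (mixture_form_arith _ m0 e1 e2 Bz e3 formE); exact/andP.
apply: first_order_arith step; first exact: energy_le1 muC.
by apply: Rintegral_ge0 => y _; exact: expR_ge0.
Qed.

Lemma compact_equilibrium : exists mu e, equilibrium X t mu e.
Proof.
have [C [mu [tC muC minE]]] := energy_minimiser.
have [muX _] := muC.
have [k0 k00 Kk0] := Kmu_lbound compactX t_gt0 muX.
have bK := bmeas_Kmu compactX t_gt0 muX.
exists mu, (energy mu); split => // [|z Xz]; last exact: minimiser_potential tC muC minE Xz.
apply: (lt_le_trans k00); rewrite -[leLHS](Rintegral_cst_prob _ mX muX).
have muXoo : (mu X < +oo)%E by rewrite muX ltry.
exact: (le_Rintegral_bmeas mX muXoo (bmeas_cst _ _) bK Kk0).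
Qed.

End minimiser.

End compact_tree.

Lemma exists_equilibrium (R : realType) (n : nat) (X : set (euclidean R n)) (t : R) :
  compact X -> X !=set0 -> 0 < t -> exists mu e, equilibrium X t mu e.
Proof.
move=> cX [x0 Xx0] t0; have [D D0 XD] := compact_edist_bounded x0 cX.
exact: (compact_equilibrium cX Xx0 D0 XD t0).
Qed.

(** * Large scale limit *)

Section potential_mass.
Variables (R : realType) (n : nat).
Notation T := (euclidean R n).
Notation Lm := (lebesgue_euclidean R n).
Variables (k : T * T -> R) (c : R).
Hypotheses (bk : bmeas k) (k_ge0 : forall xy, 0 <= k xy).
Hypothesis integral_k : forall x, (\int[Lm]_z (k (x, z))%:E = c%:E)%E.

Lemma ip_le_mass (m : {measure set T -> \bar R}) (A B : set T) :
  measurable A -> (m A < +oo)%E -> measurable B -> (Lm B < +oo)%E ->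
  ip k (fun f => \int[m]_(x in A) f x) (fun f => \int[Lm]_(x in B) f x) <=
  c * fine (m A).
Proof.
move=> mA mAoo mB mBoo; rewrite -Rintegral_cst//.
apply: le_Rintegral_bmeas => //; last 2 first.
- exact: bmeas_cst.
- move=> x _; rewrite -lee_fin fineK; last first.
    apply: integrable_fin_num => //.
    by apply: bmeas_integrable_restr => //; exact: bmeas_section1.
  rewrite -(integral_k x); apply: ge0_subset_integral => //.
    by apply/measurable_EFinP; exact: (bmeas_section1 x bk).1.
  by move=> z _; rewrite lee_fin.
exact: (bmeas_potential (signed_restr1 mB mBoo) bk).
Qed.

End potential_mass.

(** The nonnegative quadratics are the self-energies of [mu - GX / Vr], of [mu - L / V], and of
    [mu - L / V - s * GF]. The first gives [e >= c * (1 - 2 * d) / Vr]; the second gives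
    [e <= c / V] and hence [0 < c]; inserting these in the third bounds the pairing of [mu - L / V]
    with [GF]. *)
Lemma concentration_arith (R : realType) (a b c d e V Vr s W x1 x2 x3 q P : R) :
  0 < V -> 0 < Vr -> 0 < s -> 0 < e ->
  x1 <= c * Vr -> x2 <= c * V -> x3 <= c * W ->
  0 <= e - 2 * Vr^-1 * a + Vr^-1 ^+ 2 * x1 -> c * (1 - d) <= a ->
  0 <= e - 2 * V^-1 * b + V^-1 ^+ 2 * x2 -> e * V <= b ->
  0 <= e - 2 * V^-1 * b + V^-1 ^+ 2 * x2 - 2 * s * (q - V^-1 * P) + s ^+ 2 * x3 ->
  0 < c /\ (q - V^-1 * P) / c <= (V^-1 - (1 - 2 * d) / Vr) / (2 * s) + s * W / 2.
Proof.
move=> V0 Vr0 s0 e0 x1c x2c x3c.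
have hV y v : 0 < v -> y <= c * v -> v^-1 ^+ 2 * y <= c / v.
  move=> v0 yc; apply: (@le_trans _ _ (v^-1 ^+ 2 * (c * v))).
    by rewrite ler_wpM2l ?sqr_ge0.
  by rewrite le_eqVlt; apply/orP; left; apply/eqP; field; rewrite gt_eqF.
have {x1c} := hV _ _ Vr0 x1c; have {x2c} := hV _ _ V0 x2c.
have : s ^+ 2 * x3 <= s ^+ 2 * (c * W) by rewrite ler_wpM2l ?sqr_ge0.
move: (s ^+ 2 * x3) (V^-1 ^+ 2 * x2) (Vr^-1 ^+ 2 * x1) => y3 y2 y1 y3c y2c y1c.
move=> h1 ha h2 hb h3.
have eb : e <= V^-1 * b by rewrite mulrC ler_pdivlMr.
have ecV : e <= c / V by move: h2 eb; rewrite -!mulrA; lra.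
have c0 : 0 < c.
  by move: (lt_le_trans e0 ecV); rewrite pmulr_lgt0// invr_gt0.
split => //.
have ecr : c * ((1 - 2 * d) / Vr) <= e.
  have : Vr^-1 * (c * (1 - d)) <= Vr^-1 * a by rewrite ler_wpM2l// invr_ge0 ltW.
  have -> : c * ((1 - 2 * d) / Vr) = 2 * (Vr^-1 * (c * (1 - d))) - c / Vr.
    by field; rewrite gt_eqF.
  by move: h1; rewrite -!mulrA; lra.
have key : 2 * s * (q - V^-1 * P) <= c * (V^-1 - (1 - 2 * d) / Vr) + s ^+ 2 * (c * W).
  by move: h3 eb ecr; rewrite -!(mulrA 2) (mulrBr c); lra.
rewrite ler_pdivrMr// -(ler_pM2l (mulr_gt0 (ltr0n R 2) s0)) (le_trans key)//.
rewrite le_eqVlt; apply/orP; left; apply/eqP; field.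
by rewrite !gt_eqF.
Qed.

Lemma concentration_arith2 (R : realType) (m A c d V q P x y : R) :
  0 < V -> c * (1 - d) * m <= q -> P <= c * (A + d * V) ->
  0 < c -> (q - V^-1 * P) / c <= x + y ->
  (1 - d) * m <= A / V + d + x + y.
Proof.
move=> V0 hq hP c0; rewrite ler_pdivrMr// => h.
have hP' : V^-1 * P <= c * (A / V + d).
  have -> : c * (A / V + d) = V^-1 * (c * (A + d * V)) by field; rewrite gt_eqF.
  by rewrite ler_wpM2l// invr_ge0 ltW.
by rewrite -(ler_pM2l c0); move: h hq hP'; rewrite -!(mulrA c); lra.
Qed.

Section concentration.
Variables (R : realType) (n : nat) (X : set (euclidean R n)) (t c : R).
Notation T := (euclidean R n).
Notation Lm := (lebesgue_euclidean R n).
Hypotheses (compactX : compact X) (X_gt0 : (0 < Lm X)%E) (t_gt0 : 0 < t).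
Hypothesis integral_k : forall x : T, (\int[Lm]_z (lapk t (x, z))%:E = c%:E)%E.
Variables (mu : probability T R) (e : R).
Hypothesis eqmu : equilibrium X t mu e.
Variables (rho delta : R).
Hypotheses (rho_gt0 : 0 < rho) (delta_ge0 : 0 <= delta).
Hypothesis tail_k : forall x : T,
  (\int[Lm]_(z in [set z | (rho <= edist x z)%R]) (lapk t (x, z))%:E <= (delta * c)%:E)%E.

Let mX : measurable X. Proof. exact: compact_measurable_euclidean. Qed.
Let bk : bmeas (@lapk R n t). Proof. exact/bmeas_lapk/ltW. Qed.
Let k0 (xy : T * T) : 0 <= lapk t xy. Proof. exact: expR_ge0. Qed.

Lemma compact_thicken_fin F r : F `<=` X -> (Lm (thicken F r) < +oo)%E.
Proof.
move=> FX; have [F0|/set0P[x0 Fx0]] := eqVneq F set0.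
  rewrite (_ : thicken F r = set0) ?measure0//.
  by rewrite F0; apply/seteqP; split => // x [y].
have [D D0 XD] := compact_edist_bounded x0 compactX.
by apply: (@thicken_lebesgue_lt_pinfty _ _ _ x0 D) => y /FX; exact: XD.
Qed.

Lemma lebesgue_compact_fin : (Lm X < +oo)%E.
Proof.
apply: le_lt_trans (compact_thicken_fin 1 (@subset_refl _ X)).
rewrite le_measure ?inE//; first exact: measurable_thicken.
exact: subset_thicken.
Qed.

(** [s] stays free: it divides the energy gap and multiplies the self-energy of the test measure, so
    a small [s] can be fixed first and the gap made small relative to it. *)
Lemma concentration (F : set T) (s : R) : closed F -> F `<=` X -> 0 < s ->
  (1 - delta) * fine (mu F) <=
    fine (Lm (X `&` thicken F (2 * rho))) / fine (Lm X) + delta +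
    ((fine (Lm X))^-1 - (1 - 2 * delta) / fine (Lm (thicken X rho))) / (2 * s) +
    s * fine (Lm (thicken F rho)) / 2.
Proof.
move=> cF FX s0.
have mF := closed_measurable_euclidean cF.
have [muX e0 eK Ee] := eqmu.
have muXoo : (mu X < +oo)%E by rewrite muX ltry.
have Xoo := lebesgue_compact_fin.
have XXoo := compact_thicken_fin rho (@subset_refl _ X).
have FXoo := compact_thicken_fin rho FX.
have V0 : 0 < fine (Lm X) by rewrite fine_gt0// X_gt0.
have Vr0 : 0 < fine (Lm (thicken X rho)).
  rewrite fine_gt0// XXoo andbT (lt_le_trans X_gt0)// le_measure ?inE//.
    exact: measurable_thicken.
  exact: subset_thicken.
pose M (f : T -> R) := \int[mu]_(x in X) f x.
pose L (f : T -> R) := \int[Lm]_(x in X) f x.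
pose GX (f : T -> R) := \int[Lm]_(x in thicken X rho) f x.
pose GF (f : T -> R) := \int[Lm]_(x in thicken F rho) f x.
have sM : signed M by exact: signed_restr1.
have sL : signed L by exact: signed_restr1.
have sGX : signed GX by apply: signed_restr1 => //; exact: measurable_thicken.
have sGF : signed GF by apply: signed_restr1 => //; exact: measurable_thicken.
have sk : forall x y : T, lapk t (x, y) = lapk t (y, x) by move=> x y; exact: lapk_sym.
have pk := @psd_lapk R n t t_gt0.
have c0 : 0 <= c.
  by rewrite -lee_fin -(integral_k point); apply: integral_ge0 => z _; rewrite lee_fin.
have ipMM : ip (lapk t) M M = e by exact: Ee.
have ipLL : ip (lapk t) L L <= c * fine (Lm X) by exact: ip_le_mass.
have ipGX : ip (lapk t) GX GX <= c * fine (Lm (thicken X rho)).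
  by apply: ip_le_mass => //; exact: measurable_thicken.
have ipGF : ip (lapk t) GF GF <= c * fine (Lm (thicken F rho)).
  by apply: ip_le_mass => //; exact: measurable_thicken.
have ipMG : c * (1 - delta) <= ip (lapk t) M GX.
  have := mollify_ge bk k0 integral_k tail_k mX muXoo mX (@subset_refl _ X) XXoo.
  by rewrite (_ : fine (mu X) = 1) ?mulr1//; exact: (congr1 fine muX).
have q_ge : c * (1 - delta) * fine (mu F) <= ip (lapk t) M GF.
  exact: (mollify_ge bk k0 integral_k tail_k mX muXoo mF FX FXoo).
have P_le : ip (lapk t) L GF <=
    c * (fine (Lm (X `&` thicken F (2 * rho))) + delta * fine (Lm X)).
  exact: (mollify_le bk k0 c0 delta_ge0 integral_k tail_k mX Xoo FXoo).
have ipML : e * fine (Lm X) <= ip (lapk t) M L.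
  rewrite ip_sym// -(Rintegral_cst _ mX).
  apply: (le_Rintegral_bmeas mX Xoo (bmeas_cst _ _) _ eK).
  exact: (bmeas_Kmu compactX t_gt0 muX).
have sD : signed (fun f => M f + - (fine (Lm X))^-1 * L f).
  by apply: signedD => //; exact: signedZ.
have ipD_GF : ip (lapk t) (fun f => M f + - (fine (Lm X))^-1 * L f) GF =
    ip (lapk t) M GF - (fine (Lm X))^-1 * ip (lapk t) L GF.
  by rewrite ip_sym// ipD ?ipZ//; [rewrite mulNr !(ip_sym _ sGF)|exact: signedZ].
have h1 := psd_sub (fine (Lm (thicken X rho)))^-1 sM sGX bk sk pk.
have h2 := psd_sub (fine (Lm X))^-1 sM sL bk sk pk.
have h3 := psd_sub s sD sGF bk sk pk.
rewrite ipD_GF (ip_sub_sq _ sM sL bk sk) ipMM in h3.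
rewrite ipMM in h1 h2.
have [c_gt0] := concentration_arith V0 Vr0 s0 e0 ipGX ipLL ipGF h1 ipMG h2 ipML h3.
exact: concentration_arith2.
Qed.

End concentration.

(** A quarter of [e] each pays for the thickening of [F], for the term in [s * W] and for the terms
    in [d]; an eighth pays for the excess volume of the thickening of [X]. *)
Lemma limit_arith (R : realType) (m a A d V Vr s W e : R) :
  0 < V -> V <= Vr -> 0 < s -> 0 < e -> Vr <= V + V ^+ 2 * (s * e / 4) ->
  s * W / 2 <= e / 4 -> A <= a + e / 4 * V -> 0 <= d ->
  d * (2 + (s * V)^-1) <= e / 4 -> m <= 1 ->
  (1 - d) * m <= A / V + d + (V^-1 - (1 - 2 * d) / Vr) / (2 * s) + s * W / 2 ->
  m <= a / V + e.
Proof.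
move=> V0 VVr s0 e0 Vre sW Aa d0 de m1 h.
have Vr0 : 0 < Vr by exact: lt_le_trans VVr.
have AV : A / V <= a / V + e / 4 by rewrite ler_pdivrMr// mulrDl divfK// gt_eqF.
have dm : d * m <= d by rewrite ler_piMr.
have split_eq : (V^-1 - (1 - 2 * d) / Vr) / (2 * s) =
    (Vr - V) / (V * Vr * (2 * s)) + d / (s * Vr).
  by field; rewrite !gt_eqF.
have h1 : (Vr - V) / (V * Vr * (2 * s)) <= e / 8.
  rewrite ler_pdivrMr ?mulr_gt0//; apply: (@le_trans _ _ (V ^+ 2 * (s * e / 4))); first lra.
  have -> : e / 8 * (V * Vr * (2 * s)) = (V * Vr) * (s * e / 4) by field.
  have se0 : 0 <= s * e / 4 by rewrite ltW// !mulr_gt0.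
  by rewrite ler_wpM2r// expr2 ler_wpM2l// ltW.
have h2 : d / (s * Vr) <= d * (s * V)^-1.
  by rewrite ler_wpM2l// lef_pV2 ?posrE ?mulr_gt0// ler_wpM2l// ltW.
move: h; rewrite split_eq => h.
by move: de h AV dm h1 h2 sW; rewrite mulrDr mulrBl mul1r; lra.
Qed.

Section equilibrium_limit.
Variables (R : realType) (n : nat) (X : set (euclidean R n)).
Notation T := (euclidean R n).
Notation Lm := (lebesgue_euclidean R n).
Hypotheses (compactX : compact X) (X_gt0 : (0 < Lm X)%E).
Variable mu_ : R -> probability T R.
Hypothesis equ : forall t, 0 < t -> exists e, equilibrium X t (mu_ t) e.

Let mX : measurable X. Proof. exact: compact_measurable_euclidean. Qed.

Lemma equilibrium_closed_limsup (F : set T) (eps : R) : closed F -> F `<=` X -> 0 < eps ->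
  \forall t \near +oo, fine (mu_ t F) <= fine (Lm F) / fine (Lm X) + eps.
Proof.
move=> cF FX eps0.
have mF := closed_measurable_euclidean cF.
have Xoo := lebesgue_compact_fin compactX.
have V0 : 0 < fine (Lm X) by rewrite fine_gt0// X_gt0.
have thicken_fin (G : set T) r : G `<=` X -> (Lm (thicken G r) < +oo)%E.
  exact: compact_thicken_fin.
have thickenS (G H : set T) r r' : G `<=` H -> r <= r' -> thicken G r `<=` thicken H r'.
  by move=> GH rr' x [y Gy yx]; exists y; [exact: GH|exact: lt_le_trans rr'].
have le_fine (G H : set T) : measurable G -> measurable H -> G `<=` H ->
    (Lm H < +oo)%E -> fine (Lm G) <= fine (Lm H).
  move=> mG mH GH Hoo.
  have GleH : (Lm G <= Lm H)%E by rewrite le_measure ?inE.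
  by rewrite fine_le// ge0_fin_numE// (le_lt_trans GleH).
set V := fine (Lm X) in V0 *.
pose W1 := fine (Lm (thicken X 1)).
have W10 : 0 <= W1 by exact: fine_ge0.
(* [s] has to be chosen before the radius, hence against [W1], which bounds the volume of the
   thickenings of [F] of radius at most 1. The [+ 1] keeps the denominator positive. *)
pose s := eps / (2 * (W1 + 1)).
have s0 : 0 < s by rewrite divr_gt0// mulr_gt0// ltr_wpDl.
have sW1 : s * W1 / 2 <= eps / 4.
  have -> : s * W1 / 2 = eps / 4 * (W1 / (W1 + 1)).
    by rewrite /s; field; rewrite gt_eqF// ltr_wpDl.
  rewrite -[leRHS]mulr1 ler_wpM2l ?divr_ge0 ?(ltW eps0)//.
  by rewrite ler_pdivrMr ?mul1r ?lerDl// ltr_wpDl.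
have XF1oo : (Lm (X `&` thicken F 1) < +oo)%E.
  apply: le_lt_trans Xoo; rewrite le_measure ?inE//.
  by apply: measurableI => //; exact: measurable_thicken.
have [r1 /andP[r10 r11] hr1] := thicken_cvg cF mX XF1oo (mulr_gt0 (divr_gt0 eps0 (ltr0n R 4)) V0).
have XTX1oo : (Lm (setT `&` thicken X 1) < +oo)%E by rewrite setTI; exact: thicken_fin.
have e2 : 0 < V ^+ 2 * (s * eps / 4) by rewrite mulr_gt0 ?exprn_gt0// divr_gt0// mulr_gt0.
have [r2 /andP[r20 r21] hr2] :=
  thicken_cvg (compact_closed_euclidean compactX) (@measurableT _ T) XTX1oo e2.
(* [r1] is halved because the bound around [F] involves the radius [2 * rho]; [r2] controls the
   volume around [X]. *)
pose rho := Num.min (r1 / 2) r2.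
have rho0 : 0 < rho by rewrite lt_min divr_gt0.
have rho1 : rho <= 1 by rewrite ge_min r21 orbT.
have VVr : V <= fine (Lm (thicken X rho)).
  apply: le_fine => //; [exact: measurable_thicken|exact: subset_thicken|exact: thicken_fin].
have Vr_le : fine (Lm (thicken X rho)) <= V + V ^+ 2 * (s * eps / 4).
  apply: (@le_trans _ _ (fine (Lm (thicken X r2)))).
    apply: le_fine; try exact: measurable_thicken; last exact: thicken_fin.
    by apply: thickenS => //; rewrite ge_min lexx orbT.
  move: hr2; rewrite !setTI -lee_fin EFinD !fineK ?ge0_fin_numE//.
  exact: thicken_fin.
have W_le : s * fine (Lm (thicken F rho)) / 2 <= eps / 4.
  apply: le_trans sW1; rewrite ler_wpM2r// ler_wpM2l ?(ltW s0)//.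
  apply: le_fine; try exact: measurable_thicken; last exact: thicken_fin.
  exact: thickenS.
have A_le : fine (Lm (X `&` thicken F (2 * rho))) <= fine (Lm F) + eps / 4 * V.
  have mI r : measurable (X `&` thicken F r).
    by apply: measurableI => //; exact: measurable_thicken.
  have Ioo r : (Lm (X `&` thicken F r) < +oo)%E by apply: le_lt_trans Xoo; rewrite le_measure ?inE.
  apply: (@le_trans _ _ (fine (Lm (X `&` thicken F r1)))).
    apply: le_fine => //; apply: setIS; apply: thickenS => //.
    have : rho <= r1 / 2 by rewrite ge_min lexx.
    by rewrite ler_pdivlMr// mulrC.
  have Foo : (Lm F < +oo)%E by apply: le_lt_trans Xoo; rewrite le_measure ?inE.
  by move: hr1; rewrite [X `&` F]setIidr// -lee_fin EFinD !fineK ?ge0_fin_numE.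
have [C C0 hC] := @integral_lapk R n.
have kap0 : 0 < 2 + (s * V)^-1 by rewrite addr_gt0// invr_gt0 mulr_gt0.
have dd0 : 0 < eps / 4 / (2 + (s * V)^-1) by rewrite !divr_gt0.
have rho20 : 0 < rho / 2 by rewrite divr_gt0.
have [A hA] := expR_decay (2 ^+ n) rho20 dd0.
near=> t.
have t0 : 0 < t by near: t; apply: nbhs_pinfty_gt; exact: num_real.
have At : A <= t by near: t; apply: nbhs_pinfty_ge; exact: num_real.
have [e eqe] := equ t0.
have [muX _ _ _] := eqe.
have d0 : 0 <= expR (- (t * (rho / 2))) * 2 ^+ n by rewrite mulr_ge0 ?expR_ge0.
have intk (x : T) := hC t x t0.
have tailk (x : T) := lapk_tail rho x t0 hC.
have conc := concentration compactX X_gt0 t0 intk eqe rho0 d0 tailk cF FX s0.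
have mu1 : fine (mu_ t F) <= 1.
  by rewrite -lee_fin fineK ?probability_le1// fin_num_measure.
apply: limit_arith V0 VVr s0 eps0 Vr_le W_le A_le d0 _ mu1 conc.
by rewrite -ler_pdivlMr// hA.
Unshelve. all: by end_near. Qed.

End equilibrium_limit.

(** The sum counts the integers from 1 to [K] that are at most [y], so it is the integer part of
    [y]. *)
Lemma layer_count (R : realType) (K : nat) (y : R) : 0 <= y -> y <= K%:R ->
  \sum_(i < K) ((i.+1%:R <= y)%R)%:R <= y /\ y <= 1 + \sum_(i < K) ((i.+1%:R <= y)%R)%:R.
Proof.
elim: K => [|K IH] y0; first by rewrite big_ord0 => y1; split => //; lra.
rewrite big_ord_recr/= => yK1.
have [yK|Ky] := leP y K%:R.
  have [l1 l2] := IH y0 yK.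
  have /negbTE-> : ~~ (K.+1%:R <= y) by rewrite -ltNge (le_lt_trans yK)// ltr_nat.
  by rewrite addr0.
have -> : \sum_(i < K) ((i.+1%:R <= y)%R)%:R = K%:R :> R.
  rewrite (eq_bigr (fun=> 1)) ?sumr_const ?card_ord// => i _.
  by rewrite (le_trans _ (ltW Ky))// ler_nat.
have K1 : K.+1%:R = K%:R + 1 :> R by rewrite -natr1.
have [yK|yK] := leP K.+1%:R y; rewrite ?addr0 ?mulr1n.
  by split; lra.
by split; lra.
Qed.

(** * From upper bounds on closed sets to weak-star convergence *)

Section portmanteau.
Variables (R : realType) (n : nat) (X : set (euclidean R n)).
Notation T := (euclidean R n).
Hypothesis compactX : compact X.
Let mX : measurable X. Proof. exact: compact_measurable_euclidean. Qed.

Lemma closed_superlevel (f : T -> R) (a : R) : {within X, continuous f} ->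
  closed [set x | X x /\ a <= f x].
Proof.
move=> /subspace_continuousP cf x clx.
have Xx : X x.
  apply: (compact_closed_euclidean compactX) => B nB.
  by have [y [[Xy _] By]] := clx B nB; exists y.
split => //; rewrite leNgt; apply/negP => fxa.
have : \forall y \near within X (nbhs x), f y < a by apply: (cvgr_lt _ (cf x Xx)).
move=> /clx[y [[Xy ay] /(_ Xy)]] /=.
by rewrite ltNge ay.
Qed.

Lemma measurable_within_continuous (f : T -> R) : {within X, continuous f} ->
  measurable_fun X f.
Proof.
move=> cf; apply: (measurability _ (RGenCInfty.measurableE R)).
move=> _ [_ [a ->] <-]; apply: closed_measurable_euclidean.
rewrite (_ : _ `&` _ = [set x | X x /\ a <= f x]); first exact: closed_superlevel.
by apply/seteqP; split => x /=; rewrite in_itv/= andbT.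
Qed.

Lemma within_continuous_bounded (f : T -> R) : {within X, continuous f} ->
  exists2 B, 0 < B & forall x, X x -> `|f x| <= B.
Proof.
move=> cf; have := compact_bounded (continuous_compact cf compactX).
move=> [M [_ HM]]; exists (`|M| + 1); first by rewrite ltr_wpDl.
move=> x Xx; apply: (HM (`|M| + 1)); last by exists x.
by rewrite (le_lt_trans (ler_norm M))// ltrDl.
Qed.

(* Each superlevel set is closed, so bounds on the masses of closed sets bound
   integrals up to the layer height [h]. *)
Lemma layer_integral (nu : probability T R) (f : T -> R) (B h : R) (K : nat) :
  nu X = 1%E -> bmeas f -> {within X, continuous f} -> 0 < h ->
  (forall x, X x -> `|f x| <= B) -> 2 * B <= K%:R * h ->
  let S := - B + h * \sum_(i < K) fine (nu [set x | X x /\ - B + i.+1%:R * h <= f x]) in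
  S <= \int[nu]_(x in X) f x /\ \int[nu]_(x in X) f x <= S + h.
Proof.
move=> nuX bf cf h0 fB KB S.
have nuXoo : (nu X < +oo)%E by rewrite nuX ltry.
pose F (i : nat) := [set x | X x /\ - B + i.+1%:R * h <= f x].
have mF i : measurable (F i) by apply: closed_measurable_euclidean; exact: closed_superlevel.
pose g x : R := - B + h * \sum_(i < K) 1 * \1_(F i) x.
have bi (i : 'I_K) : bmeas (\1_(F i) : T -> R) by exact: bmeas_indic.
have bs := bmeas_sum (fun=> 1) bi.
have bB : bmeas (fun _ : T => - B) by exact: bmeas_cst.
have bhs : bmeas (fun x => h * \sum_(i < K) 1 * \1_(F i) x).
  by apply: bmeasM => //; exact: bmeas_cst.
have bg : bmeas g by exact: bmeasD.
have sI := signed_restr1 mX nuXoo.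
have gE : \int[nu]_(x in X) g x = S.
  rewrite /g (signed_linD sI bB bhs) (signed_linZ h sI bs) (signed_lin_sum _ sI bi).
  rewrite (Rintegral_cst_prob _ mX nuX) /S; congr (_ + h * _).
  apply: eq_bigr => i _; rewrite -RintegralZl//; last exact: bmeas_integrable_restr.
  by rewrite Rintegral_indic// mul1r setIidr// => x [].
have gf x : X x -> g x <= f x /\ f x <= g x + h.
  move=> Xx; have /andP[f1 f2] : - B <= f x <= B by rewrite -ler_norml fB.
  have [||l1 l2] := @layer_count R K ((f x + B) / h).
  - by rewrite divr_ge0 ?(ltW h0)// -lerBlDr sub0r.
  - by rewrite ler_pdivrMr// (le_trans _ KB)//; lra.
  have SE : \sum_(i < K) 1 * \1_(F i) x = \sum_(i < K) ((i.+1%:R <= (f x + B) / h)%R)%:R :> R.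
    apply: eq_bigr => i _; rewrite mul1r indicE ler_pdivlMr// -lerBlDr addrC.
    have [h1|/negP h1] := boolP (- B + i.+1%:R * h <= f x); first by rewrite mem_set.
    by rewrite memNset// => -[].
  rewrite /g SE; move: l1 l2; rewrite ler_pdivlMr// ler_pdivrMr//.
  by move: (\sum_(i < K) _) => s l1 l2; split; lra.
rewrite -gE; split; first by apply: le_Rintegral_bmeas => // x /gf[].
rewrite -[X in _ + X](Rintegral_cst_prob h mX nuX) -(signed_linD sI bg (bmeas_cst T h)).
apply: le_Rintegral_bmeas => //; last by move=> x /gf[].
by apply: bmeasD => //; exact: bmeas_cst.
Qed.

Section limit.
Variables (mu_ : R -> probability T R) (mu : probability T R).
Hypotheses (muX : mu X = 1%E) (mu_X : \forall t \near +oo, mu_ t X = 1%E).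
Hypothesis limsup_closed : forall (F : set T) (eps : R), closed F -> F `<=` X -> 0 < eps ->
  \forall t \near +oo, fine (mu_ t F) <= fine (mu F) + eps.

(** Half of [eps] is the layer height [h]. The other half is [h] times the total excess of the [K]
    layers, each of which is allowed [K^-1]. *)
Let limsup_Rintegral (f : T -> R) (eps : R) : bmeas f -> {within X, continuous f} ->
  0 < eps -> \forall t \near +oo, \int[mu_ t]_(x in X) f x <= \int[mu]_(x in X) f x + eps.
Proof.
move=> bf cf e0; have [B B0 fB] := within_continuous_bounded cf.
pose h := eps / 2; have h0 : 0 < h by rewrite divr_gt0.
pose K := (Num.truncn (2 * B / h)).+1.
have KB : 2 * B <= K%:R * h by rewrite -ler_pdivrMr// ltW// truncnS_gt.
pose F (i : nat) := [set x | X x /\ - B + i.+1%:R * h <= f x].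
have K0 : 0 < K%:R :> R by rewrite ltr0n.
have ev : \forall t \near +oo, forall i : 'I_K, fine (mu_ t (F i)) <= fine (mu (F i)) + K%:R^-1.
  apply: filter_forall => i; apply: limsup_closed; rewrite ?invr_gt0//.
    exact: closed_superlevel.
  by move=> x [].
have [lo _] := layer_integral muX bf cf h0 fB KB.
apply: filterS2 mu_X ev => t tX evt.
have [_ hi] := layer_integral tX bf cf h0 fB KB.
apply: (le_trans hi); apply: (@le_trans _ _ (- B + h * (\sum_(i < K) fine (mu (F i)) + 1) + h)).
  rewrite lerD2r lerD2l ler_wpM2l ?(ltW h0)//.
  apply: (@le_trans _ _ (\sum_(i < K) (fine (mu (F i)) + K%:R^-1))).
    by apply: ler_sum => i _; exact: evt.
  by rewrite big_split/= sumr_const card_ord -[K%:R^-1 *+ K]mulr_natr mulVf// gt_eqF.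
have -> : eps = h + h by rewrite /h; field.
by rewrite addrA lerD2r mulrDr mulr1 addrA lerD2r.
Qed.

(** The lower bound is the upper bound for [- f]. As [f0] is arbitrary outside [X], it is first
    replaced there by 0, which makes it bounded and measurable everywhere. *)
Lemma portmanteau_weak_star : weak_star_cvg X (mu_ t @[t --> +oo]) mu.
Proof.
move=> f0 cf0.
pose f := f0 \_ X.
have fE x : X x -> f x = f0 x by move=> Xx; rewrite /f patchE mem_set.
have int_eq (nu : probability T R) : \int[nu]_(x in X) f0 x = \int[nu]_(x in X) f x.
  by apply: eq_Rintegral => x; rewrite inE => /fE.
have cf : {within X, continuous f}.
  by apply: subspace_eq_continuous cf0 => x; rewrite inE => /fE.
have [B B0 fB] := within_continuous_bounded cf.
have bf : bmeas f.
  split.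
    apply/(measurable_restrict _ mX measurableT); rewrite setTI.
    exact: measurable_within_continuous.
  exists B => x; have [Xx|nXx] := pselect (X x); first exact: fB.
  by rewrite /f patchE memNset// normr0 ltW.
have bNf : bmeas (fun x => -1 * f x) by apply: bmeasM => //; exact: bmeas_cst.
have cNf : {within X, continuous (fun x => -1 * f x)}.
  by move=> x; apply: cvgM; [exact: cvg_cst|exact: cf].
have intN (nu : probability T R) : nu X = 1%E ->
    \int[nu]_(x in X) (-1 * f x) = - (\int[nu]_(x in X) f x).
  move=> nuX; have nuXoo : (nu X < +oo)%E by rewrite nuX ltry.
  by rewrite (signed_linZ (-1) (signed_restr1 mX nuXoo) bf) mulN1r.
rewrite int_eq; under eq_cvg do rewrite int_eq.
apply/cvgrPdist_le => e e0.
have h1 := limsup_Rintegral bf cf e0.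
have h2 := limsup_Rintegral bNf cNf e0.
apply: filterS3 mu_X h1 h2 => t tX t1; rewrite !intN// => t2.
change (`|\int[mu]_(x in X) f x - \int[mu_ t]_(x in X) f x| <= e).
move: t1 t2; move: (\int[mu_ t]_(x in X) f x) (\int[mu]_(x in X) f x) => a b t1 t2.
by rewrite ler_norml; apply/andP; split; lra.
Qed.

End limit.

End portmanteau.

Theorem theorem9p9 (R : realType) (n : nat) (X : set (euclidean R n))
    (compactX : compact X) (X_neq0 : lebesgue_euclidean R n X != 0%E) :
  exists2 mu : probability (euclidean R n) R,
    is_uniform_measure X mu &
    forall A : set (euclidean R n), measurable A ->
      mu A = (lebesgue_euclidean R n (A `&` X) / lebesgue_euclidean R n X)%E.
Proof.
have mX := compact_measurable_euclidean compactX.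
have X_gt0 : (0 < lebesgue_euclidean R n X)%E by rewrite lt0e X_neq0 measure_ge0.
have Xoo := lebesgue_compact_fin compactX.
have V0 : 0 < fine (lebesgue_euclidean R n X) by rewrite fine_gt0// X_gt0.
have VE : lebesgue_euclidean R n X = (fine (lebesgue_euclidean R n X))%:E.
  by rewrite fineK// ge0_fin_numE.
have VI : ((lebesgue_euclidean R n X)^-1)%E = ((fine (lebesgue_euclidean R n X))^-1)%:E.
  by rewrite {1}VE inver gt_eqF.
have X0 : X !=set0.
  by apply/set0P; apply: contraNneq X_neq0 => ->; rewrite measure0.
(* [mnormalize] falls back to the point mass when the total mass is 0 or infinite; [X_neq0] and
   [Xoo] exclude both. *)
pose mu : probability (euclidean R n) R :=
  mnormalize (mrestr (lebesgue_euclidean R n) mX) (@dirac _ _ point R).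
have muE A : mu A = (lebesgue_euclidean R n (A `&` X) / lebesgue_euclidean R n X)%E.
  rewrite /mu /= /mnormalize /= /mrestr setTI (negbTE X_neq0)/=.
  rewrite (_ : (_ == +oo)%E = false) ?(lt_eqF Xoo)//.
  by rewrite VI.
have muX : mu X = 1%E.
  by rewrite muE setIid VI {1}VE -EFinM divff// gt_eqF.
have [mu_ mu_eq] : exists mu_ : R -> probability (euclidean R n) R,
    forall t, 0 < t -> exists e, equilibrium X t (mu_ t) e.
  (* For [t <= 0] the family takes the filler value [mu]; the limit only sees large [t]. *)
  have /choice[mu_ h] : forall t : R, exists nu : probability (euclidean R n) R,
      0 < t -> exists e, equilibrium X t nu e.
    move=> t; have [t0|_] := ltP 0 t; last by exists mu.
    by have [nu [e eqe]] := exists_equilibrium compactX X0 t0; exists nu => _; exists e.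
  by exists mu_.
exists mu => [|A _]; last exact: muE.
split; first exact: muX.
exists mu_; split.
  apply: filterS (nbhs_pinfty_gt (num_real 0)) => t t0.
  by have [e eqe] := mu_eq t t0; exact: (equilibrium_unique compactX t0 eqe).
apply: portmanteau_weak_star => //.
  apply: filterS (nbhs_pinfty_gt (num_real 0)) => t t0.
  by have [e []] := mu_eq t t0.
move=> F eps cF FX e0.
have := equilibrium_closed_limsup compactX X_gt0 mu_eq cF FX e0.
have mF := closed_measurable_euclidean cF.
have Foo : (lebesgue_euclidean R n F < +oo)%E.
  by apply: le_lt_trans Xoo; rewrite le_measure ?inE.
have -> : fine (mu F) = fine (lebesgue_euclidean R n F) / fine (lebesgue_euclidean R n X).
  by rewrite muE setIidl// VI fineM// ge0_fin_numE.
by [].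
Qed.
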